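(* The spectrum (in $\mathcal{H}\times\mathcal{H}$) of the linear stability problem $$L_-v=\lambda(1-\varphi^2)u,\qquad -L_+u=\lambda(1-\varphi^2)v$$ consists only of isolated eigenvalues of finite multiplicity and admits no finite accumulation points.
   Context: Let $\varphi(x)=\tanh(x)$, so that $1-\varphi^2=\mathrm{sech}^2(x)$, and $L_+=-\partial_x^2+6\varphi^2-2$, $L_-=-\partial_x^2+2\varphi^2-2$. Let $\mathcal{H}=\{f\in L^2_{\rm loc}(\mathbb{R}):\sqrt{1-\varphi^2}f\in L^2(\mathbb{R})\}$ with inner product $(f,g)_{\mathcal{H}}=\int_{\mathbb{R}}(1-\varphi^2)\bar fg\,dx$. Let $\mathcal{H}^1_+=H^1(\mathbb{R})$, $\mathcal{H}^1_-=\{f\in\mathcal{H}:f'\in L^2(\mathbb{R})\}$, $\mathcal{H}^2_\pm=\{f\in\mathcal{H}^1_\pm:\cosh^2(\cdot)L_\pm f\in\mathcal{H}\}$ and $\mathcal{L}_\pm=\cosh^2(\cdot)L_\pm:\mathcal{H}^2_\pm\subset\mathcal{H}\to\mathcal{H}$. The stability problem is equivalently $\mathcal{L}_-v=\lambda u$, $-\mathcal{L}_+u=\lambda v$, i.e. the spectral problem for the operator $\begin{pmatrix}0&\mathcal{L}_-\\-\mathcal{L}_+&0\end{pmatrix}$ in $\mathcal{H}\times\mathcal{H}$ with domain $\mathcal{H}^2_+\times\mathcal{H}^2_-\ni(u,v)$. *)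

(* Defs.v *)
From HB Require Import structures.
From mathcomp Require Import all_boot all_order all_algebra.
From mathcomp Require Import all_classical all_reals all_analysis.
From mathcomp Require Export complex.
Set Implicit Arguments.
Unset Strict Implicit.
Unset Printing Implicit Defensive.
Import Order.TTheory GRing.Theory Num.Theory.
Import numFieldNormedType.Exports.
Local Open Scope classical_set_scope.
Local Open Scope ring_scope.
Local Open Scope complex_scope.

Section ComplexFunctions.
Variable R : realType.
Local Notation C := R[i].
Local Notation mu := (@lebesgue_measure R).
Implicit Types f g : R -> C.

Definition ReF f : R -> R := fun x => complex.Re (f x).
Definition ImF f : R -> R := fun x => complex.Im (f x).

Definition Cint f : C := (\int[mu]_x ReF f x) +i* (\int[mu]_x ImF f x).

Definition L1loc f : Prop :=
  locally_integrable [set: R] (ReF f) /\ locally_integrable [set: R] (ImF f).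

Definition L2 f : Prop :=
  (ReF f \in Lfun mu 2%:E) /\ (ImF f \in Lfun mu 2%:E).

Definition L2loc f : Prop :=
  forall K : set R, compact K -> L2 (fun x => (\1_K x)%:C * f x).

Definition test_function (psi : R -> R) : Prop :=
  (forall (n : nat) (x : R), derivable (derive1n n psi) x 1) /\
  compact (closure [set x | psi x != 0]).

(* Real-valued test functions suffice: the identity below is linear in psi. *)
Definition is_wderiv (n : nat) f g : Prop :=
  [/\ L1loc f, L1loc g &
    forall psi : R -> R, test_function psi ->
      Cint (fun x => (derive1n n psi x)%:C * f x) =
      (-1) ^+ n * Cint (fun x => (psi x)%:C * g x)].

Definition weakly_derivable (n : nat) f : Prop := exists g, is_wderiv n f g.

(* A chosen representative of the n-th weak derivative, which is unique up to
   almost everywhere equality, and the zero function if there is none. *)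
Definition wderiv (n : nat) f : R -> C :=
  xget (fun=> 0) [set g | is_wderiv n f g].

End ComplexFunctions.

Section Operators.
Variable R : realType.
Local Notation C := R[i].
Implicit Types f g : R -> C.

Definition cosh (x : R) : R := (expR x + expR (- x)) / 2.
Definition tanh (x : R) : R := (expR x - expR (- x)) / (expR x + expR (- x)).

Definition phi : R -> R := tanh.

(* Functions stand for their classes modulo almost everywhere equality. *)
Definition H f : Prop :=
  L2loc f /\ L2 (fun x => (Num.sqrt (1 - phi x ^+ 2))%:C * f x).

Definition dotH f g : C :=
  Cint (fun x => (1 - phi x ^+ 2)%:C * ((f x)^*%C * g x)).

Definition Lplus f : R -> C :=
  fun x => - wderiv 2 f x + (6 * phi x ^+ 2 - 2)%:C * f x.
Definition Lminus f : R -> C :=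
  fun x => - wderiv 2 f x + (2 * phi x ^+ 2 - 2)%:C * f x.

Definition calLplus f : R -> C := fun x => (cosh x ^+ 2)%:C * Lplus f x.
Definition calLminus f : R -> C := fun x => (cosh x ^+ 2)%:C * Lminus f x.

Definition H1plus f : Prop :=
  [/\ L2 f, weakly_derivable 1 f & L2 (wderiv 1 f)].
Definition H1minus f : Prop :=
  [/\ H f, weakly_derivable 1 f & L2 (wderiv 1 f)].

(* For f in H1plus or H1minus, if the distribution cosh^2 L f belongs to H,
   then f'' is a locally integrable function; hence asking for the second weak
   derivative, without which wderiv 2 f is meaningless, is no restriction. *)
Definition H2plus f : Prop :=
  [/\ H1plus f, weakly_derivable 2 f & H (calLplus f)].
Definition H2minus f : Prop :=
  [/\ H1minus f, weakly_derivable 2 f & H (calLminus f)].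

End Operators.

Section Spectrum.
Variable R : realType.
Local Notation C := R[i].
Local Notation X := ((R -> C) * (R -> C))%type.
Local Notation mu := (@lebesgue_measure R).

Definition HH (w : X) : Prop := H w.1 /\ H w.2.

Definition aeeq (w z : X) : Prop :=
  w.1 = z.1 %[ae mu] /\ w.2 = z.2 %[ae mu].

Definition normHH (w : X) : R :=
  Num.sqrt (complex.Re (dotH w.1 w.1 + dotH w.2 w.2)).

(* D is the domain of the operator, A its action on (representatives of) the
   elements of D. *)
Variables (D : set X) (A : X -> X).

Definition resolvent_set : set C := [set lam |
  [/\ forall F, HH F -> exists2 w, D w & aeeq (A w - lam *: w) F,
      forall w z, D w -> D z ->
        aeeq (A w - lam *: w) (A z - lam *: z) -> aeeq w z &
      exists K : R, forall w, D w -> normHH w <= K * normHH (A w - lam *: w)]].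

Definition spectrum : set C := ~` resolvent_set.

Definition eigenvalue_of (lam : C) : Prop :=
  exists w, [/\ D w, ~ aeeq w 0 & aeeq (A w) (lam *: w)].

(* The kernel of (A - lam)^k, on its natural domain. *)
Fixpoint ker_pow (lam : C) (k : nat) (w : X) : Prop :=
  if k is k'.+1 then D w /\ ker_pow lam k' (A w - lam *: w) else aeeq w 0.

(* Algebraic multiplicity: the union over k of the kernels of (A - lam)^k has
   finite dimension (modulo almost everywhere equality). *)
Definition finite_multiplicity (lam : C) : Prop :=
  exists (n : nat) (b : 'I_n -> X), forall k w, ker_pow lam k w ->
    exists c : 'I_n -> C, aeeq w (\sum_(i < n) c i *: b i).

End Spectrum.

Section StabilityProblem.
Variable R : realType.
Local Notation C := R[i].
Local Notation X := ((R -> C) * (R -> C))%type.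

Definition stab_domain : set X := [set w | H2plus w.1 /\ H2minus w.2].

Definition stab_op (w : X) : X := (calLminus w.2, - calLplus w.1).

(* On complex R the library's topology is the one of the regular module C^o. *)
Definition stab_spectrum : set C^o := spectrum stab_domain stab_op.

End StabilityProblem.

(* Main.v *)
Require Import Defs.
From HB Require Import structures.
From mathcomp Require Import all_boot all_order all_algebra.
From mathcomp Require Import all_classical all_reals all_analysis.
From mathcomp Require Import complex measurable_realfun ring lra.
Set Implicit Arguments.
Unset Strict Implicit.
Unset Printing Implicit Defensive.
Import Order.TTheory GRing.Theory Num.Theory.
Import numFieldNormedType.Exports.
Local Open Scope classical_set_scope.
Local Open Scope ring_scope.

(** Write A for the operator (u, v) |-> (cosh^2 L_- v, - cosh^2 L_+ u) of the
    stability problem. The spectrum is discrete because A is, up to a bounded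
    perturbation, the inverse of a compact operator; the proof makes this
    explicit, in a form in which compactness is replaced by a pointwise
    estimate.

    The parametrix. As phi^2 = 1 - sech^2, one has L_+ = - d^2 + 4 - 6 sech^2
    and L_- = - d^2 - 2 sech^2. Therefore cosh^2 L_+ + 6 = cosh^2 (- d^2 + 4),
    which is inverted by [Rp], an integral operator with kernel
    exp (- 2 |x - y|) sech^2 y / 4. Similarly cosh^2 L_- + 2 = - cosh^2 d^2; the
    domain only asks v' to be square-integrable, so this operator kills the
    constants, but it becomes invertible, with inverse [Rm], once the rank-one
    operator v |-> \int sech^2 v is added. Altogether T (F, G) = (- Rp G, Rm F)
    satisfies A T = 1 + B T and T (A - B) = 1 with B bounded.

    Carleman operators. The exponential decay of sech^2 gives a bound
    |(T w)(t)|^2 <= c ||w||^2, uniform in t. Summing such a bound over an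
    orthonormal family and integrating it against the finite measure sech^2 dx
    shows that T is Hilbert-Schmidt ([carleman_hilbert_schmidt]). Two
    consequences carry the spectral theory. First, an operator K of this kind is
    a finite-rank operator plus a contraction, so that 1 - K satisfies the
    Fredholm alternative ([fredholm_alternative]). Second, if K is triangular
    along an orthonormal family, the squares of its diagonal entries have a
    bounded sum ([flag_bound]).

    The spectrum. The equation (A - lam) w = y is w = T y + T (lam - B) w, and
    T (lam - B) is again a Carleman operator; hence every lam is an eigenvalue
    or belongs to the resolvent set ([not_eigen_resolvent]). The point 1 + i is
    not an eigenvalue ([no_eigenvector]): for an eigenvector (u, v) of lam, the
    quadratic forms of L_+ and L_- are real and force lam^2 to be real, unless
    the form of L_+ vanishes at u; then L_+ u = 0 since L_+ is D^* D with
    D = d + 2 phi, and so v = 0 and u = 0. Consequently S = (A - (1 + i))^-1 is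
    a Carleman operator. The root vectors of A for lam, and the eigenvectors of
    A for different lam, produce triangular families for S with diagonal entries
    1 / (lam - (1 + i)), and the bound on their squares says that root spaces
    have finite dimension ([root_space_finite]) and that every disc contains
    finitely many eigenvalues ([eigen_discrete]).

    The domains are phrased with weak derivatives. By the lemma of du
    Bois-Reymond these are the derivatives of absolutely continuous functions
    ([wd_AC], [weak2_AC]), for which integration by parts is Fubini's theorem on
    a triangle ([AC_mul]), without boundary terms as soon as the integrand is
    the derivative of a square-integrable function ([AC_total]). *)

Local Open Scope complex_scope.

(** * Semi-inner products with point evaluations *)

Section SquaredModulus.
Variable R : realType.
Implicit Types z w : R[i].

Definition sqmod z : R := complex.Re z ^+ 2 + complex.Im z ^+ 2.

Lemma sqmod_ge0 z : 0 <= sqmod z.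
Proof. by rewrite addr_ge0 // sqr_ge0. Qed.

Lemma sqmod0 : sqmod 0 = 0. Proof. by rewrite /sqmod /= !expr0n addr0. Qed.

Lemma sqmodN z : sqmod (- z) = sqmod z.
Proof. by case: z => a b; rewrite /sqmod /= !sqrrN. Qed.

Lemma sqmodM z w : sqmod (z * w) = sqmod z * sqmod w.
Proof. by case: z w => [a b] [c d]; rewrite /sqmod /=; ring. Qed.

Lemma sqmodJ z : sqmod (z^*)%C = sqmod z.
Proof. by case: z => a b; rewrite /sqmod /= sqrrN. Qed.

Lemma sqmodD z w : sqmod (z + w) <= 2 * sqmod z + 2 * sqmod w.
Proof.
case: z w => [a b] [c d]; rewrite /sqmod /=.
have := sqr_ge0 (a - c); have := sqr_ge0 (b - d); lra.
Qed.

Lemma mulJc z : (z^*)%C * z = (sqmod z)%:C.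
Proof.
case: z => a b; apply/eqP; rewrite eq_complex /sqmod /=; apply/andP.
by split; apply/eqP; ring.
Qed.

Lemma sqmod_eq0 z : (sqmod z == 0) = (z == 0).
Proof.
case: z => a b; rewrite /sqmod /= paddr_eq0 ?sqr_ge0 // !sqrf_eq0.
by rewrite [RHS]eq_complex.
Qed.

Lemma sqmodC (x : R) : sqmod x%:C = x ^+ 2.
Proof. by rewrite /sqmod /= expr0n addr0. Qed.

Lemma sqmodV z : sqmod z^-1 = (sqmod z)^-1.
Proof.
have [->|z0] := eqVneq z 0; first by rewrite invr0 sqmod0 invr0.
have h : sqmod z^-1 * sqmod z = 1 by rewrite -sqmodM mulVf // sqmodC expr1n.
have nz : sqmod z != 0 by rewrite sqmod_eq0.
by apply: (mulIf nz); rewrite h mulVf.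
Qed.

End SquaredModulus.

(** The vectors are functions, not classes, so the inner product [ip] may be
    degenerate while the evaluations [ev] separate vectors. The field
    [ip_dominated] is the trace of an underlying measure: it integrates a
    pointwise bound against the weight, whose integral is [mass]. The field
    [ev_complete] is the only completeness that a Neumann series uses: uniform
    geometric convergence, where 1/4 is the square of the ratio 1/2; the 8 is
    4 for each of the real and imaginary parts. *)
Record carleman_space (R : realType) (V : lmodType R[i]) := CarlemanSpace {
  ip : V -> V -> R[i];
  point : Type;
  ev : point -> V -> R[i];
  weight : point -> R;
  mass : R;
  ip_linear : forall x a y z, ip x (a *: y + z) = a * ip x y + ip x z;
  ip_conj : forall x y, ip y x = (ip x y)^*%C;
  ip_ge0 : forall x, 0 <= complex.Re (ip x x);
  ev_linear : forall t a x y, ev t (a *: x + y) = a * ev t x + ev t y;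
  ev_sep : forall x, (forall t, ev t x = 0) -> x = 0;
  weight_ge0 : forall t, 0 <= weight t;
  mass_ge0 : 0 <= mass;
  ip_dominated : forall (s : seq V) (r : R), 0 <= r ->
    (forall t, \sum_(x <- s) sqmod (ev t x) <= r * weight t) ->
    \sum_(x <- s) complex.Re (ip x x) <= r * mass;
  ev_complete : forall (x : nat -> V) (r : R), 0 <= r ->
    (forall n t, sqmod (ev t (x n.+1 - x n)) <= r * 4^-1 ^+ n * weight t) ->
    exists y, forall n t, sqmod (ev t (y - x n)) <= 8 * r * 4^-1 ^+ n * weight t }.

Section CarlemanSpace.
Variables (R : realType) (V : lmodType R[i]) (E : carleman_space V).
Local Notation C := R[i].
Implicit Types (x y z : V) (s : seq V).
Local Notation "<< x , y >>" := (ip E x y).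
Local Notation ev := (@ev _ _ E).

Definition sqnorm x : R := complex.Re << x, x >>.

Lemma ipDr x y z : << x, y + z >> = << x, y >> + << x, z >>.
Proof. by rewrite -[y]scale1r ip_linear mul1r scale1r. Qed.

Lemma ip0r x : << x, 0 >> = 0.
Proof. by have := ipDr x 0 0; rewrite addr0 => /esym/eqP; rewrite -subr_eq0 addrK => /eqP. Qed.

Lemma ipZr x a y : << x, a *: y >> = a * << x, y >>.
Proof. by rewrite -[a *: y]addr0 ip_linear ip0r addr0. Qed.

Lemma ipNr x y : << x, - y >> = - << x, y >>.
Proof. by rewrite -scaleN1r ipZr mulN1r. Qed.

Lemma ipBr x y z : << x, y - z >> = << x, y >> - << x, z >>.
Proof. by rewrite ipDr ipNr. Qed.

Lemma ip_sumr I (r : seq I) x (F : I -> V) :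
  << x, \sum_(i <- r) F i >> = \sum_(i <- r) << x, F i >>.
Proof. by elim/big_rec2: _ => [|i a b _ <-]; rewrite ?ip0r // ipDr. Qed.

Lemma ipDl x y z : << x + y, z >> = << x, z >> + << y, z >>.
Proof. by rewrite ip_conj ipDr rmorphD /= -!ip_conj. Qed.

Lemma ipZl x a y : << a *: x, y >> = (a^*)%C * << x, y >>.
Proof. by rewrite ip_conj ipZr rmorphM /= -ip_conj. Qed.

Lemma ipNl x y : << - x, y >> = - << x, y >>.
Proof. by rewrite ip_conj ipNr rmorphN /= -ip_conj. Qed.

Lemma ipxx x : << x, x >> = (sqnorm x)%:C.
Proof.
have := ip_conj E x x; rewrite /sqnorm; case: (ip E x x) => a b /= [] h.
by congr (_ +i* _); lra.
Qed.

Lemma sqnorm_ge0 x : 0 <= sqnorm x. Proof. exact: ip_ge0. Qed.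

Lemma sqnorm0 : sqnorm 0 = 0. Proof. by rewrite /sqnorm ip0r. Qed.

Lemma sqnormZ a x : sqnorm (a *: x) = sqmod a * sqnorm x.
Proof.
rewrite {1}/sqnorm ipZl ipZr mulrA mulJc ipxx.
by rewrite -rmorphM.
Qed.

Lemma sqnormN x : sqnorm (- x) = sqnorm x.
Proof. by rewrite /sqnorm ipNl ipNr opprK. Qed.

Lemma sqnormBC x y : sqnorm (x - y) = sqnorm (y - x).
Proof. by rewrite -sqnormN opprB. Qed.

Lemma ReD (z w : C) : complex.Re (z + w) = complex.Re z + complex.Re w.
Proof. by case: z w => [a b] [c d]. Qed.

Lemma sqnormD_expand x y :
  sqnorm (x + y) = sqnorm x + 2 * complex.Re << x, y >> + sqnorm y.
Proof.
rewrite {1}/sqnorm ipDl !ipDr (ip_conj E x y) !ReD -!/(sqnorm _).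
by case: (ip E x y) => a b /=; ring.
Qed.

Lemma sqnormD x y : sqnorm (x + y) <= 2 * sqnorm x + 2 * sqnorm y.
Proof.
have := sqnorm_ge0 (x - y); rewrite !sqnormD_expand ipNr sqnormN.
by case: (ip E x y) => a b /=; lra.
Qed.

Lemma sqnorm_pythagoras x y : << x, y >> = 0 ->
  sqnorm (x + y) = sqnorm x + sqnorm y.
Proof. by move=> h; rewrite sqnormD_expand h mulr0 addr0. Qed.

(** Positivity of the norm of y - (t <x, y>) x, at t = 1 / |x|^2, or for a
    large t when x is a null vector. *)
Lemma cauchy_schwarz x y : sqmod << x, y >> <= sqnorm x * sqnorm y.
Proof.
have key (t : R) : 0 <= sqnorm y - 2 * t * sqmod << x, y >>
    + t ^+ 2 * sqmod << x, y >> * sqnorm x.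
  have := sqnorm_ge0 (y - (t%:C * << x, y >>) *: x).
  rewrite sqnormD_expand ipNr sqnormN sqnormZ sqmodM sqmodC ipZr.
  rewrite (ip_conj E x y).
  case: (ip E x y) => a b; rewrite /sqmod /=.
  set u := _ + _ + _; set w := _ - _ + _; suff -> : u = w by [].
  rewrite /u /w; ring.
move: key (sqnorm_ge0 x) (sqmod_ge0 << x, y >>).
move: (sqnorm x) (sqnorm y) (sqmod _) => N M m key N0 m0.
case: (ltrgtP 0 N) N0 key => [N0 _|//|<- _] key; rewrite ?mul0r.
  have := key N^-1; have -> : M - 2 * N^-1 * m + N^-1 ^+ 2 * m * N = M - m / N.
    by field; rewrite gt_eqF.
  by rewrite subr_ge0 ler_pdivrMr // mulrC.
rewrite leNgt; apply/negP => m1.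
have := key ((M + 1) / (2 * m)).
have -> : 2 * ((M + 1) / (2 * m)) * m = M + 1 by field; rewrite gt_eqF.
by rewrite mulr0 addr0; lra.
Qed.

Lemma sqnorm_eq0_ip x y : sqnorm x = 0 -> << x, y >> = 0.
Proof.
move=> h; apply/eqP; rewrite -sqmod_eq0 eq_le sqmod_ge0 andbT.
by apply: le_trans (cauchy_schwarz _ _) _; rewrite h mul0r.
Qed.

Lemma sqnorm_eq0D x y : sqnorm x = 0 -> sqnorm (x + y) = sqnorm y.
Proof. by move=> h; rewrite sqnormD_expand h sqnorm_eq0_ip //= mulr0 !add0r. Qed.

(** For a space of functions, this is equality almost everywhere. *)
Definition eqv x y := sqnorm (x - y) = 0.
Local Notation "x ~= y" := (eqv x y) (at level 70).

Lemma eqv_refl x : x ~= x. Proof. by rewrite /eqv subrr sqnorm0. Qed.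

Lemma eqv_sym x y : x ~= y -> y ~= x.
Proof. by rewrite /eqv sqnormBC. Qed.

Lemma eqvD x x' y y' : x ~= x' -> y ~= y' -> x + y ~= x' + y'.
Proof. by move=> hx hy; rewrite /eqv opprD addrACA sqnorm_eq0D. Qed.

Lemma eqvZ a x y : x ~= y -> a *: x ~= a *: y.
Proof. by move=> h; rewrite /eqv -scalerBr sqnormZ h mulr0. Qed.

Lemma eqvN x y : x ~= y -> - x ~= - y.
Proof. by move=> h; rewrite /eqv -opprD sqnormN. Qed.

Lemma eqvB x x' y y' : x ~= x' -> y ~= y' -> x - y ~= x' - y'.
Proof. by move=> hx /eqvN; apply: eqvD. Qed.

Lemma eqv_trans y x z : x ~= y -> y ~= z -> x ~= z.
Proof. by move=> h1 h2; have := eqvD h1 h2; rewrite /eqv opprD addrA addrK. Qed.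

Lemma eqv_sqnorm x y : x ~= y -> sqnorm x = sqnorm y.
Proof. by move=> h; rewrite -[x](subrK y) sqnorm_eq0D. Qed.

Lemma eqv_ip x y z : x ~= y -> << z, x >> = << z, y >>.
Proof.
move=> h; apply/eqP; rewrite -subr_eq0 -ipBr ip_conj sqnorm_eq0_ip //.
by rewrite rmorph0.
Qed.

Fixpoint orthonormal s : Prop :=
  if s is e :: s' then
    [/\ sqnorm e = 1, forall f, f \in s' -> << e, f >> = 0 & orthonormal s']
  else True.

Definition proj s x : V := \sum_(e <- s) << e, x >> *: e.

Lemma projE_cons e s x : proj (e :: s) x = << e, x >> *: e + proj s x.
Proof. by rewrite /proj big_cons. Qed.

Lemma proj_linear s a x y : proj s (a *: x + y) = a *: proj s x + proj s y.
Proof.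
rewrite /proj scaler_sumr -big_split /=; apply: eq_bigr => e _.
by rewrite ip_linear scalerDl scalerA.
Qed.

Lemma proj0 s : proj s 0 = 0.
Proof. by rewrite /proj big1 // => e _; rewrite ip0r scale0r. Qed.

Lemma ip_comb0 s (c : V -> C) x : (forall f, f \in s -> << x, f >> = 0) ->
  << x, \sum_(f <- s) c f *: f >> = 0.
Proof.
move=> h; rewrite ip_sumr big_seq big1 // => f fs.
by rewrite ipZr h // mulr0.
Qed.

Lemma ip_comb s (c : V -> C) e : orthonormal s -> e \in s ->
  << e, \sum_(f <- s) c f *: f >> = c e.
Proof.
elim: s => // f s IH [f1 fs os]; rewrite inE big_cons ipDr ipZr => /predU1P[->|es].
  by rewrite ipxx f1 mulr1 ip_comb0 // addr0.
by rewrite (ip_conj E f e) fs // rmorph0 mulr0 add0r IH.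
Qed.

Lemma sqnorm_comb s (c : V -> C) : orthonormal s ->
  sqnorm (\sum_(f <- s) c f *: f) = \sum_(f <- s) sqmod (c f).
Proof.
elim: s => [|f s IH [f1 fs os]]; first by rewrite !big_nil sqnorm0.
rewrite !big_cons sqnorm_pythagoras ?IH // ?sqnormZ ?f1 ?mulr1 //.
by rewrite ipZl ip_comb0 ?mulr0.
Qed.

Lemma ip_proj s e x : orthonormal s -> e \in s -> << e, proj s x >> = << e, x >>.
Proof. by move=> os es; rewrite /proj (ip_comb (fun f => << f, x >>)). Qed.

Lemma ip_subproj s e x : orthonormal s -> e \in s -> << e, x - proj s x >> = 0.
Proof. by move=> os es; rewrite ipBr ip_proj // subrr. Qed.

Lemma ip_subproj_comb s (c : V -> C) x : orthonormal s ->
  << x - proj s x, \sum_(f <- s) c f *: f >> = 0.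
Proof.
move=> os; apply: ip_comb0 => f fs.
by rewrite ip_conj ip_subproj // rmorph0.
Qed.

Lemma sqnorm_proj s x : orthonormal s ->
  sqnorm x = sqnorm (x - proj s x) + \sum_(e <- s) sqmod << e, x >>.
Proof.
move=> os; rewrite -(sqnorm_comb (fun e => << e, x >>)) //.
by rewrite -sqnorm_pythagoras ?ip_subproj_comb // subrK.
Qed.

Lemma sqnorm_subproj_le s x : orthonormal s -> sqnorm (x - proj s x) <= sqnorm x.
Proof.
move=> os; rewrite [leRHS](sqnorm_proj x os) lerDl sumr_ge0 // => e _.
exact: sqmod_ge0.
Qed.

Lemma orthonormal_extend s x : orthonormal s -> sqnorm (x - proj s x) != 0 ->
  let c := (Num.sqrt (sqnorm (x - proj s x)))^-1 in
  orthonormal (c%:C *: (x - proj s x) :: s).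
Proof.
move=> os nz /=; split=> //.
  rewrite sqnormZ sqmodC exprVn sqr_sqrtr ?sqnorm_ge0 // mulVf //.
by move=> f fs; rewrite ipZl ip_conj ip_subproj // rmorph0 mulr0.
Qed.

End CarlemanSpace.

(** * Carleman operators and the Fredholm alternative *)

Section CarlemanOperators.
Variables (R : realType) (V : lmodType R[i]) (E : carleman_space V).
Local Notation C := R[i].
Implicit Types (x y z : V) (s : seq V) (K S : V -> V).
Local Notation "<< x , y >>" := (ip E x y).
Local Notation ev := (@ev _ _ E).
Local Notation weight := (@weight _ _ E).
Local Notation mass := (@mass _ _ E).
Local Notation sqnorm := (sqnorm E).
Local Notation "x ~= y" := (eqv E x y) (at level 70).

Definition is_linear K := forall a x y, K (a *: x + y) = a *: K x + K y.

(** Evaluation at a point after K is a bounded functional, with a bound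
    controlled by the weight; for an integral operator this bounds the norm of
    the kernel in its second variable. *)
Definition carleman (c : R) K :=
  [/\ is_linear K, 0 <= c &
   forall x t, sqmod (ev t (K x)) <= c * weight t * sqnorm x].

Definition bounded K := exists2 c : R, 0 <= c & forall x, sqnorm (K x) <= c * sqnorm x.

Section Linear.
Variable K : V -> V.
Hypothesis Klin : is_linear K.

Lemma lin0 : K 0 = 0.
Proof. by have := Klin (-1) 0 0; rewrite scaler0 addr0 scaleN1r addNr. Qed.

Lemma linD x y : K (x + y) = K x + K y.
Proof. by rewrite -[x]scale1r Klin !scale1r. Qed.

Lemma linZ a x : K (a *: x) = a *: K x.
Proof. by rewrite -[a *: x]addr0 Klin lin0 addr0. Qed.

Lemma linN x : K (- x) = - K x.
Proof. by rewrite -scaleN1r linZ scaleN1r. Qed.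

Lemma linB x y : K (x - y) = K x - K y.
Proof. by rewrite linD linN. Qed.

Lemma lin_sum I (r : seq I) (F : I -> V) :
  K (\sum_(i <- r) F i) = \sum_(i <- r) K (F i).
Proof. by elim/big_rec2: _ => [|i a b _ <-]; rewrite ?lin0 // linD. Qed.

End Linear.

Lemma ev0 t : ev t 0 = 0.
Proof. by have := ev_linear t (-1) 0 0; rewrite scaler0 addr0 mulN1r addNr. Qed.

Lemma evD t x y : ev t (x + y) = ev t x + ev t y.
Proof. by rewrite -[x]scale1r ev_linear mul1r scale1r. Qed.

Lemma evN t x : ev t (- x) = - ev t x.
Proof. by rewrite -[- x]addr0 -scaleN1r ev_linear ev0 addr0 mulN1r. Qed.

Section Bounds.
Variables (c : R) (K : V -> V).
Hypothesis KC : carleman c K.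
Let Klin : is_linear K. Proof. by case: KC. Qed.
Let c0 : 0 <= c. Proof. by case: KC. Qed.
Let Kle x t : sqmod (ev t (K x)) <= c * weight t * sqnorm x.
Proof. by case: KC. Qed.

Lemma carleman_sqnorm x : sqnorm (K x) <= c * mass * sqnorm x.
Proof.
have := @ip_dominated _ _ E [:: K x] (c * sqnorm x).
rewrite big_seq1 mulrAC; apply; first by rewrite mulr_ge0 ?sqnorm_ge0.
by move=> t; rewrite big_seq1 mulrAC.
Qed.

Lemma carleman_eqv0 x : sqnorm x = 0 -> K x = 0.
Proof.
move=> h; apply: (@ev_sep _ _ E) => t; apply/eqP; rewrite -sqmod_eq0 eq_le sqmod_ge0 andbT.
by have := Kle x t; rewrite h mulr0.
Qed.

(** Carleman operators turn equality modulo null vectors into equality, which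
    is what allows exact fixed-point equations below. *)
Lemma carleman_eqv x y : x ~= y -> K x = K y.
Proof. by move=> /carleman_eqv0/eqP; rewrite linB // subr_eq0 => /eqP. Qed.

(** At a fixed point t, test the pointwise bound on the combination of the e
    whose coefficients are the conjugates of (K e)(t): its image at t is the
    sum of the |(K e)(t)|^2, which is also its squared norm, so that this sum
    is at most c weight(t). It remains to integrate. *)
Lemma carleman_hilbert_schmidt s : orthonormal E s ->
  \sum_(e <- s) sqnorm (K e) <= c * mass.
Proof.
move=> os; have := @ip_dominated _ _ E (map K s) c c0.
rewrite !big_map; apply=> t; rewrite big_map.
pose x := \sum_(e <- s) (ev t (K e))^*%C *: e.
have qx : sqnorm x = \sum_(e <- s) sqmod (ev t (K e)).
  rewrite (sqnorm_comb (fun e => (ev t (K e))^*%C)) //.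
  by apply: eq_bigr => e _; rewrite sqmodJ.
have evs (F : V -> V) : ev t (\sum_(e <- s) F e) = \sum_(e <- s) ev t (F e).
  by elim/big_rec2: _ => [|i a b _ <-]; rewrite ?ev0 // evD.
have ex : ev t (K x) = (sqnorm x)%:C.
  rewrite qx /x lin_sum // evs raddf_sum /=.
  apply: eq_bigr => e _; rewrite linZ // -mulJc.
  by rewrite -[_ *: _]addr0 ev_linear ev0 addr0.
have := Kle x t; rewrite ex sqmodC expr2 -qx.
have := sqnorm_ge0 E x; rewrite le_eqVlt => /predU1P[<- _|x0].
  by rewrite mulr_ge0 ?weight_ge0.
by rewrite ler_pM2r.
Qed.

(** Choose s so that the sum of the squared norms of the K e, for e in s, is
    within eps of its supremum: a further unit vector orthogonal to s can then
    contribute at most eps. *)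
Lemma carleman_finite_rank_approx (eps : R) : 0 < eps ->
  exists2 s, orthonormal E s &
    forall x, sqnorm (K (x - proj E s x)) <= eps * sqnorm x.
Proof.
move=> e0; pose A := [set r : R | exists2 s, orthonormal E s & r = \sum_(e <- s) sqnorm (K e)].
have A0 : A !=set0 by exists 0; exists [::]; rewrite ?big_nil.
have Aub : has_ubound A.
  by exists (c * mass) => _ [s os ->]; exact: carleman_hilbert_schmidt.
have [_ [s os ->] hs] := sup_adherent e0 (conj A0 Aub).
exists s => // x; set y := x - _.
have := eqVneq (sqnorm y) 0 => -[y0|y0].
  by rewrite carleman_eqv0 // sqnorm0 mulr_ge0 ?sqnorm_ge0 // ltW.
have := orthonormal_extend os y0; set a := Num.sqrt _; move=> /= oe.
have : \sum_(e <- a^-1%:C *: y :: s) sqnorm (K e) <= sup A.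
  by apply: ub_le_sup => //; exists (a^-1%:C *: y :: s).
rewrite big_cons linZ // sqnormZ sqmodC exprVn sqr_sqrtr ?sqnorm_ge0 // => h.
have yp : 0 < sqnorm y by rewrite lt_def y0 sqnorm_ge0.
have : (sqnorm y)^-1 * sqnorm (K y) <= eps by lra.
rewrite mulrC ler_pdivrMr // => /le_trans; apply.
by rewrite ler_pM2l // sqnorm_subproj_le.
Qed.

End Bounds.

Lemma le_geometric0 (a b : R) : (forall n : nat, a <= b * 4^-1 ^+ n) -> a <= 0.
Proof.
move=> h; rewrite leNgt; apply/negP => a0.
have b0 : 0 < b by have := h 0; rewrite expr0 mulr1; lra.
have [n hn] : exists n : nat, b / a < n%:R.
  by exists (Num.bound (b / a)); apply: archi_boundP; rewrite divr_ge0 // ltW.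
have := h n; rewrite exprVn ler_pdivlMr ?exprn_gt0 //; apply/negP; rewrite -ltNge.
rewrite mulrC -ltr_pdivrMr //; apply: lt_le_trans hn _.
by rewrite -natrX ler_nat; apply: ltnW; apply: ltn_expl.
Qed.

(** The iterates of x |-> y + K x converge geometrically at every point, since
    the Carleman bound turns the decay of the norms into a pointwise one; no
    limit in norm is taken. *)
Lemma neumann c K : carleman c K -> (forall x, sqnorm (K x) <= 4^-1 * sqnorm x) ->
  forall y, exists2 x, x = y + K x & sqnorm x <= 4 * sqnorm y.
Proof.
move=> KC Kle y; have [Klin c0 Kev] := KC.
pose xs n := iter n (fun x => y + K x) y.
have xsS n : xs n.+1 = y + K (xs n) by [].
have dS n : xs n.+1 - xs n = K (iter n K y).
  elim: n => [|n IH]; first by rewrite xsS /= addrAC subrr add0r.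
  by rewrite (xsS n.+1) {2}xsS opprD addrACA subrr add0r -linB // IH.
have Kn n : sqnorm (iter n K y) <= 4^-1 ^+ n * sqnorm y.
  elim: n => [|n IH]; rewrite ?mul1r //= exprS -mulrA.
  by apply: le_trans (Kle _) _; rewrite ler_pM2l ?invr_gt0.
have r0 : 0 <= c * sqnorm y by rewrite mulr_ge0 ?sqnorm_ge0.
have [n t|x hx] := @ev_complete _ _ E xs _ r0.
  rewrite dS; apply: le_trans (Kev _ _) _.
  have -> : c * sqnorm y * 4^-1 ^+ n * weight t = c * weight t * (4^-1 ^+ n * sqnorm y).
    by ring.
  by rewrite ler_wpM2l // mulr_ge0 ?weight_ge0.
have xE : x = y + K x.
  apply/eqP; rewrite -subr_eq0; apply/eqP; apply: (@ev_sep _ _ E) => t.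
  apply/eqP; rewrite -sqmod_eq0 eq_le sqmod_ge0 andbT.
  set r := c * sqnorm y in r0 hx.
  apply: (@le_geometric0 _ (2 * (8 * r * weight t) + 2 * (c * weight t * (8 * r * mass)))).
  move=> n; have -> : x - (y + K x) = (x - xs n.+1) - K (x - xs n).
    by rewrite linB // xsS opprB !opprD !addrA subrK.
  rewrite evD evN; apply: le_trans (sqmodD _ _) _; rewrite sqmodN.
  have h1 := hx n.+1 t; have h2 := Kev (x - xs n) t.
  have h3 : sqnorm (x - xs n) <= 8 * r * 4^-1 ^+ n * mass.
    have := @ip_dominated _ _ E [:: x - xs n] (8 * r * 4^-1 ^+ n).
    rewrite big_seq1; apply; last by move=> u; rewrite big_seq1.
    by apply: mulr_ge0; [lra | rewrite exprn_ge0 ?invr_ge0].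
  have h4 : c * weight t * sqnorm (x - xs n) <= c * weight t * (8 * r * 4^-1 ^+ n * mass).
    by rewrite ler_wpM2l // mulr_ge0 ?weight_ge0.
  have h5 : 8 * r * 4^-1 ^+ n.+1 * weight t <= 8 * r * 4^-1 ^+ n * weight t.
    apply: ler_wpM2r; first exact: weight_ge0.
    apply: ler_wpM2l; first by rewrite mulr_ge0.
    by rewrite exprS ler_piMl ?exprn_ge0 ?invr_ge0 // invf_le1 ?ler1n.
  move: h1 h2 h3 h4 h5; set p := 4^-1 ^+ n => h1 h2 h3 h4 h5.
  have -> : (2 * (8 * r * weight t) + 2 * (c * weight t * (8 * r * mass))) * p =
     2 * (8 * r * p * weight t) + 2 * (c * weight t * (8 * r * p * mass)) by ring.
  by lra.
exists x => //; have := sqnormD E y (K x); rewrite -xE.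
by have := Kle x; lra.
Qed.

Lemma bounded_add F G : bounded F -> bounded G -> bounded (fun x => F x + G x).
Proof.
move=> [a a0 ha] [b b0 hb]; exists (2 * a + 2 * b); first by lra.
move=> x; apply: le_trans (sqnormD _ _ _) _.
by have := ha x; have := hb x; lra.
Qed.

Lemma bounded_sum I (r : seq I) (F : I -> V -> V) :
  (forall i, bounded (F i)) -> bounded (fun x => \sum_(i <- r) F i x).
Proof.
move=> h; elim: r => [|i r IH].
  by exists 0 => // x; rewrite big_nil sqnorm0 mul0r.
have [c c0 hc] := bounded_add (h i) IH.
by exists c => // x; rewrite big_cons.
Qed.

(** Let P be the projection onto a finite orthonormal family for which S = K
    (1 - P) has norm at most 1/2. Inverting 1 - S by a Neumann series reduces
    x = y + K x to a linear system for the coefficients of P x, which is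
    square and whose matrix is invertible because 1 - K is injective. *)
Lemma fredholm_alternative c K : carleman c K ->
  (forall x, x = K x -> sqnorm x = 0) ->
  (forall y, exists x, x = y + K x) /\
  exists2 b : R, 0 <= b & forall x, sqnorm x <= b * sqnorm (x - K x).
Proof.
move=> KC inj; have [Klin c0 Kev] := KC.
have [s os hs] := carleman_finite_rank_approx KC (eps := 4^-1) ltac:(by rewrite invr_gt0).
pose S x := K (x - proj E s x).
have SC : carleman c S.
  split=> //.
    move=> a x y; rewrite /S -Klin; congr (K _).
    by rewrite proj_linear scalerBr opprD addrACA.
  move=> x t; apply: le_trans (Kev _ _) _; apply: ler_wpM2l.
    by rewrite mulr_ge0 ?weight_ge0.
  exact: sqnorm_subproj_le.
have Slin : is_linear S by case: SC.
have KE x : K x = K (proj E s x) + S x by rewrite -linD // addrC subrK.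
have [N hN] : {N : V -> V & forall y, N y = y + S (N y) /\ sqnorm (N y) <= 4 * sqnorm y}.
  apply: (@choice _ _ (fun y x => x = y + S x /\ sqnorm x <= 4 * sqnorm y)) => y.
  by have [x] := neumann SC hs y; exists x.
pose n := size s; pose e (i : 'I_n) := s`_i; pose g i := N (K (e i)).
have es i : e i \in s by rewrite mem_nth.
have projE x : proj E s x = \sum_(i < n) << e i, x >> *: e i.
  by rewrite /proj (big_nth 0) big_mkord.
(* N is a choice of solutions of the Neumann equation and is not known to be
   linear: only its values at the K (e i) and at y enter the linear system. *)
pose M : 'M[C]_n := \matrix_(i, j) << e j, g i >>.
have combE (a : 'rV[C]_n) : \sum_i a 0 i *: g i =
    K (\sum_i a 0 i *: e i) + S (\sum_i a 0 i *: g i).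
  rewrite (lin_sum Klin) (lin_sum Slin) -big_split /=; apply: eq_bigr => i _.
  by rewrite (linZ Klin) (linZ Slin) -scalerDr; congr (_ *: _); case: (hN (K (e i))).
have MU : 1%:M - M \in unitmx.
  rewrite -row_free_unit; apply: inj_row_free => a.
  rewrite mulmxBr mulmx1 => /eqP; rewrite subr_eq0 => /eqP aM.
  pose x := \sum_i a 0 i *: g i.
  have aE j : a 0 j = << e j, x >>.
    rewrite {1}aM mxE ip_sumr; apply: eq_bigr => i _.
    by rewrite mxE ipZr.
  have x0 : sqnorm x = 0.
    apply: inj; rewrite KE projE.
    rewrite {1}/x combE; congr (K _ + _).
    by apply: eq_bigr => i _; rewrite aE.
  by apply/rowP => j; rewrite aE mxE ip_conj sqnorm_eq0_ip // rmorph0.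
(* The functional y |-> << f j, N y >> computes the j-th coefficient of P x;
   writing it as an inner product makes its boundedness immediate. *)
pose Q := invmx (1%:M - M).
pose f (j : 'I_n) := \sum_i (Q i j)^*%C *: e i.
pose X y := N y + \sum_j << f j, N y >> *: g j.
have Xb : bounded X.
  have bN : bounded N by exists 4 => // y; case: (hN y).
  apply: bounded_add => //; apply: bounded_sum => j.
  exists (sqnorm (f j) * 4 * sqnorm (g j)); first by rewrite !mulr_ge0 ?sqnorm_ge0.
  move=> y; rewrite sqnormZ mulrAC ler_wpM2r ?sqnorm_ge0 // -mulrA.
  apply: le_trans (cauchy_schwarz _ _ _) _; rewrite ler_wpM2l ?sqnorm_ge0 //.
  by case: (hN y).
have XE y : X y = y + K (X y).
  pose b : 'rV[C]_n := \row_j << e j, N y >>; pose a := b *m Q.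
  have aE j : a 0 j = << f j, N y >>.
    rewrite mxE ip_conj ip_sumr rmorph_sum /=; apply: eq_bigr => i _.
    by rewrite mxE ipZr rmorphM /= conjcK -ip_conj mulrC.
  have XaE : X y = N y + \sum_j a 0 j *: g j.
    by congr (_ + _); apply: eq_bigr => j _; rewrite aE.
  have aM : a = b + a *m M.
    have : a *m (1%:M - M) = b by rewrite mulmxKV.
    by rewrite mulmxBr mulmx1 => <-; rewrite subrK.
  have aX j : a 0 j = << e j, X y >>.
    rewrite XaE ipDr {1}aM mxE mxE; congr (_ + _).
    rewrite mxE ip_sumr; apply: eq_bigr => i _; by rewrite [M _ _]mxE ipZr.
  have K1 : K (proj E s (X y)) = K (\sum_j a 0 j *: e j).
    by rewrite projE; congr K; apply: eq_bigr => j _; rewrite aX.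
  rewrite KE K1 {1}XaE {1}(hN y).1 combE XaE (linD Slin).
  by rewrite -addrA; congr (_ + _); rewrite addrCA.
split; first by move=> y; exists (X y).
case: Xb => b b0 hb; exists b => // x; apply: le_trans (hb _).
have h : x ~= X (x - K x).
  apply: inj; rewrite (linB Klin) {1}XE opprD addrA; congr (_ - _).
  by rewrite opprB addrC subrK.
by rewrite (eqv_sqnorm h).
Qed.

End CarlemanOperators.

(** * Spectrum of an operator with a Carleman parametrix *)

Lemma subrBB (U : zmodType) (x y z t : U) : (x - y) - (z - t) = (x - z) - (y - t).
Proof. by rewrite !opprD !opprK addrACA. Qed.

Lemma bounded_nat_max (P : nat -> Prop) (n N : nat) : P n ->
  (forall m, P m -> (m <= N)%N) -> exists2 m, P m & forall k, P k -> (k <= m)%N.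
Proof.
move=> Pn PN.
have ex : exists m, `[< P m >] by exists n; apply/asboolP.
have ub m : `[< P m >] -> (m <= N)%N by move=> /asboolP/PN.
case: (ex_maxnP ex ub) => m /asboolP Pm hm.
by exists m => // k Pk; apply: hm; apply/asboolP.
Qed.

Lemma natr_bound (R : realType) (b : R) : exists N : nat,
  forall n : nat, n%:R <= b -> (n <= N)%N.
Proof.
exists (Num.bound b) => n hn; have [b0|b0] := leP 0 b.
  by rewrite -(ler_nat R); apply: le_trans hn (ltW (archi_boundP b0)).
by have := ler0n R n; lra.
Qed.

Section SpectralTheory.
Variables (R : realType) (V : lmodType R[i]) (E : carleman_space V).
Local Notation C := R[i].
Implicit Types (x y z w : V) (s : seq V) (l : seq (C * V)).
Local Notation "<< x , y >>" := (ip E x y).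
Local Notation sqnorm := (sqnorm E).
Local Notation "x ~= y" := (eqv E x y) (at level 70).

(** For an orthonormal s: membership in the span of s, modulo null vectors. *)
Definition inspan s x := x ~= proj E s x.

Lemma inspan_linear s a x y : inspan s x -> inspan s y -> inspan s (a *: x + y).
Proof. by move=> hx hy; rewrite /inspan proj_linear; apply/eqvD/hy/eqvZ. Qed.

Lemma inspan0 s : inspan s 0.
Proof. by rewrite /inspan proj0; exact: eqv_refl. Qed.

Lemma inspanZ s a x : inspan s x -> inspan s (a *: x).
Proof. by move=> hx; rewrite -[a *: x]addr0; exact/inspan_linear/inspan0. Qed.

Lemma inspanD s x y : inspan s x -> inspan s y -> inspan s (x + y).
Proof. by move=> hx hy; rewrite -[x]scale1r; exact/inspan_linear. Qed.

Lemma inspanB s x y : inspan s x -> inspan s y -> inspan s (x - y).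
Proof. by move=> hx hy; rewrite -scaleN1r addrC; exact/inspan_linear. Qed.

Lemma proj_eqv s x y : x ~= y -> proj E s x = proj E s y.
Proof. by move=> h; apply: eq_bigr => e _; rewrite (eqv_ip _ h). Qed.

Lemma inspan_eqv s x y : x ~= y -> inspan s x -> inspan s y.
Proof.
move=> h hx; rewrite /inspan -(proj_eqv s h).
exact: eqv_trans (eqv_sym h) hx.
Qed.

Lemma inspan_comb s (a : V -> C) : orthonormal E s ->
  inspan s (\sum_(e <- s) a e *: e).
Proof.
move=> os; rewrite /inspan /proj; rewrite [X in _ ~= X](_ : _ = \sum_(e <- s) a e *: e).
  exact: eqv_refl.
by apply: eq_big_seq => e es; rewrite (ip_comb a).
Qed.

Lemma inspan_proj s x : orthonormal E s -> inspan s (proj E s x).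
Proof. by move=> os; apply: (inspan_comb (fun e => << e, x >>)). Qed.

Lemma orthogonal_inspan s e x : (forall f, f \in s -> << e, f >> = 0) ->
  inspan s x -> << e, x >> = 0.
Proof. by move=> h hx; rewrite (eqv_ip _ hx) (ip_comb0 (fun f => << f, x >>)). Qed.

Lemma inspan_cons s e x : (forall f, f \in s -> << e, f >> = 0) ->
  inspan s x -> inspan (e :: s) x.
Proof.
by move=> h hx; rewrite /inspan projE_cons (orthogonal_inspan h hx) scale0r add0r.
Qed.

Lemma inspan_head s e : orthonormal E (e :: s) -> inspan (e :: s) e.
Proof.
move=> [e1 es _]; rewrite /inspan projE_cons ipxx e1 scale1r.
rewrite /proj big_seq big1 ?addr0; first exact: eqv_refl.
by move=> f fs; rewrite ip_conj es // rmorph0 scale0r.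
Qed.

Section Flags.
Variables (c : R) (S : V -> V).
Hypothesis SC : carleman E c S.
Let Slin : is_linear S. Proof. by case: SC. Qed.

(** A Schur form of S: each tail of the list spans an invariant subspace, and
    S is triangular along the list, with the first components as diagonal
    entries. *)
Fixpoint flag l : Prop :=
  if l is (nu, e) :: l' then
    [/\ sqnorm e = 1, forall f, f \in map snd l' -> << e, f >> = 0,
        inspan (map snd l') (S e - nu *: e) & flag l']
  else True.

Lemma flag_orthonormal l : flag l -> orthonormal E (map snd l).
Proof. by elim: l => // -[nu e] l IH /= [? ? _ /IH]. Qed.

Lemma flag_stable l x : flag l -> inspan (map snd l) x -> inspan (map snd l) (S x).
Proof.
elim: l x => [|[nu e] l IH] x.
  by move=> _ hx; rewrite (carleman_eqv SC hx) /= /proj big_nil lin0 //; exact: inspan0.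
move=> fl hx; have os := flag_orthonormal fl; case: fl os => e1 es he fl os.
rewrite (carleman_eqv SC hx) [map _ _]/= projE_cons Slin; apply: inspan_linear.
  rewrite -[S e](subrK (nu *: e)); apply: inspanD; first exact: inspan_cons.
  exact/inspanZ/inspan_head.
apply: inspan_cons => //; apply: IH => //.
by apply: inspan_proj; exact: flag_orthonormal.
Qed.

(** The diagonal entries are the <e, S e>, bounded by the norms of the S e. *)
Lemma flag_bound l : flag l -> \sum_(p <- l) sqmod p.1 <= c * mass E.
Proof.
move=> fl; apply: le_trans (carleman_hilbert_schmidt SC (flag_orthonormal fl)).
rewrite big_map; elim: l fl => [|[nu e] l IH]; first by rewrite !big_nil.
move=> [e1 es he fl]; rewrite !big_cons lerD ?IH //=.
have := cauchy_schwarz E e (S e); rewrite e1 mul1r; congr (sqmod _ <= _).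
by have /eqP := orthogonal_inspan es he; rewrite ipBr ipZr ipxx e1 mulr1 subr_eq0 => /eqP.
Qed.

(** The new vector is the normalised component of w orthogonal to the flag;
    invariance of the flag absorbs the part that is removed. *)
Lemma flag_extend l nu w : flag l -> inspan (map snd l) (S w - nu *: w) ->
  ~ inspan (map snd l) w -> exists e, flag ((nu, e) :: l).
Proof.
move=> fl; set s := map snd l => hS /eqP nz; have os : orthonormal E s := flag_orthonormal fl.
have := orthonormal_extend os nz; set a := (Num.sqrt _)^-1 => -[e1 es _].
exists (a%:C *: (w - proj E s w)); split=> //.
rewrite (linZ Slin) (linB Slin) scalerA mulrC -scalerA -scalerBr.
have hp := inspan_proj w os; apply: inspanZ; rewrite scalerBr subrBB.
by apply: inspanB => //; apply: inspanB; [exact: flag_stable|exact: inspanZ].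
Qed.

(** A triangular operator has no eigenvalue outside its diagonal: the
    component of an eigenvector along the head of the flag vanishes, and so on
    down the list. *)
Lemma flag_eigenvector l nu w : flag l -> S w ~= nu *: w ->
  inspan (map snd l) w -> nu \notin map fst l -> w ~= 0.
Proof.
elim: l w => [|[mu e] l IH] w.
  by rewrite /inspan /= /proj big_nil.
move=> fl hS hw; rewrite inE negb_or /= => /andP[numu nul].
have os := flag_orthonormal fl; case: fl os => e1 es he fl os.
have osl := flag_orthonormal fl.
set s := map snd l in es he osl; set p := proj E s w.
have hp : inspan s p by exact: inspan_proj.
have we : << e, w >> = 0.
  have : << e, S w - nu *: w >> = 0.
    by rewrite (eqv_ip _ (eqvB hS (eqv_refl _ (nu *: w)))) subrr ip0r.
  have hSw : S w = << e, w >> *: S e + S p.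
    by rewrite {1}(carleman_eqv SC hw) [map _ _]/= projE_cons Slin.
  have Se : << e, S e >> = mu.
    by have /eqP := orthogonal_inspan es he; rewrite ipBr ipZr ipxx e1 mulr1 subr_eq0 => /eqP.
  rewrite ipBr ipZr hSw ip_linear Se (orthogonal_inspan es (flag_stable fl hp)) addr0.
  rewrite [nu * _]mulrC -mulrBr => /eqP; rewrite mulf_eq0 subr_eq0 [mu == nu]eq_sym (negPf numu) orbF.
  by move=> /eqP.
apply: IH => //.
by move: hw; rewrite /inspan [map _ _]/= projE_cons we scale0r add0r.
Qed.

End Flags.

Lemma bounded_comp K L : bounded E K -> bounded E L -> bounded E (K \o L).
Proof.
move=> [a a0 ha] [b b0 hb]; exists (a * b); first exact: mulr_ge0.
by move=> x; apply: le_trans (ha _) _; rewrite -mulrA ler_wpM2l.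
Qed.

Lemma carleman_bounded c K : carleman E c K -> bounded E K.
Proof.
move=> KC; exists (c * mass E); last exact: carleman_sqnorm.
by case: KC => _ c0 _; rewrite mulr_ge0 ?mass_ge0.
Qed.

Lemma carleman_comp c K L : carleman E c K -> is_linear L -> bounded E L ->
  exists c', carleman E c' (K \o L).
Proof.
move=> [Klin c0 hK] Llin [b b0 hb]; exists (c * b); split.
- by move=> a x y /=; rewrite Llin Klin.
- exact: mulr_ge0.
- move=> x t; apply: le_trans (hK _ _) _.
  rewrite [leRHS](_ : _ = c * weight t * (b * sqnorm x)); last by ring.
  by rewrite ler_wpM2l // mulr_ge0 ?weight_ge0.
Qed.

Lemma bounded_id : bounded E id.
Proof. by exists 1 => // x; rewrite mul1r. Qed.

Lemma bounded_scale a K : bounded E K -> bounded E (fun x => a *: K x).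
Proof.
move=> [b b0 hb]; exists (sqmod a * b); first by rewrite mulr_ge0 ?sqmod_ge0.
by move=> x; rewrite sqnormZ -mulrA ler_wpM2l ?sqmod_ge0.
Qed.

Section Parametrix.
(** T is a parametrix of A: up to the bounded error B it is a two-sided
    inverse. The perturbation is not small, so one point lam0 outside the set
    of eigenvalues has to be supplied; it makes A - lam0 invertible. *)
Variables (c : R) (T B : V -> V) (D : set V) (A : V -> V) (lam0 : C).
Hypothesis TC : carleman E c T.
Hypothesis Blin : is_linear B.
Hypothesis Bbd : bounded E B.
Hypothesis TA : forall y, D (T y) /\ A (T y) ~= y + B (T y).
Hypothesis AT : forall w, D w -> w ~= T (A w - B w).
Hypothesis lam0_reg : forall w, D w -> A w ~= lam0 *: w -> w ~= 0.

Let Tlin : is_linear T. Proof. by case: TC. Qed.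

Definition eigen (lam : C) := exists w, [/\ D w, ~ w ~= 0 & A w ~= lam *: w].

Fixpoint root_space (lam : C) (k : nat) (w : V) : Prop :=
  if k is k'.+1 then D w /\ root_space lam k' (A w - lam *: w) else w ~= 0.

Let shift lam x := lam *: x - B x.
Let Kl lam := T \o shift lam.

Let shift_lin lam : is_linear (shift lam).
Proof.
move=> a x y; rewrite /shift Blin !scalerDr !scalerA [lam * a]mulrC scalerN.
by rewrite opprD addrACA -scalerA.
Qed.

Let shift_bd lam : bounded E (shift lam).
Proof.
apply: bounded_add; first exact/bounded_scale/bounded_id.
by case: Bbd => b b0 hb; exists b => // x; rewrite sqnormN.
Qed.

Let Klin lam : is_linear (Kl lam).
Proof. by move=> a x y; rewrite /Kl /= shift_lin Tlin. Qed.

Let KC lam : exists c', carleman E c' (Kl lam).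
Proof. exact: (carleman_comp TC (shift_lin lam) (shift_bd lam)). Qed.

Let K_inj lam : ~ eigen lam -> forall x, x = Kl lam x -> sqnorm x = 0.
Proof.
move=> ne x xE; have [Dx hx] := TA (shift lam x).
have xE' : x = T (shift lam x) := xE; rewrite -xE' in Dx hx.
apply: contrapT => nx; apply: ne; exists x; split=> //.
  by rewrite /eqv subr0.
by rewrite subrK in hx.
Qed.

(** With y = (A - lam) w this reads w = T y + T (lam - B) w. *)
Let resolvent_eq lam w : D w -> w ~= T (A w - lam *: w) + Kl lam w.
Proof.
move=> Dw; apply: eqv_trans (AT Dw) _; rewrite /Kl /= -(linD Tlin) /shift.
by rewrite addrA subrK; exact: eqv_refl.
Qed.

(** The equation (A - lam) w = y is equivalent to the fixed-point equation w =
    T y + T (lam - B) w, to which the Fredholm alternative applies. *)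
Lemma not_eigen_resolvent lam : ~ eigen lam ->
  [/\ forall y, exists2 w, D w & A w - lam *: w ~= y,
      forall w z, D w -> D z -> A w - lam *: w ~= A z - lam *: z -> w ~= z &
      exists2 b : R, 0 <= b &
        forall w, D w -> sqnorm w <= b * sqnorm (A w - lam *: w)].
Proof.
move=> ne; have [c' KC'] := KC lam.
have [surj [b b0 hb]] := fredholm_alternative KC' (K_inj ne).
split.
- move=> y; have [x xE] := surj (T y).
  have [Dx hx] := TA (y + shift lam x).
  have xE' : x = T (y + shift lam x) by rewrite (linD Tlin).
  rewrite -xE' in Dx hx; exists x => //.
  have := eqvB hx (eqv_refl _ (lam *: x)).
  by rewrite -[y + _ + _]addrA subrK addrK.
- move=> w z Dw Dz h.
  have h1 := eqvB (resolvent_eq lam Dw) (resolvent_eq lam Dz).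
  have h2 := carleman_eqv TC h.
  rewrite h2 opprD addrACA subrr add0r -(linB (Klin lam)) in h1.
  have h3 := carleman_eqv KC' h1.
  have := K_inj ne h3; rewrite (linB (Klin lam)) => h4.
  apply: eqv_trans (resolvent_eq lam Dw) _.
  apply: eqv_trans (eqv_sym (resolvent_eq lam Dz)).
  rewrite h2; apply: eqvD; first exact: eqv_refl.
  exact: h4.
- have [b1 b10 hb1] := carleman_bounded TC.
  exists (b * b1); first exact: mulr_ge0.
  move=> w Dw; apply: le_trans (hb w) _; rewrite -mulrA ler_wpM2l //.
  have h : w - Kl lam w ~= T (A w - lam *: w).
    have := eqvB (resolvent_eq lam Dw) (eqv_refl _ (Kl lam w)).
    by rewrite addrK.
  by rewrite (eqv_sqnorm h).
Qed.

Let not_eigen0 : ~ eigen lam0.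
Proof. by move=> [w [Dw nw hw]]; apply: nw; exact: lam0_reg. Qed.

(** The operator S is (A - lam0)^-1. It solves S y = T (y + (lam0 - B) S y),
    and is therefore T composed with a bounded operator. *)
Let resolvent0 : exists c' S, carleman E c' S /\
  forall w, D w -> S (A w - lam0 *: w) ~= w.
Proof.
have [c' KC'] := KC lam0.
have [surj [b b0 hb]] := fredholm_alternative KC' (K_inj not_eigen0).
have [S hS] : {S : V -> V & forall y, S y = T y + Kl lam0 (S y)}.
  by apply: (@choice _ _ (fun y x => x = T y + Kl lam0 x)) => y; exact: surj.
have K_uniq x : x = Kl lam0 x -> x = 0.
  by move=> xE; rewrite xE; apply: (carleman_eqv0 KC'); exact: (K_inj not_eigen0).
have S_uniq x y : x = T y + Kl lam0 x -> x = S y.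
  move=> xE; apply/eqP; rewrite -subr_eq0; apply/eqP/K_uniq.
  by rewrite (linB (Klin lam0)) {1}xE {1}(hS y) opprD addrACA subrr add0r.
have Slin : is_linear S.
  move=> a x y; apply/esym/S_uniq; rewrite Klin Tlin addrACA -scalerDr.
  by rewrite -!hS.
have Sbd : bounded E S.
  have [b1 b10 hb1] := carleman_bounded TC.
  exists (b * b1); first exact: mulr_ge0.
  move=> y; apply: le_trans (hb (S y)) _; rewrite -mulrA ler_wpM2l //.
  by rewrite {1}hS addrK.
pose L y := y + shift lam0 (S y).
have Llin : is_linear L.
  by move=> a x y; rewrite /L Slin (shift_lin lam0) [in RHS]scalerDr [LHS]addrACA.
have Lbd : bounded E L.
  by apply: bounded_add; [exact: bounded_id|exact: bounded_comp].
have [c2 SC] := carleman_comp TC Llin Lbd.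
have SE : S = T \o L.
  by apply/funext => y; rewrite /= /L (linD Tlin); exact: hS.
exists c2, S; split; first by rewrite SE.
move=> w Dw; have h := resolvent_eq lam0 Dw.
set w' := T _ + _ in h; suff <- : w' = S (A w - lam0 *: w) by exact: eqv_sym.
by apply: S_uniq; rewrite {1}/w' (carleman_eqv KC' h).
Qed.

(** For mu = lam - lam0, consider the flags of S with all diagonal entries 1 /
    mu. Their length is bounded by [flag_bound]; a longest one spans all root
    vectors, since by induction on k a root vector of order k that is not in
    its span would extend it. *)
Lemma root_space_finite lam : exists s : seq V,
  forall k w, root_space lam k w -> inspan s w.
Proof.
have [c' [S [SC hS]]] := resolvent0; have Slin : is_linear S by case: SC.
have [->|lam_neq] := eqVneq lam lam0.
  exists [::]; elim=> [|k IH] w /=; first by rewrite /inspan /proj big_nil.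
  move=> [Dw /IH]; rewrite /inspan /proj !big_nil => h.
  have := hS _ Dw; rewrite (carleman_eqv SC h) (lin0 Slin).
  exact: eqv_sym.
set mu := lam - lam0; have mu0 : mu != 0 by rewrite subr_eq0.
pose P n := exists l, [/\ flag S l, all (fun p => p.1 == mu^-1) l & size l = n].
have mup : 0 < sqmod mu by rewrite lt_def sqmod_ge0 sqmod_eq0 mu0.
have [N hN] := natr_bound (sqmod mu * (c' * mass E)).
have Pb n : P n -> (n <= N)%N.
  move=> [l [fl al <-]]; apply: hN.
  have := flag_bound SC fl; rewrite (eq_big_seq (fun=> (sqmod mu)^-1)); last first.
    by move=> p /(allP al)/eqP ->; rewrite sqmodV.
  rewrite big_const_seq count_predT iter_addr_0 => h.
  by rewrite mulrC -ler_pdivrMr // mulr_natl.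
have P0 : P 0%N by exists [::].
have [m [l [fl al sl]] hm] := bounded_nat_max P0 Pb.
exists (map snd l); elim=> [|k IH] w /=.
  by move=> h; apply: inspan_eqv (eqv_sym h) (inspan0 _).
move=> [Dw hw]; set z := A w - lam *: w in hw.
have hz : inspan (map snd l) (S z) by exact: (flag_stable SC fl (IH _ hw)).
apply: contrapT => nw.
have hSw : inspan (map snd l) (S w - mu^-1 *: w).
  apply: (@inspan_eqv _ (- mu^-1 *: S z)); last exact: inspanZ.
  have /(eqvZ mu^-1) h := hS _ Dw.
  have zE : A w - lam0 *: w = mu *: w + z.
    by rewrite /z /mu scalerBl [RHS]addrC addrA subrK.
  rewrite zE Slin scalerDr scalerA mulVf // scale1r in h.
  have := eqvB (eqv_refl _ (S w)) h.
  by rewrite opprD addrA subrr sub0r scaleNr.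
have [e fe] := flag_extend SC fl hSw nw.
have : (m.+1 <= m)%N.
  apply: hm; exists ((mu^-1, e) :: l); split=> //=; first by rewrite eqxx.
  by rewrite sl.
by rewrite ltnn.
Qed.

(** Eigenvectors of A for distinct eigenvalues are successively added to a
    flag of S, with diagonal entries 1 / (lam - lam0); in a disc these are
    bounded below, so [flag_bound] limits their number. *)
Lemma eigen_discrete (M : R) : exists N : nat, forall L : seq C, uniq L ->
  (forall lam, lam \in L -> eigen lam /\ sqmod (lam - lam0) <= M) ->
  (size L <= N)%N.
Proof.
have [c' [S [SC hS]]] := resolvent0; have Slin : is_linear S by case: SC.
have [N hN] := natr_bound (M * (c' * mass E)).
exists N => L uL hL.
have neq lam : lam \in L -> lam - lam0 != 0.
  move=> /hL[el _]; apply/eqP => /eqP; rewrite subr_eq0 => /eqP h.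
  by move: el; rewrite h; exact: not_eigen0.
have [l [fl fstl]] : exists l, flag S l /\ map fst l = map (fun lam => (lam - lam0)^-1) L.
  elim: L uL hL neq => [|lam L IH]; first by exists [::].
  rewrite cons_uniq => /andP[lamL uL] hL neq.
  have [||l [fl fstl]] := IH uL.
  - by move=> nu nuL; apply: hL; rewrite inE nuL orbT.
  - by move=> nu nuL; apply: neq; rewrite inE nuL orbT.
  have [[w [Dw nw hw]] _] := hL lam (mem_head _ _).
  have mu0 := neq lam (mem_head _ _).
  have hSw : S w ~= (lam - lam0)^-1 *: w.
    have h1 : A w - lam0 *: w ~= (lam - lam0) *: w.
      by rewrite scalerBl; apply: eqvB => //; exact: eqv_refl.
    have := hS _ Dw; rewrite (carleman_eqv SC h1) (linZ Slin).
    by move=> /(eqvZ (lam - lam0)^-1); rewrite scalerA mulVf // scale1r.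
  have nl : (lam - lam0)^-1 \notin map fst l.
    rewrite fstl; apply/mapP => -[nu nuL /invr_inj/addIr h].
    by rewrite h nuL in lamL.
  have hz : inspan (map snd l) (S w - (lam - lam0)^-1 *: w).
    apply: inspan_eqv (inspan0 _); apply: eqv_sym.
    by have := eqvB hSw (eqv_refl _ ((lam - lam0)^-1 *: w)); rewrite subrr.
  have [e fe] : exists e, flag S (((lam - lam0)^-1, e) :: l).
    apply: (flag_extend SC fl hz) => hsp; apply: nw.
    exact: (flag_eigenvector SC fl hSw hsp nl).
  by exists (((lam - lam0)^-1, e) :: l); split => //=; rewrite fstl.
have [M0|M0] := leP M 0.
  case: L {uL fstl} hL neq => [//|lam L] hL neq.
  have [_ h] := hL lam (mem_head _ _).
  have /eqP[] := neq lam (mem_head _ _).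
  by apply/eqP; rewrite -sqmod_eq0 eq_le sqmod_ge0 andbT (le_trans h).
apply: hN; rewrite -ler_pdivrMl //; apply: le_trans (flag_bound SC fl).
have -> : \sum_(p <- l) sqmod p.1 = \sum_(lam <- L) (sqmod (lam - lam0))^-1.
  rewrite -(big_map fst predT (@sqmod R)) fstl big_map.
  by apply: eq_bigr => lam _; rewrite sqmodV.
have -> : M^-1 * (size L)%:R = \sum_(lam <- L) M^-1.
  by rewrite big_const_seq count_predT iter_addr_0 mulr_natr.
rewrite !big_seq; apply: ler_sum => lam lamL; have [_ h] := hL lam lamL.
have p : 0 < sqmod (lam - lam0) by rewrite lt_def sqmod_ge0 sqmod_eq0 neq.
by rewrite lef_pV2.
Qed.

End Parametrix.
End SpectralTheory.

Local Close Scope complex_scope.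

(** * Integration on the line *)

Section IntegralCalculus.
Variable R : realType.
Local Notation mu := (@lebesgue_measure R).
Implicit Types f g h k : R -> R.

Definition meas f : Prop := measurable_fun [set: R] f.
Definition Int f : Prop := mu.-integrable [set: R] (EFin \o f).
Definition I f : R := \int[mu]_x f x.
Definition aeeqr f g : Prop := f = g %[ae mu].

Lemma Int_meas f : Int f -> meas f.
Proof. by move=> /(measurable_int mu)/measurable_EFinP. Qed.

Lemma measD f g : meas f -> meas g -> meas (fun x => f x + g x).
Proof. exact: measurable_funD. Qed.
Lemma measB f g : meas f -> meas g -> meas (fun x => f x - g x).
Proof. exact: measurable_funB. Qed.
Lemma measM f g : meas f -> meas g -> meas (fun x => f x * g x).
Proof. exact: measurable_funM. Qed.
Lemma measX f n : meas f -> meas (fun x => f x ^+ n).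
Proof. exact: measurable_funX. Qed.
Lemma measN f : meas f -> meas (fun x => - f x).
Proof. exact: measurableT_comp. Qed.
Lemma measA f : meas f -> meas (fun x => `|f x|).
Proof. exact: measurableT_comp. Qed.
Lemma measc (c : R) : meas (fun=> c).
Proof. exact: measurable_cst. Qed.
Lemma meas_cont f : continuous f -> meas f.
Proof. exact: continuous_measurable_fun. Qed.

Lemma Int_le f g : meas f -> Int g -> (forall x, `|f x| <= g x) -> Int f.
Proof.
move=> mf ig h; apply: (le_integrable measurableT _ _ ig).
  exact/measurable_EFinP.
by move=> x _ /=; rewrite lee_fin; apply: le_trans (h x) (ler_norm _).
Qed.

Lemma Int_ext f g : f =1 g -> Int f -> Int g.
Proof. by move=> /funext ->. Qed.

Lemma I_ext f g : f =1 g -> I f = I g.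
Proof. by move=> /funext ->. Qed.

Lemma Int0 : Int (fun=> 0).
Proof. exact: integrable0. Qed.
Lemma IntD f g : Int f -> Int g -> Int (fun x => f x + g x).
Proof. by move=> hf hg; apply: eq_integrable (integrableD _ hf hg). Qed.
Lemma IntZ c f : Int f -> Int (fun x => c * f x).
Proof. by move=> hf; apply: eq_integrable (integrableZl _ c hf). Qed.
Lemma IntN f : Int f -> Int (fun x => - f x).
Proof. by move=> /(IntZ (-1)); apply: Int_ext => x; rewrite mulN1r. Qed.
Lemma IntB f g : Int f -> Int g -> Int (fun x => f x - g x).
Proof. by move=> hf /IntN; exact: IntD. Qed.
Lemma IntA f : Int f -> Int (fun x => `|f x|).
Proof. by move=> hf; apply: integrable_norm. Qed.

Lemma I_D f g : Int f -> Int g -> I (fun x => f x + g x) = I f + I g.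
Proof. by move=> hf hg; apply: RintegralD. Qed.
Lemma I_Z c f : Int f -> I (fun x => c * f x) = c * I f.
Proof. by move=> hf; apply: RintegralZl. Qed.
Lemma I_N f : Int f -> I (fun x => - f x) = - I f.
Proof. by move=> hf; rewrite -mulN1r -I_Z //; apply: I_ext => x; rewrite mulN1r. Qed.
Lemma I_B f g : Int f -> Int g -> I (fun x => f x - g x) = I f - I g.
Proof. by move=> hf hg; apply: RintegralB. Qed.
Lemma I_0 : I (fun=> 0) = 0.
Proof. by rewrite -[in LHS](mulr0 0) I_Z ?mul0r //; exact: Int0. Qed.
Lemma I_le f g : Int f -> Int g -> (forall x, f x <= g x) -> I f <= I g.
Proof. by move=> hf hg h; apply: le_Rintegral. Qed.
Lemma I_ge0 f : (forall x, 0 <= f x) -> 0 <= I f.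
Proof. by move=> h; apply: Rintegral_ge0. Qed.
Lemma I_abs f : Int f -> `|I f| <= I (fun x => `|f x|).
Proof. by move=> hf; apply: le_normr_Rintegral. Qed.

Lemma ae_map1 (P Q : R -> Prop) : (forall x, P x -> Q x) ->
  {ae mu, forall x, P x} -> {ae mu, forall x, Q x}.
Proof. move=> h; exact: (@filterS _ _ (ae_filter_ringOfSetsType mu) _ _ h). Qed.

Lemma ae_map2 (P Q S : R -> Prop) : (forall x, P x -> Q x -> S x) ->
  {ae mu, forall x, P x} -> {ae mu, forall x, Q x} -> {ae mu, forall x, S x}.
Proof. move=> h; exact: (@filterS2 _ _ (ae_filter_ringOfSetsType mu) _ _ _ h). Qed.

Lemma ae_refl f : aeeqr f f. Proof. exact: aeW. Qed.
Lemma ae_sym f g : aeeqr f g -> aeeqr g f.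
Proof. by apply: ae_map1 => x h /h. Qed.
Lemma ae_trans g f h : aeeqr f g -> aeeqr g h -> aeeqr f h.
Proof. by apply: ae_map2 => x h1 h2 t; rewrite h1 // h2. Qed.
Lemma ae_comp2 (F : R -> R -> R -> R) f f' g g' : aeeqr f f' -> aeeqr g g' ->
  aeeqr (fun x => F x (f x) (g x)) (fun x => F x (f' x) (g' x)).
Proof. by apply: ae_map2 => x h1 h2 t /=; rewrite h1 // h2. Qed.
Lemma ae_comp1 (F : R -> R -> R) f f' : aeeqr f f' ->
  aeeqr (fun x => F x (f x)) (fun x => F x (f' x)).
Proof. by apply: ae_map1 => x h1 t /=; rewrite h1. Qed.

Lemma I_ae f g : meas f -> meas g -> aeeqr f g -> I f = I g.
Proof.
move=> mf mg fg; congr fine; apply: ae_eq_integral => //; try exact/measurable_EFinP.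
by apply: ae_map1 fg => x h t /=; rewrite h.
Qed.

Lemma Int_ae f g : Int f -> meas g -> aeeqr f g -> Int g.
Proof.
move=> hf mg fg; apply/integrableP; split; first exact/measurable_EFinP.
have /integrableP[mf] := hf; congr (_ < _)%E.
apply: ae_eq_integral => //; try (apply/measurable_EFinP; exact/measA).
- by apply/measurableT_comp.
- by apply/measurableT_comp => //; exact/measurable_EFinP.
by apply: ae_map1 fg => x h t /=; rewrite h.
Qed.

Lemma I_eq0_ae f : Int f -> (forall x, 0 <= f x) -> I f = 0 -> aeeqr f (fun=> 0).
Proof.
move=> hf f0 h.
have : (\int[mu]_x `|(EFin \o f) x| = 0)%E.
  have e : (fun x => `|(EFin \o f) x|%E) = EFin \o f.
    by apply/funext => x /=; rewrite ger0_norm.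
  rewrite e; have := integrable_fin_num measurableT hf.
  by move=> /fineK <-; rewrite [fine _]h.
move=> /(ae_eq_integral_abs mu measurableT (measurable_int mu hf)).
by apply: ae_map1 => x h1 t; have [] := h1 t.
Qed.

Lemma DCT (F : nat -> R -> R) f g : (forall n, meas (F n)) -> meas f -> Int g ->
  (forall x, F n x @[n --> \oo] --> f x) -> (forall n x, `|F n x| <= g x) ->
  I (F n) @[n --> \oo] --> I f.
Proof.
move=> mF mf ig Ff Fg.
have [|||||hf _ h] := @dominated_convergence _ _ _ mu setT measurableT (fun n => EFin \o F n)
  (EFin \o f) (EFin \o g).
- by move=> n; apply/measurable_EFinP; exact: mF.
- exact/measurable_EFinP.
- by apply: aeW => x _; apply: cvg_EFin; [exact: nearW|exact: Ff].
- exact: ig.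
- by apply: aeW => x n _ /=; rewrite lee_fin.
- apply: fine_cvg; rewrite [X in _ --> X](_ : _ = \int[mu]_x (EFin \o f) x)%E //.
  by rewrite fineK // integrable_fin_num.
Qed.

End IntegralCalculus.

(** * Square-integrable functions *)

Section SquareIntegrable.
Variable R : realType.
Local Notation mu := (@lebesgue_measure R).
Implicit Types f g h k : R -> R.

Definition Sq f := meas f /\ Int (fun x => f x ^+ 2).

Lemma SqM f g : Sq f -> Sq g -> Int (fun x => f x * g x).
Proof.
move=> [mf hf] [mg hg]; apply: (Int_le _ (IntD hf hg)); first exact: measM.
move=> x; rewrite ler_norml; have := sqr_ge0 (f x + g x); have := sqr_ge0 (f x - g x).
have := sqr_ge0 (f x); have := sqr_ge0 (g x); move=> h1 h2 h3 h4; apply/andP; split; lra.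
Qed.

Lemma SqD f g : Sq f -> Sq g -> Sq (fun x => f x + g x).
Proof.
move=> hf hg; have hfg := SqM hf hg; case: hf hg => mf hf [mg hg].
split; first exact: measD.
by apply: Int_ext (IntD (IntD hf (IntZ 2 hfg)) hg) => x; ring.
Qed.

Lemma SqZ c f : Sq f -> Sq (fun x => c * f x).
Proof.
move=> [mf hf]; split; first by apply: measM => //; exact: measc.
by apply: Int_ext (IntZ (c ^+ 2) hf) => x; ring.
Qed.

Lemma SqN f : Sq f -> Sq (fun x => - f x).
Proof. by move=> /(SqZ (-1)) h; rewrite (_ : (fun x => _) = (fun x => -1 * f x)) //; apply/funext => x; rewrite mulN1r. Qed.

Lemma SqB f g : Sq f -> Sq g -> Sq (fun x => f x - g x).
Proof. by move=> hf /SqN; exact: SqD. Qed.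

Lemma Sq_le f g : meas f -> Sq g -> (forall x, `|f x| <= g x) -> Sq f.
Proof.
move=> mf [mg hg] h; split=> //; apply: (Int_le _ hg); first exact: measX.
by move=> x; rewrite normrX lerXn2r // ?nnegrE //; apply: le_trans (h x).
Qed.

Lemma Sq_bd f g M : meas f -> Sq g -> (forall x, `|f x| <= M) -> Sq (fun x => f x * g x).
Proof.
move=> mf hg h; have [mg _] := hg.
have [m2 hz] := SqZ M hg; split; first exact: measM.
apply: (Int_le _ hz); first by apply: measX; exact: measM.
move=> x; rewrite ger0_norm ?sqr_ge0 // !exprMn ler_wpM2r ?sqr_ge0 //.
have M0 : 0 <= M by apply: le_trans (h x).
by rewrite -(real_normK (num_real (f x))) lerXn2r ?nnegrE.
Qed.

Lemma Sq_ae f g : Sq f -> meas g -> aeeqr f g -> Sq g.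
Proof.
move=> [mf hf] mg fg; split=> //; apply: (Int_ae hf); first exact: measX.
by apply: ae_map1 fg => x h t; rewrite h.
Qed.

Lemma discriminant (A B C : R) : 0 <= A ->
  (forall t, 0 <= A * t ^+ 2 + 2 * B * t + C) -> B ^+ 2 <= A * C.
Proof.
rewrite le_eqVlt => /predU1P[<-|A0] key.
  rewrite mul0r leNgt; apply/negP => B0.
  have Bn : B != 0 by apply: contraTneq B0 => ->; rewrite expr0n ltxx.
  have := key (- (C + 1) / (2 * B)).
  have -> : 2 * B * (- (C + 1) / (2 * B)) = - (C + 1) by field.
  by lra.
have := key (- B / A).
have -> : A * (- B / A) ^+ 2 + 2 * B * (- B / A) + C = C - B ^+ 2 / A.
  by field; rewrite gt_eqF.
by rewrite subr_ge0 ler_pdivrMr // mulrC.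
Qed.

Lemma CS f g : Sq f -> Sq g ->
  I (fun x => f x * g x) ^+ 2 <= I (fun x => f x ^+ 2) * I (fun x => g x ^+ 2).
Proof.
move=> hf hg; apply: discriminant; first by apply: I_ge0 => x; exact: sqr_ge0.
move=> t; have hfg := SqM hf hg; case: hf hg => mf hf [mg hg].
rewrite mulrC [2 * _]mulrC -[_ * 2 * t]mulrA [_ * (2 * t)]mulrC.
rewrite -!I_Z // -!I_D //; try by [exact: IntZ|apply: IntD; exact: IntZ].
apply: I_ge0 => x.
rewrite (_ : _ + _ = (t * f x + g x) ^+ 2) ?sqr_ge0 //; ring.
Qed.

End SquareIntegrable.

Section Step.
Variable R : realType.
Local Notation mu := (@lebesgue_measure R).
Implicit Types f g h k : R -> R.

Definition step (a t : R) : R := ((t <= a)%R : bool)%:R.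

Lemma step_indic a : step a = \1_(`]-oo, a]%classic) :> (R -> R).
Proof. by apply/funext => t; rewrite /step indicE mem_setE in_itv. Qed.

Lemma meas_step a : meas (step a).
Proof. by rewrite step_indic; exact: measurable_indic. Qed.

Lemma step_ge0 a t : 0 <= step a t. Proof. by rewrite /step ler0n. Qed.
Lemma step_le1 a t : step a t <= 1. Proof. by rewrite /step lern1 leq_b1. Qed.
Lemma step_norm a t : `|step a t| <= 1. Proof. by rewrite ger0_norm ?step_ge0 ?step_le1. Qed.

Lemma meas_step2 : measurable_fun [set: R * R] (fun z : R * R => step z.1 z.2).
Proof.
have -> : (fun z : R * R => step z.1 z.2) = \1_[set z : R * R | z.2 <= z.1].
  by apply/funext => z; rewrite indicE /step; congr (_%:R); rewrite mem_setE.
apply: measurable_indic.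
have h := measurable_fun_ler (@measurable_snd _ _ R R) (@measurable_fst _ _ R R).
have := h measurableT [set true] Logic.I.
by rewrite setTI.
Qed.

Lemma step_indicr a : (fun x => step x a) = \1_(`[a, +oo[%classic) :> (R -> R).
Proof. by apply/funext => t; rewrite /step indicE mem_setE in_itv /= andbT. Qed.

Lemma meas_stepr a : meas (fun x => step x a).
Proof. by rewrite step_indicr; exact: measurable_indic. Qed.

Lemma IE f : Int f -> (\int[mu]_x (f x)%:E)%E = (I f)%:E.
Proof. by move=> hf; rewrite /I /Rintegral fineK // integrable_fin_num. Qed.

Lemma Int_step a f : Int f -> Int (fun x => step a x * f x).
Proof.
move=> hf; apply: (Int_le _ (IntA hf)).
  by apply: measM; [exact: meas_step|exact: Int_meas].
by move=> x; rewrite normrM ler_piMl // step_norm.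
Qed.

(** Both sides are the integral of f(x) g(y) over the half-plane y <= x. This
    identity is the whole content of integration by parts below. *)
Lemma fubini_step f g : Int f -> Int g ->
  I (fun x => f x * I (fun y => step x y * g y)) =
  I (fun y => g y * I (fun x => step x y * f x)).
Proof.
move=> hf hg.
pose F (z : R * R) : \bar R := (f z.1 * (step z.1 z.2 * g z.2))%:E.
have mf := Int_meas hf; have mg := Int_meas hg.
have mF : measurable_fun setT F.
  apply/measurable_EFinP; apply: measurable_funM.
    exact: (measurableT_comp mf measurable_fst).
  apply: measurable_funM; first exact: meas_step2.
  exact: (measurableT_comp mg measurable_snd).
have step_l x : Int (fun y => step x y * g y) by exact: Int_step.
have step_r y : Int (fun x => step x y * f x).
  apply: (Int_le _ (IntA hf)); first by apply: measM => //; exact: meas_stepr.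
  by move=> x; rewrite normrM ler_piMl // step_norm.
have iF : (mu \x mu)%E.-integrable setT F.
  apply/integrable12ltyP => //.
  have hfg : Int (fun x => `|f x| * I (fun y => `|g y|)).
    by apply: Int_ext (IntZ (I (fun y => `|g y|)) (IntA hf)) => x; rewrite mulrC.
  apply: (@le_lt_trans _ _ (\int[mu]_x (`|f x| * I (fun y => `|g y|))%:E)%E); last first.
    by rewrite (IE hfg) ltry.
  apply: ge0_le_integral => //.
  - by move=> x _; apply: integral_ge0.
  - have mF' : measurable_fun setT (abse \o F) by exact: measurableT_comp.
    exact: (@measurable_fun_fubini_tonelli_F _ _ _ _ R mu _ mF' (fun=> abse_ge0 _)).
  - exact: (measurable_int mu hfg).
  - move=> x _; rewrite /F /=.
    have h1 : Int (fun y => f x * (step x y * g y)) by exact: IntZ.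
    rewrite (IE (IntA h1)) lee_fin -I_Z; last exact: IntA.
    apply: I_le; [exact: IntA|exact/IntZ/IntA|].
    by move=> y; rewrite !normrM ler_wpM2l // ler_piMl // step_norm.
have := Fubini iF; rewrite /F /=.
under eq_integral => x _ do rewrite (IE (IntZ (f x) (step_l x))) I_Z //.
move=> h; rewrite /I {1}/Rintegral h; congr fine; apply: eq_integral => y _.
rewrite -I_Z //.
have h2 := IntZ (g y) (step_r y).
rewrite -(IE h2); apply: eq_integral => x _; congr (_%:E); ring.
Qed.

End Step.

(** * Absolutely continuous functions *)

Section AbsolutelyContinuous.
Variable R : realType.
Local Notation mu := (@lebesgue_measure R).
Implicit Types f g h k l : R -> R.

(** The indicator of ]a, b] when a <= b, and minus that of ]b, a] otherwise:
    integrating against it gives oriented integrals. *)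
Definition win (a b t : R) : R := step b t - step a t.

Lemma win_norm a b t : `|win a b t| <= 1.
Proof.
have := step_ge0 a t; have := step_le1 a t; have := step_ge0 b t; have := step_le1 b t.
by rewrite ler_norml /win => *; apply/andP; split; lra.
Qed.

Lemma win_le a b t : a <= b -> win a b t = \1_(`]a, b]%classic) t :> R.
Proof.
move=> ab; rewrite indicE mem_setE in_itv /= /win /step.
case: (leP t b) => tb; case: (leP t a) => ta /=; rewrite ?subrr ?subr0 //.
by move: (le_trans ta ab); rewrite leNgt tb.
Qed.

Lemma win_swap a b t : win a b t = - win b a t.
Proof. by rewrite /win opprB. Qed.

Lemma win_supp a b t : win a b t != 0 -> `|t| <= `|a| + `|b|.
Proof.
rewrite /win /step; case: (leP t b) => tb; case: (leP t a) => ta; rewrite ?subrr ?eqxx // => _.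
  rewrite ler_norml; have := ler_norm b; have := ler_norm (- a); rewrite normrN.
  by have := normr_ge0 a; have := normr_ge0 b => *; apply/andP; split; lra.
rewrite ler_norml; have := ler_norm a; have := ler_norm (- b); rewrite normrN.
by have := normr_ge0 a; have := normr_ge0 b => *; apply/andP; split; lra.
Qed.

Lemma meas_win a b : meas (win a b).
Proof. by apply: measB; exact: meas_step. Qed.

Lemma Int_win a b : Int (win a b).
Proof.
wlog ab : a b / a <= b.
  move=> h; have [/h //|ba] := leP a b.
  by apply: Int_ext (IntN (h _ _ (ltW ba))) => t; rewrite -win_swap.
apply: (@Int_ext _ \1_(`]a, b]%classic)) => [t|]; first by rewrite win_le.
exact: integrable_indic_itv.
Qed.

Lemma I_win a b : a <= b -> I (win a b) = b - a.
Proof.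
move=> ab; rewrite (@I_ext _ _ \1_(`]a, b]%classic)); last by move=> t; rewrite win_le.
rewrite /I /Rintegral integral_indic // setIT.
suff h : lebesgue_measure (`]a, b]%classic : set R) = (b - a)%:E.
  by transitivity (fine (b - a)%:E) => //; congr fine; exact: h.
rewrite lebesgue_measure_itv /= lte_fin.
by case: ltP => [_|ba] //=; rewrite (le_anti (introT andP (conj ab ba))) subrr.
Qed.

Definition Lloc k := meas k /\ forall a b, Int (fun t => win a b t * k t).
(** f is absolutely continuous with derivative k, which matters only almost
    everywhere. *)
Definition isAC f k := Lloc k /\ forall a b, f b - f a = I (fun t => win a b t * k t).
Definition locbd f := forall N : R, exists M, forall t, `|t| <= N -> `|f t| <= M.

Lemma Int_Lloc k : Int k -> Lloc k.
Proof.
move=> hk; split; first exact: Int_meas.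
move=> a b; apply: (Int_le _ (IntA hk)).
  by apply: measM; [exact: meas_win|exact: Int_meas].
by move=> t; rewrite normrM ler_piMl // win_norm.
Qed.

Lemma LlocD k l : Lloc k -> Lloc l -> Lloc (fun t => k t + l t).
Proof.
move=> [mk hk] [ml hl]; split; first exact: measD.
by move=> a b; apply: Int_ext (IntD (hk a b) (hl a b)) => t; rewrite mulrDr.
Qed.

Lemma LlocM f k : meas f -> locbd f -> Lloc k -> Lloc (fun t => f t * k t).
Proof.
move=> mf bf [mk hk]; split; first exact: measM.
move=> a b; have [M hM] := bf (`|a| + `|b|).
apply: (Int_le _ (IntZ M (IntA (hk a b)))).
  by apply: measM; [exact: meas_win|exact: measM].
move=> t; rewrite mulrCA normrM; have [->|w0] := eqVneq (win a b t) 0.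
  by rewrite mul0r !normr0 !mulr0.
by rewrite ler_wpM2r // hM // win_supp.
Qed.

Lemma Lloc1 : Lloc (fun=> 1).
Proof.
split; first exact: measc.
by move=> a b; apply: Int_ext (Int_win a b) => t; rewrite mulr1.
Qed.

Lemma locbd_Lloc f : meas f -> locbd f -> Lloc f.
Proof.
move=> mf bf; have := LlocM mf bf Lloc1.
by rewrite (_ : (fun t => _) = f) //; apply/funext => t; rewrite mulr1.
Qed.

Lemma locbd_cont f : continuous f -> locbd f.
Proof.
move=> cf N; have [N0|N0] := ltP N 0.
  by exists 0 => t h; have := normr_ge0 t; lra.
have NN : - N <= N by lra.
have cF : {within `[- N, N], continuous (fun t => `|f t|)}.
  apply: continuous_subspaceT => t.
  by apply: (@continuous_comp _ _ _ f (fun y => `|y|)); [exact: cf|exact: norm_continuous].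
have [c _ hc] := EVT_max NN cF.
by exists `|f c| => t; rewrite ler_norml => tN; apply: hc; rewrite in_itv.
Qed.

Section Basics.
Variables f k : R -> R.
Hypothesis fk : isAC f k.
Let mk : meas k. Proof. by case: fk => -[]. Qed.
Let ik a b : Int (fun t => win a b t * k t). Proof. by case: fk => -[]. Qed.
Let fE a b : f b - f a = I (fun t => win a b t * k t). Proof. by case: fk. Qed.

Lemma win_itv a b : a <= b ->
  (fun t => win a b t * k t) = k \_ `]a, b]%classic.
Proof.
move=> ab; apply/funext => t; rewrite win_le // indicE patchE.
by case: (t \in _); rewrite ?mul1r ?mul0r.
Qed.

Lemma AC_locbd : locbd f.
Proof.
move=> N; exists (`|f (- N)| + I (fun t => `|win (- N) N t * k t|)) => t.
rewrite ler_norml => /andP[Nt tN].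
have -> : f t = f (- N) + (f t - f (- N)) by ring.
apply: le_trans (ler_normD _ _) _; rewrite lerD2l fE.
apply: le_trans (I_abs (ik _ _)) _; apply: I_le; try exact: IntA.
move=> u; rewrite !normrM ler_wpM2r //.
have Nt' : - N <= N by exact: le_trans Nt tN.
rewrite !win_le // !indicE !mem_setE !in_itv /=.
case: (ltP (- N) u) => h1 //=; case: (leP u t) => h2 /=; rewrite ?normr0 //.
by rewrite (le_trans h2 tN).
Qed.

Lemma AC_integrable_itv a b : a <= b -> mu.-integrable `]a, b] (EFin \o k).
Proof.
move=> ab; apply/(integrable_mkcond _ _).2 => //.
by have := ik a b; rewrite win_itv // /Int -restrict_EFin.
Qed.

Lemma AC_integrable_itv' a b : mu.-integrable `[a, b] (EFin \o k).
Proof.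
have [ab|ba] := leP (a - 1) b; last first.
  by rewrite set_itv_ge ?bnd_simp -?ltNge; [exact: integrable_set0|lra].
apply: (integrableS _ _ _ (AC_integrable_itv ab)) => //.
by move=> t /=; rewrite !in_itv /= => /andP[at_ ->]; rewrite andbT; lra.
Qed.

Lemma AC_itv a b : a <= b -> f b - f a = \int[mu]_(t in `[a, b]) k t.
Proof.
move=> ab; rewrite fE win_itv // /I -Rintegral_mkcond Rintegral_itv_obnd_cbnd //.
exact: AC_integrable_itv.
Qed.

Lemma AC_continuous : continuous f.
Proof.
move=> x; pose a := x - 1; pose b := x + 1.
have ab : a < b by rewrite /a /b; lra.
have := parameterized_integral_continuous (ltW ab) (AC_integrable_itv' a b).
move=> /(continuous_within_itvP _ ab) [h _ _].
have xab : x \in `]a, b[ by rewrite in_itv /= /a /b; apply/andP; split; lra.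
have hx := h x xab.
have near_eq : {near x, (fun y => f a + parameterized_integral mu a y k) =1 f}.
  have : \forall y \near x, y \in `]a, b[ by exact: near_in_itvoo.
  apply: filterS => y; rewrite in_itv /= => /andP[ay yb].
  rewrite /parameterized_integral -AC_itv; [ring|exact: ltW].
have c : (fun y => f a + parameterized_integral mu a y k) y @[y --> x] -->
   f a + parameterized_integral mu a x k by apply: cvgD => //; exact: cvg_cst.
have e := nbhs_singleton near_eq; rewrite /= in e; rewrite e in c; apply: cvg_trans c.
by apply: near_eq_cvg; apply: filterS near_eq => y ->.
Qed.

Lemma AC_meas : meas f.
Proof. exact: meas_cont AC_continuous. Qed.

Lemma AC_Lloc : Lloc f.
Proof. exact: locbd_Lloc AC_meas AC_locbd. Qed.

End Basics.

Lemma isAC_le f k : Lloc k ->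
  (forall a b, a <= b -> f b - f a = I (fun t => win a b t * k t)) -> isAC f k.
Proof.
move=> [mk hk] h; split=> // a b; have [/h //|ba] := leP a b.
rewrite -opprB (h _ _ (ltW ba)) -I_N //.
by apply: I_ext => t; rewrite (win_swap a b) mulNr.
Qed.

End AbsolutelyContinuous.

(** * Calculus of absolutely continuous functions *)

Section ACTheory.
Variable R : realType.
Local Notation mu := (@lebesgue_measure R).
Implicit Types f g h k l : R -> R.

Lemma AC_Int f k a b : isAC f k -> Int (fun t => win a b t * k t).
Proof. by move=> [[]]. Qed.

Lemma AC_measd f k : isAC f k -> meas k.
Proof. by move=> [[]]. Qed.

Lemma AC_E f k a b : isAC f k -> f b - f a = I (fun t => win a b t * k t).
Proof. by move=> [_ ->]. Qed.

Lemma win_step (a b t s : R) : a < t -> t <= b -> win a t s = step t s * win a b s.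
Proof.
rewrite /win /step => at_ tb.
case: (leP s t) => st; case: (leP s a) => sa; case: (leP s b) => sb /=; try ring.
- by move: (le_trans sa (le_trans (ltW at_) tb)); rewrite leNgt sb.
- by move: (le_trans st tb); rewrite leNgt sb.
- by move: (lt_trans at_ (lt_le_trans st sa)); rewrite ltxx.
- by move: (lt_trans at_ (lt_le_trans st sa)); rewrite ltxx.
Qed.

(** Recasts f - f a on ]a, b] as an integral over a half-line, to which
    [fubini_step] applies. *)
Lemma AC_windowed f k a b t : a <= b -> isAC f k ->
  win a b t * (f t - f a) = win a b t * I (fun s => step t s * (win a b s * k s)).
Proof.
move=> ab fk; rewrite (AC_E a t fk) win_le // indicE mem_setE in_itv /=.
case: (ltP a t) => [at_|]; case: (leP t b) => [tb|] /=; rewrite ?mul0r // => *.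
by congr (_ * _); apply: I_ext => s; rewrite (win_step _ at_ tb) mulrA.
Qed.

(** The two half-lines overlap in a point, which is negligible. *)
Lemma step_total k : Int k -> forall x,
  I (fun y => step x y * k y) + I (fun y => step y x * k y) = I k.
Proof.
move=> hk x.
have h1 : Int (fun y => step x y * k y) by exact: Int_step.
have h2 : Int (fun y => step y x * k y).
  apply: (Int_le _ (IntA hk)).
    by apply: measM; [exact: meas_stepr|exact: Int_meas].
  by move=> y; rewrite normrM ler_piMl // step_norm.
rewrite -I_D //; apply: I_ae; [by apply: Int_meas; exact: IntD|exact: Int_meas|].
exists [set x]; split; [by []|exact: lebesgue_measure_set1|].
move=> y /= h; apply: contrapT => yx; apply: h => _.
rewrite /step; case: (ltgtP y x) => [_|_|//] /=; ring.
Qed.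

(** After subtracting f a and g a, the integral of f' g and that of f g' are
    those of f'(s) g'(t) over two complementary triangles. *)
Lemma AC_mul f g k l : isAC f k -> isAC g l ->
  isAC (fun t => f t * g t) (fun t => k t * g t + f t * l t).
Proof.
move=> fk gl; apply: isAC_le.
  apply: LlocD.
    rewrite (_ : (fun t => _) = (fun t => g t * k t)); last by apply/funext => t; rewrite mulrC.
    by apply: LlocM; [exact: AC_meas gl|exact: AC_locbd gl|case: fk].
  by apply: LlocM; [exact: AC_meas fk|exact: AC_locbd fk|case: gl].
move=> a b ab.
pose k' t := win a b t * k t; pose l' t := win a b t * l t.
have ik : Int k' := AC_Int a b fk; have il : Int l' := AC_Int a b gl.
have bdI f0 k0 : isAC f0 k0 -> forall k1, Lloc k1 -> Int (fun t => win a b t * k1 t * (f0 t - f0 a)).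
  move=> h k1 [mk1 hk1]; have [M hM] := AC_locbd h (`|a| + `|b|).
  apply: (Int_le _ (IntZ (M + `|f0 a|) (IntA (hk1 a b)))).
    apply: measM; first exact: measM (meas_win a b) mk1.
    by apply: measB; [exact: AC_meas h|exact: measc].
  move=> t; rewrite normrM mulrC; have [->|w0] := eqVneq (win a b t) 0.
    by rewrite mul0r normr0 !mulr0.
  apply: ler_wpM2r => //; apply: le_trans (ler_normB _ _) _.
  by rewrite lerD2r; apply: hM; exact: win_supp.
have e1 : I (fun t => win a b t * k t * (g t - g a)) =
    I (fun x => k' x * I (fun y => step x y * l' y)).
  apply: I_ext => t; rewrite -mulrA mulrCA (AC_windowed _ ab gl) /k'; ring.
have e2 : I (fun t => win a b t * l t * (f t - f a)) =
    I (fun x => l' x * I (fun y => step x y * k' y)).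
  apply: I_ext => t; rewrite -mulrA mulrCA (AC_windowed _ ab fk) /l'; ring.
have i1 := bdI _ _ gl _ fk.1; have i2 := bdI _ _ fk _ gl.1.
have e3 : I (fun t => win a b t * k t * (g t - g a)) + I (fun t => win a b t * l t * (f t - f a))
    = (f b - f a) * (g b - g a).
  rewrite e1 (fubini_step ik il) e2 (AC_E a b fk) (AC_E a b gl) -/k' -/l'.
  have i3 : Int (fun x => l' x * I (fun y => step x y * k' y)).
    by apply: Int_ext i2 => t; rewrite -mulrA mulrCA (AC_windowed _ ab fk) /l'; ring.
  have i4 : Int (fun y => l' y * I (fun x => step x y * k' x)).
    apply: Int_ext (IntB (IntZ (I k') il) i3) => t.
    by rewrite -(step_total ik t); ring.
  rewrite -I_D // -I_Z //; apply: I_ext => t.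
  by rewrite -(step_total ik t); ring.
rewrite (@I_ext _ _ (fun t => (win a b t * k t * (g t - g a) + win a b t * l t * (f t - f a))
   + (g a * (win a b t * k t) + f a * (win a b t * l t)))); last by move=> t; ring.
rewrite I_D ?I_D ?I_Z //; try by [exact: IntZ|exact: IntD|apply: IntD; exact: IntZ].
by rewrite e3 -(AC_E a b fk) -(AC_E a b gl); ring.
Qed.

Lemma AC_add f g k l : isAC f k -> isAC g l ->
  isAC (fun t => f t + g t) (fun t => k t + l t).
Proof.
move=> fk gl; split; first by apply: LlocD; [case: fk|case: gl].
move=> a b; have e : (fun t => win a b t * (k t + l t)) =
   (fun t => win a b t * k t + win a b t * l t) by apply/funext => t; ring.
rewrite e I_D; [|exact: AC_Int fk|exact: AC_Int gl].
by rewrite -(AC_E a b fk) -(AC_E a b gl); ring.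
Qed.

Lemma AC_cst (c : R) : isAC (fun=> c) (fun=> 0).
Proof.
split; first by apply: Int_Lloc; exact: Int0.
move=> a b; rewrite subrr (@I_ext _ _ (fun=> 0)) ?I_0 // => t.
by rewrite mulr0.
Qed.

Lemma AC_eq f g k l : isAC f k -> f =1 g -> k =1 l -> isAC g l.
Proof. by move=> h /funext <- /funext <-. Qed.

Lemma AC_Z c f k : isAC f k -> isAC (fun t => c * f t) (fun t => c * k t).
Proof.
move=> fk; apply: AC_eq (AC_mul (AC_cst c) fk) _ _ => // t.
by rewrite mul0r add0r.
Qed.

Lemma AC_N f k : isAC f k -> isAC (fun t => - f t) (fun t => - k t).
Proof. by move=> /(AC_Z (-1)) h; apply: AC_eq h _ _ => t; rewrite mulN1r. Qed.

Lemma AC_B f g k l : isAC f k -> isAC g l ->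
  isAC (fun t => f t - g t) (fun t => k t - l t).
Proof. by move=> fk /AC_N; exact: AC_add. Qed.

Lemma AC_ae f k l : isAC f k -> meas l -> aeeqr k l -> isAC f l.
Proof.
move=> [[mk hk] fE] ml kl.
have h a b : aeeqr (fun t => win a b t * k t) (fun t => win a b t * l t).
  exact: (ae_comp1 (fun t x => win a b t * x) kl).
have m a b : meas (fun t => win a b t * l t) by apply: measM => //; exact: meas_win.
split; first by split=> // a b; apply: Int_ae (hk a b) (m a b) (h a b).
by move=> a b; rewrite fE; apply: I_ae => //; apply: measM => //; exact: meas_win.
Qed.

Lemma AC_prim k : Lloc k -> isAC (fun x => I (fun t => win 0 x t * k t)) k.
Proof.
move=> [mk hk]; split=> // a b; rewrite -I_B //.
by apply: I_ext => t; rewrite /win; ring.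
Qed.

Lemma AC_C1 f k : (forall x : R, is_derive x (1 : R) f (k x)) -> continuous k -> isAC f k.
Proof.
move=> df ck; have mk := meas_cont ck.
have lk : Lloc k by apply: locbd_Lloc => //; exact: locbd_cont.
apply: isAC_le => // a b; rewrite le_eqVlt => /predU1P[<-|ab].
  rewrite subrr (@I_ext _ _ (fun=> 0)) ?I_0 // => t.
  by rewrite /win subrr mul0r.
have cf : continuous f.
  by move=> x; apply: differentiable_continuous; apply/derivable1_diffP; case: (df x).
rewrite win_itv ?ltW // /I -Rintegral_mkcond Rintegral_itv_obnd_cbnd; last first.
  apply/(integrable_mkcond _ _).2 => //.
  by have := lk.2 a b; rewrite win_itv ?ltW // /Int -restrict_EFin.
rewrite /Rintegral (@continuous_FTC2 _ k f) //.
- exact: continuous_subspaceT.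
- split.
  + by move=> x _; case: (df x).
  + exact: cvg_at_right_filter (cf a).
  + exact: cvg_at_left_filter (cf b).
- by move=> x _; rewrite derive1E; case: (df x).
Qed.

End ACTheory.

(** * Behaviour at infinity and almost everywhere *)

Section Limits.
Variable R : realType.
Local Notation mu := (@lebesgue_measure R).
Implicit Types f g h k l : R -> R.

Lemma nat_above (x : R) : exists n : nat, x <= n%:R.
Proof.
exists (Num.bound x); apply: le_trans (ler_norm x) _.
by have := archi_boundP (normr_ge0 x); rewrite /Num.bound normr_id => /ltW.
Qed.

Lemma Int_costep a k : Int k -> Int (fun t => (1 - step a t) * k t).
Proof.
move=> hk; apply: Int_ext (IntB hk (Int_step a hk)) => t; ring.
Qed.

Lemma step_cvg1 (t : R) : step (n%:R : R) t @[n --> \oo] --> (1 : R).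
Proof.
have [N hN] := nat_above t; apply: cvg_near_cst; exists N => // n /= Nn.
by rewrite /step (le_trans hN) // ler_nat.
Qed.

Lemma step_cvg0 (t : R) : step (- n%:R : R) t @[n --> \oo] --> (0 : R).
Proof.
have [N hN] := nat_above (- t + 1); apply: cvg_near_cst; exists N => // n /= Nn.
rewrite /step leNgt; have : (N%:R : R) <= n%:R by rewrite ler_nat.
by move=> h; have -> : - n%:R < t by lra.
Qed.

Lemma tail_right k : Int k -> I (fun t => (1 - step n%:R t) * k t) @[n --> \oo] --> 0.
Proof.
move=> hk; rewrite -(I_0 R).
apply: (@DCT _ (fun n t => (1 - step n%:R t) * k t) (fun=> 0) (fun t => `|k t|)).
- by move=> n; apply: Int_meas; exact: Int_costep.
- exact: measc.
- exact: IntA.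
- move=> t; have h : (1 - step (n%:R : R) t) * k t @[n --> \oo] --> (1 - 1) * k t.
    by apply: cvgM; [apply: cvgB; [exact: cvg_cst|exact: step_cvg1]|exact: cvg_cst].
  by rewrite subrr mul0r in h.
- move=> n t; rewrite normrM ler_piMl //.
  by have := step_ge0 n%:R t; have := step_le1 n%:R t; rewrite ler_norml => *; apply/andP; split; lra.
Qed.

Lemma tail_left k : Int k -> I (fun t => step (- n%:R) t * k t) @[n --> \oo] --> 0.
Proof.
move=> hk; rewrite -(I_0 R).
apply: (@DCT _ (fun n t => step (- n%:R) t * k t) (fun=> 0) (fun t => `|k t|)).
- by move=> n; apply: Int_meas; exact: Int_step.
- exact: measc.
- exact: IntA.
- move=> t; have h : step (- n%:R : R) t * k t @[n --> \oo] --> 0 * k t.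
    by apply: cvgM; [exact: step_cvg0|exact: cvg_cst].
  by rewrite mul0r in h.
- by move=> n t; rewrite normrM ler_piMl // step_norm.
Qed.

Lemma cvg0_exists (u : nat -> R) e : u n @[n --> \oo] --> 0 -> 0 < e -> exists n, `|u n| < e.
Proof.
move=> /cvgr0Pnorm_lt h e0; have [N _ hN] := h _ e0.
by exists N; apply: hN => /=.
Qed.

(** This excludes nonzero limits at infinity for square-integrable functions.
    *)
Lemma Sq_not_large f e : Sq f -> 0 < e ->
  (forall M : nat, exists a, forall t, a < t -> t <= a + M%:R -> e <= `|f t|) -> False.
Proof.
move=> [mf hf] e0 h.
have [M hM] := nat_above (I (fun t => f t ^+ 2) / e ^+ 2 + 1).
have [a ha] := h M.
have e2 : 0 < e ^+ 2 by rewrite exprn_gt0.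
have aM : a <= a + M%:R by rewrite lerDl ler0n.
have : I (fun t => e ^+ 2 * win a (a + M%:R) t) <= I (fun t => f t ^+ 2).
  apply: I_le => //; first by apply: IntZ; exact: Int_win.
  move=> t; rewrite win_le // indicE mem_setE in_itv /=.
  case: (ltP a t) => h1; rewrite ?mulr0 ?sqr_ge0 //=.
  case: (leP t (a + M%:R)) => h2; rewrite ?mulr0 ?sqr_ge0 // mulr1.
  by rewrite -[leRHS]real_normK ?num_real // lerXn2r ?nnegrE ?ha // ltW.
rewrite I_Z ?I_win //; last exact: Int_win.
rewrite addrC addKr mulrC -ler_pdivlMr //; lra.
Qed.

(** The first two terms are the limit of f at plus infinity and the last one
    is the tail of its derivative. *)
Lemma AC_right_limit f k x : isAC f k -> Int k ->
  f x = f 0 + I (fun t => (1 - step 0 t) * k t) - I (fun t => (1 - step x t) * k t).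
Proof.
move=> fk hk; rewrite -addrA -I_B; [|exact: Int_costep..].
rewrite -[LHS](subrK (f 0)) (AC_E 0 x fk) addrC; congr (_ + _).
by apply: I_ext => t; rewrite /win; ring.
Qed.

Lemma AC_left_limit f k x : isAC f k -> Int k ->
  f x = f 0 - I (fun t => step 0 t * k t) + I (fun t => step x t * k t).
Proof.
move=> fk hk; rewrite addrAC -addrA -I_B; [|exact: Int_step..].
rewrite -[LHS](subrK (f 0)) (AC_E 0 x fk) addrC; congr (_ + _).
by apply: I_ext => t; rewrite /win; ring.
Qed.

Lemma AC_Sq_right f k : isAC f k -> Int k -> Sq f ->
  forall x, f x = - I (fun t => (1 - step x t) * k t).
Proof.
move=> fk hk sf x; rewrite (AC_right_limit x fk hk).
set L := f 0 + _; suff -> : L = 0 by rewrite sub0r.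
apply/eqP/negP => /negP L0; have e0 : 0 < `|L| / 2 by rewrite divr_gt0 ?normr_gt0.
have [N hN] := cvg0_exists (tail_right (IntA hk)) e0.
apply: (Sq_not_large sf e0) => M; exists N%:R => t Nt _.
rewrite (AC_right_limit t fk hk) -/L.
have h1 : `|I (fun t0 => (1 - step t t0) * k t0)| < `|L| / 2.
  apply: le_lt_trans hN; apply: le_trans (I_abs _) _; first exact: Int_costep.
  apply: le_trans (ler_norm _); apply: I_le.
  - exact/IntA/Int_costep.
  - exact/Int_costep/IntA.
  move=> u; rewrite normrM ler_wpM2r // /step.
  case: (leP u t) => ut; case: (leP u N%:R) => uN; rewrite ?subrr ?subr0 ?normr0 ?normr1 //.
  by move: (lt_trans Nt ut); rewrite ltNge uN.
have := lerB_dist L (I (fun t0 => (1 - step t t0) * k t0)); lra.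
Qed.

Lemma AC_Sq_left f k : isAC f k -> Int k -> Sq f ->
  forall x, f x = I (fun t => step x t * k t).
Proof.
move=> fk hk sf x; rewrite (AC_left_limit x fk hk).
set L := f 0 - _; suff -> : L = 0 by rewrite add0r.
apply/eqP/negP => /negP L0; have e0 : 0 < `|L| / 2 by rewrite divr_gt0 ?normr_gt0.
have [N hN] := cvg0_exists (tail_left (IntA hk)) e0.
apply: (Sq_not_large sf e0) => M; exists (- N%:R - M%:R) => t _ tN.
have {}tN : t <= - N%:R by lra.
rewrite (AC_left_limit t fk hk) -/L.
have h1 : `|I (fun t0 => step t t0 * k t0)| < `|L| / 2.
  apply: le_lt_trans hN; apply: le_trans (I_abs _) _; first exact: Int_step.
  apply: le_trans (ler_norm _); apply: I_le.
  - exact/IntA/Int_step.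
  - exact/Int_step/IntA.
  move=> u; rewrite normrM ler_wpM2r // /step.
  case: (leP u t) => ut; case: (leP u (- N%:R)) => uN; rewrite ?normr0 ?normr1 //.
  by move: (le_trans ut tN); rewrite leNgt uN.
have := lerB_dist L (- I (fun t0 => step t t0 * k t0)); rewrite opprK normrN; lra.
Qed.

(** Whole-line integration by parts: a square-integrable function with
    integrable derivative tends to 0 at both ends. *)
Lemma AC_total h k : isAC h k -> Int k -> Sq h -> I k = 0.
Proof.
move=> hk ik sh; have e1 := AC_Sq_right hk ik sh 0; have e2 := AC_Sq_left hk ik sh 0.
have -> : I k = I (fun t => step 0 t * k t) + I (fun t => (1 - step 0 t) * k t).
  rewrite -I_D; [|exact: Int_step|exact: Int_costep].
  by apply: I_ext => t; ring.
lra.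
Qed.

Lemma AC_bounded f k : isAC f k -> Int k -> exists M, forall x, `|f x| <= M.
Proof.
move=> fk hk; exists (`|f 0| + I (fun t => `|k t|)) => x.
rewrite -[f x](subrK (f 0)) addrC; apply: le_trans (ler_normD _ _) _.
rewrite lerD2l (AC_E 0 x fk); apply: le_trans (I_abs (AC_Int _ _ fk)) _.
apply: I_le; [exact/IntA/(AC_Int _ _ fk)|exact: IntA|].
by move=> t; rewrite normrM ler_piMl // win_norm.
Qed.

(** The derivative 2 f k of f^2 is integrable. *)
Lemma AC_Sq_bounded f k : isAC f k -> Sq f -> Sq k -> exists M, forall x, `|f x| <= M.
Proof.
move=> fk sf sk.
have h := AC_mul fk fk; have ifk := SqM sf sk.
have ih : Int (fun t => k t * f t + f t * k t).
  by apply: Int_ext (IntZ 2 ifk) => t; ring.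
have [M hM] := AC_bounded h ih; exists (M + 1) => x.
have M0 : 0 <= M by apply: le_trans (hM 0).
have := hM x; rewrite normrM -expr2 => h1.
have [//|h2] := leP `|f x| (M + 1).
have : (M + 1) ^+ 2 <= `|f x| ^+ 2 by apply: lerXn2r; rewrite ?nnegrE; [lra|by []|exact: ltW].
by have := sqr_ge0 M; rewrite expr2 => ? ?; lra.
Qed.

End Limits.

Section LocalIntegrability.
Variable R : realType.
Local Notation mu := (@lebesgue_measure R).
Implicit Types f g h k l : R -> R.

Lemma Lloc_itv k a b : Lloc k -> mu.-integrable `[a, b] (EFin \o k).
Proof. by move=> hk; exact: AC_integrable_itv' (AC_prim hk) _ _. Qed.

Lemma Lloc_locally_integrable k : Lloc k <-> locally_integrable [set: R] k.
Proof.
split=> [hk|[mk _ hk]].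
  split; [exact: hk.1|exact: openT|move=> K _ cK].
  have [M [_ hM]] := compact_bounded cK.
  pose N := `|M| + 1.
  have KN : K `<=` `[- N, N]%classic.
    move=> t Kt; have := hM N _ t Kt; rewrite /= in_itv /= -ler_norml; apply.
    by rewrite /N; have := ler_norm M; lra.
  have /integrableP[_ h] := Lloc_itv (- N) N hk.
  apply: le_lt_trans h; apply: ge0_subset_integral => //=.
  - exact: compact_measurable.
  - have h2 := measA hk.1; apply: (measurable_funTS (D := `[- N, N]%classic)); exact/measurable_EFinP.
split=> // a b.
wlog ab : a b / a <= b.
  move=> h; have [/h //|ba] := leP a b.
  by apply: Int_ext (IntN (h _ _ (ltW ba))) => t; rewrite (win_swap a b) mulNr.
rewrite win_itv // /Int -restrict_EFin; apply/(integrable_mkcond _ _).1 => //.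
apply: (@integrableS _ _ _ mu `[a, b]%classic) => //.
  by move=> t /=; rewrite !in_itv /= => /andP[/ltW -> ->].
apply/integrableP; split; first by apply/measurable_EFinP/measurable_funTS.
by apply: hk => //; exact: segment_compact.
Qed.

(** Lebesgue's differentiation theorem, applied to the vanishing primitives of
    k on each half-line. *)
Lemma win_zero_ae k : Lloc k -> (forall a b, I (fun t => win a b t * k t) = 0) ->
  aeeqr k (fun=> 0).
Proof.
move=> hk h0.
have Fz (a : R) : (fun x => \int[mu]_(t in [set` Interval (BLeft a) (BRight x)]) k t) = cst 0.
  apply/funext => x; have [ax|xa] := leP a x.
    by rewrite -(AC_itv (AC_prim hk)) // (AC_E a x (AC_prim hk)) h0.
  by rewrite set_itv_ge ?Rintegral_set0 // bnd_simp -ltNge.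
have ae n : {ae mu, forall x, - n%:R < x -> k x = 0}.
  have := @FTC1 R k (BLeft (- n%:R)) (fun y => Lloc_itv _ y hk) ((Lloc_locally_integrable k).1 hk).
  rewrite /= Fz; apply: ae_map1 => x h nx.
  have [|_ <-] := h; first by rewrite lte_fin.
  by rewrite derive1_cst.
have := @ae_foralln _ _ _ mu _ ae.
apply: ae_map1 => x h _; have [n hn] := nat_above (- x + 1).
by apply: (h n); lra.
Qed.

(** The two functions are continuous, and a nonempty open set is not
    negligible. *)
Lemma AC_ae_eq f g k l : isAC f k -> isAC g l -> aeeqr f g -> f = g.
Proof.
move=> fk gl [N [mN N0 hN]]; apply/funext => x; apply: contrapT => neq.
have h := AC_B fk gl; have ch := AC_continuous h.
have nz : f x - g x != 0 by rewrite subr_eq0; apply/eqP.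
have : \forall y \near x, f y - g y != 0.
  have := ch x => /cvgrPdist_lt /(_ `|f x - g x|).
  rewrite normr_gt0 => /(_ nz); apply: filterS => y; apply: contraTneq => ->.
  by rewrite subr0 ltxx.
move=> [e /= e0 he].
have bN : ball x e `<=` N.
  move=> y /he /= nzy; apply: hN => /= hy; move: nzy.
  by rewrite hy // subrr eqxx.
have : (mu (ball x e) <= mu N)%E by apply: le_measure => //; rewrite inE //; exact: measurable_ball.
rewrite N0 (lebesgue_measure_ball x (ltW e0)) lee_fin => h1.
by have : 0 < e *+ 2 by [rewrite pmulrn_lgt0]; rewrite ltNge h1.
Qed.

End LocalIntegrability.

(** * Smooth functions *)

Section Smooth.
Variable R : realType.
Implicit Types f g : R -> R.

(** Being n times differentiable, peeling off the innermost derivative so that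
    inductions go through. *)
Fixpoint Sm (n : nat) f : Prop :=
  if n is m.+1 then (forall x : R, derivable f x (1 : R)) /\ Sm m (derive1 f) else True.

Definition smooth f := forall n, Sm n f.

Lemma smooth_derivable f x : smooth f -> derivable f x (1 : R).
Proof. by move=> /(_ 1%N) []. Qed.

Lemma smooth_derive f : smooth f -> smooth (derive1 f).
Proof. by move=> h n; have [] := h n.+1. Qed.

Lemma smooth_continuous f : smooth f -> continuous f.
Proof.
move=> h x; apply: differentiable_continuous; apply/derivable1_diffP.
exact: smooth_derivable.
Qed.

Lemma smoothP f : smooth f <-> (forall (n : nat) (x : R), derivable (derive1n n f) x 1).
Proof.
split=> [h n|h n].
  elim: n f h => [|n IH] f h x; first exact: smooth_derivable.
  by rewrite derive1Sn; apply: IH; exact: smooth_derive.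
elim: n f h => // n IH f h; split; first exact: (h 0%N).
by apply: IH => m x; rewrite -derive1Sn; exact: h.
Qed.

Lemma Sm_le n f : Sm n.+1 f -> Sm n f.
Proof. by elim: n f => // n IH f [df /IH]. Qed.

Lemma SmD n f g : Sm n f -> Sm n g -> Sm n (f \+ g).
Proof.
elim: n f g => // n IH f g [df sf] [dg sg]; split.
  by move=> x; exact: derivableD.
have -> : derive1 (f \+ g) = (derive1 f) \+ (derive1 g).
  by apply/funext => x; rewrite /= !derive1E deriveD.
exact: IH.
Qed.

Lemma SmM n f g : Sm n f -> Sm n g -> Sm n (fun x => f x * g x).
Proof.
elim: n f g => // n IH f g [df sf] [dg sg]; split.
  by move=> x; exact: derivableM.
have -> : derive1 (fun x => f x * g x) = (fun x => f x * (derive1 g) x) \+ (fun x => g x * (derive1 f) x).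
  by apply/funext => x; rewrite /= !derive1E deriveM.
by apply: SmD; apply: IH => //; apply: Sm_le.
Qed.

Lemma Sm_cst n (c : R) : Sm n (fun=> c).
Proof.
elim: n c => // n IH c; split; first by move=> x; exact: derivable_cst.
have -> : derive1 (fun=> c) = (fun=> 0 : R) by apply/funext => x; rewrite derive1_cst.
exact: IH.
Qed.

Lemma Sm_affine n f (c d : R) : Sm n f -> Sm n (fun x => f (c * x + d)).
Proof.
elim: n f => // n IH f [df sf].
have h x : is_derive x (1 : R) (fun x => f (c * x + d)) (c * (derive1 f) (c * x + d)).
  have h1 : is_derive (c * x + d) (1 : R) f ((derive1 f) (c * x + d)).
    by apply: DeriveDef => //; rewrite derive1E.
  have h2 : is_derive x (1 : R) (fun x : R => c * x + d) c.
    by apply: is_derive_eq; rewrite /GRing.scale /=; ring.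
  by have := @is_derive1_comp _ f (fun x => c * x + d) x _ _ h1 h2; rewrite mulrC.
split; first by move=> x; case: (h x).
have -> : derive1 (fun x => f (c * x + d)) = (fun x => c * (derive1 f) (c * x + d)).
  by apply/funext => x; rewrite derive1E; case: (h x).
by apply: SmM; [exact: Sm_cst|exact: IH].
Qed.

Lemma smoothM f g : smooth f -> smooth g -> smooth (fun x => f x * g x).
Proof. by move=> hf hg n; exact: SmM. Qed.

Lemma smoothB f g : smooth f -> smooth g -> smooth (fun x => f x - g x).
Proof.
move=> hf hg n; have := SmD (hf n) (SmM (Sm_cst n (-1)) (hg n)).
rewrite (_ : _ \+ _ = (fun x => f x - g x)) //.
by apply/funext => x /=; rewrite mulN1r.
Qed.

Lemma smoothZ c f : smooth f -> smooth (fun x => c * f x).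
Proof. by move=> hf; apply: smoothM => // n; exact: Sm_cst. Qed.

Lemma smooth_AC f : smooth f -> isAC f (derive1 f).
Proof.
move=> h; apply: AC_C1; last exact/smooth_continuous/smooth_derive.
by move=> x; apply: DeriveDef; [exact: smooth_derivable|rewrite derive1E].
Qed.

Section Flat.
Variable e : R.
Hypothesis e0 : 0 < e.

(** The functions p(1/x) exp (- e / x), extended by 0: a family that contains
    the classical flat function, for p = 1, and is stable under
    differentiation. Letting e tend to 0 makes it approach the indicator of
    the positive half-line. *)
Definition flat (p : {poly R}) (x : R) : R :=
  if 0 < x then p.[x^-1] * expR (- e * x^-1) else 0.

(** Take n-th powers in 1 + z <= exp z at z = e y / n. *)
Lemma exp_beats_monomial n (y : R) : 0 <= y -> y ^+ n * expR (- e * y) <= (n%:R / e) ^+ n.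
Proof.
move=> y0; case: n => [|n].
  by rewrite !expr0 mul1r -expR0 ler_expR mulNr oppr_le0 mulr_ge0 // ltW.
have h : (e * y / n.+1%:R) ^+ n.+1 <= expR (e * y).
  have -> : expR (e * y) = expR (e * y / n.+1%:R) ^+ n.+1.
    by rewrite -expRM_natl [n.+1%:R * _]mulrC divfK // pnatr_eq0.
  have p0 : 0 <= e * y / n.+1%:R by rewrite divr_ge0 // mulr_ge0 // ltW.
  rewrite lerXn2r ?nnegrE ?expR_ge0 //.
  by apply: le_trans (expR_ge1Dx _); rewrite lerDr.
rewrite mulNr expRN ler_pdivrMr ?expR_gt0 //.
have -> : y ^+ n.+1 = (n.+1%:R / e) ^+ n.+1 * (e * y / n.+1%:R) ^+ n.+1.
  rewrite -exprMn; congr (_ ^+ _); have : n.+1%:R != 0 :> R by rewrite pnatr_eq0.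
  by move: (n.+1%:R : R) => a a0; field; rewrite a0 gt_eqF.
by rewrite ler_wpM2l // exprn_ge0 // divr_ge0 ?ltW.
Qed.

Lemma poly_exp_bounded (p : {poly R}) : exists C, forall y, 0 <= y ->
  `|p.[y] * expR (- e * y)| <= C.
Proof.
exists (\sum_(i < size p) `|p`_i| * (i%:R / e) ^+ i) => y y0.
rewrite horner_coef mulr_suml; apply: le_trans (ler_norm_sum _ _ _) _.
apply: ler_sum => i _; rewrite -mulrA normrM ler_wpM2l //.
rewrite ger0_norm; first exact: exp_beats_monomial.
by rewrite mulr_ge0 ?exprn_ge0 ?expR_ge0.
Qed.

(** Quadratic smallness at 0 gives differentiability there, with derivative 0.
    *)
Lemma flat_bound (p : {poly R}) : exists C, forall x, `|flat p x| <= C * x ^+ 2.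
Proof.
have [C hC] := poly_exp_bounded ('X^2 * p); exists C => x; rewrite /flat.
have C0 : 0 <= C by apply: le_trans (hC 0 _).
case: ltP => [x0|_]; last by rewrite normr0 mulr_ge0 ?sqr_ge0.
have x2 : 0 < x ^+ 2 by rewrite exprn_gt0.
have := hC x^-1; rewrite invr_ge0 ltW // => /(_ isT).
rewrite hornerM hornerXn -mulrA normrM normrX normfV (gtr0_norm x0) => h.
by rewrite -ler_pdivrMr // mulrC -exprVn.
Qed.

(** Differentiating p(1/x) exp (- e / x) multiplies by 1/x^2 and replaces p by
    e p - p'. *)
Definition flatd (p : {poly R}) : {poly R} := 'X^2 * (e *: p - p^`()).

Lemma is_derive_flat_pos (p : {poly R}) (x : R) : 0 < x ->
  is_derive x (1 : R) (flat p) (flat (flatd p) x).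
Proof.
move=> x0.
have near0 : {near x, (fun y => p.[y^-1] * expR (- e * y^-1)) =1 flat p}.
  near=> y; rewrite /flat /=.
  by have -> : 0 < y by near: y; exact: lt_nbhsr.
apply: near_eq_is_derive near0 _.
have h1 : is_derive x (1 : R) (fun y : R => y^-1) (- x ^- 2).
  have := @is_deriveV R id x 1 1 (lt0r_neq0 x0) (is_derive_id _ _).
  by rewrite /GRing.scale /= mulr1.
have h2 := is_derive1_comp (is_derive_poly p x^-1) h1.
have h3 : is_derive x (1 : R) (fun y : R => - e * y^-1) (- e * - x ^- 2).
  exact: (is_deriveZ (- e) h1).
have h4 := @is_derive1_comp _ _ (fun y : R => - e * y^-1) x _ _ (is_derive_expR (- e * x^-1)) h3.
have h5 : is_derive x (1 : R) (fun y => p.[y^-1] * expR (- e * y^-1)) _ := is_deriveM h2 h4.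
apply: (is_derive_eq h5).
rewrite /flat x0 /flatd hornerM hornerXn hornerD hornerN hornerZ /GRing.scale /= exprVn.
ring.
Unshelve. all: by end_near.
Qed.

Lemma is_derive_flat_neg (p : {poly R}) (x : R) : x < 0 ->
  is_derive x (1 : R) (flat p) (flat (flatd p) x).
Proof.
move=> x0; have near0 : {near x, cst 0 =1 flat p}.
  near=> y; rewrite /flat /= ltNge.
  by have -> : y <= 0 by apply: ltW; near: y; exact: lt_nbhsl.
apply: near_eq_is_derive near0 _.
by rewrite /flat ltNge ltW //=; exact: is_derive_cst.
Unshelve. all: by end_near.
Qed.

Lemma is_derive_flat0 (p : {poly R}) : is_derive (0 : R) (1 : R) (flat p) (flat (flatd p) 0).
Proof.
have -> : flat (flatd p) 0 = 0 by rewrite /flat ltxx.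
have [C hC] := flat_bound p.
have c : h^-1 *: ((flat p \o shift 0) (h *: (1 : R)) - flat p 0) @[h --> (0 : R)^'] --> (0 : R).
  apply/cvgr0Pnorm_lt => eps eps0; near=> h.
  have h0 : h != 0 by near: h; exact: nbhs_dnbhs_neq.
  rewrite /= addr0 /GRing.scale /= mulr1 [flat p 0]/flat ltxx subr0.
  rewrite normrM normfV mulrC ltr_pdivrMr ?normr_gt0 //.
  apply: le_lt_trans (hC h) _; rewrite -real_normK ?num_real // expr2 mulrA.
  rewrite ltr_pM2r ?normr_gt0 //.
  have C1 : 0 < `|C| + 1 by rewrite ltr_pwDr.
  have hs : `|h| < eps / (`|C| + 1).
    near: h; apply: dnbhs0_lt; exact: divr_gt0.
  rewrite ltr_pdivlMr // in hs; apply: le_lt_trans hs.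
  rewrite mulrC ler_wpM2l //; have := ler_norm C; lra.
apply: DeriveDef; first by apply/cvg_ex; exists 0.
exact: cvg_lim.
Unshelve. all: by end_near.
Qed.

Lemma is_derive_flat (p : {poly R}) (x : R) : is_derive x (1 : R) (flat p) (flat (flatd p) x).
Proof.
case: (ltgtP x 0) => [x0|x0|->].
- exact: is_derive_flat_neg.
- exact: is_derive_flat_pos.
- exact: is_derive_flat0.
Qed.

Lemma smooth_flat (p : {poly R}) : smooth (flat p).
Proof.
move=> n; elim: n p => // n IH p; split.
  by move=> x; case: (is_derive_flat p x).
have -> : derive1 (flat p) = flat (flatd p).
  by apply/funext => x; rewrite derive1E; case: (is_derive_flat p x).
exact: IH.
Qed.

End Flat.
End Smooth.

(** * Test functions *)

Section TestFunctions.
Variable R : realType.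
Local Notation mu := (@lebesgue_measure R).
Implicit Types f g k l psi : R -> R.

Definition vanishes (N : R) f := forall t, N < `|t| -> f t = 0.
(** [test_function] with the support condition in the form in which it is
    used. *)
Definition tf psi := smooth psi /\ exists N, vanishes N psi.

Lemma tfP psi : test_function psi <-> tf psi.
Proof.
split=> [[/smoothP sm cp]|[sm [N hN]]].
  split=> //; have [M [_ hM]] := compact_bounded cp.
  exists (`|M| + 1) => t ht; apply: contrapT => nz.
  have : `|t| <= `|M| + 1.
    apply: (hM _ _ t); first by have := ler_norm M; lra.
    by apply: subset_closure; exact/eqP.
  by rewrite leNgt ht.
split; first exact/smoothP.
have sub : closure [set x | psi x != 0] `<=` `[- N, N]%classic.
  have cl : closed (`[- N, N]%classic : set R) by exact: itv_closed.
  rewrite [X in _ `<=` X]((closure_id _).1 cl).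
  apply: closureS => x /= nz; rewrite in_itv /= -ler_norml leNgt; apply/negP => h.
  by move: nz; rewrite hN // eqxx.
apply: (subclosed_compact _ (@segment_compact _ (- N) N) sub).
exact: closed_closure.
Qed.

Lemma vanishes_derive N psi : smooth psi -> vanishes N psi -> vanishes N (derive1 psi).
Proof.
move=> sm hN t Nt; rewrite derive1E.
have h : is_derive t (1 : R) psi 0.
  apply: (near_eq_is_derive _ (is_derive_cst (0 : R) t (1 : R))).
  have : \forall y \near t, N < `|y|.
    have /cvgrPdist_lt /(_ (`|t| - N)) := @norm_continuous _ R t.
    rewrite subr_gt0 => /(_ Nt); apply: filterS => y /(le_lt_trans (ler_norm _)); lra.
  by apply: filterS => y hy; rewrite hN.
by case: h.
Qed.

Lemma tf_derive psi : tf psi -> tf (derive1 psi).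
Proof.
move=> [sm [N hN]]; split; first exact: smooth_derive.
by exists N; exact: vanishes_derive.
Qed.

Lemma tf_cont psi : tf psi -> continuous psi.
Proof. by move=> [sm _]; exact: smooth_continuous. Qed.

Lemma tfB f g : tf f -> tf g -> tf (fun x => f x - g x).
Proof.
move=> [sf [M hM]] [sg [N hN]]; split; first exact: smoothB.
exists (Num.max M N) => t; rewrite gt_max => /andP[h1 h2].
by rewrite hM // hN // subrr.
Qed.

Lemma tfZ c f : tf f -> tf (fun x => c * f x).
Proof.
move=> [sf [M hM]]; split; first exact: smoothZ.
by exists M => t h; rewrite hM // mulr0.
Qed.

Lemma vanishes_win N f : vanishes N f -> forall t, f t = win (- (`|N| + 1)) (`|N| + 1) t * f t.
Proof.
move=> hN t; have [h|h] := leP `|t| N; last by rewrite hN // mulr0.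
rewrite win_le; last by have := normr_ge0 N; lra.
move: h; rewrite ler_norml => /andP[h1 h2]; have := ler_norm N; have := ler_norm (- N).
rewrite normrN => h3 h4.
have h5 : - (`|N| + 1) < t by lra.
have h6 : t <= `|N| + 1 by lra.
by rewrite indicE mem_setE in_itv /= h5 h6 mul1r.
Qed.

Lemma tf_Int psi k : tf psi -> Lloc k -> Int (fun t => psi t * k t).
Proof.
move=> tp lk; have [sm [N hN]] := tp; have cp := tf_cont tp.
have [_ h] := LlocM (meas_cont cp) (locbd_cont cp) lk.
apply: Int_ext (h (- (`|N| + 1)) (`|N| + 1)) => t.
by rewrite [in RHS](vanishes_win hN) mulrA.
Qed.

(** Integration by parts: psi f vanishes outside a bounded interval. *)
Lemma tf_AC psi f k : tf psi -> isAC f k ->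
  I (fun t => derive1 psi t * f t) = - I (fun t => psi t * k t).
Proof.
move=> tp fk; have [sm [N hN]] := tp.
have h := AC_mul (smooth_AC sm) fk.
have i1 : Int (fun t => derive1 psi t * f t) := tf_Int (tf_derive tp) (AC_Lloc fk).
have i2 : Int (fun t => psi t * k t) := tf_Int tp fk.1.
apply/eqP; rewrite -addr_eq0 -I_D //; apply/eqP.
have v : vanishes N (fun t => derive1 psi t * f t + psi t * k t).
  by move=> t ht; rewrite hN // (vanishes_derive sm hN) // !mul0r addr0.
rewrite (I_ext (vanishes_win v)) -(AC_E _ _ h).
have N1 : N < `|N| + 1 by have := ler_norm N; lra.
have N2 : 0 <= `|N| + 1 by rewrite addr_ge0.
by rewrite !hN ?normrN ?(ger0_norm N2) // !mul0r subrr.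
Qed.

(** A test function supported in [a, b], at most 1, which converges to the
    indicator of ]a, b[ when e tends to 0. *)
Definition bump (a b e x : R) : R := flat e 1 (x - a) * flat e 1 (b - x).

Lemma flat1E (e x : R) : flat e 1 x = if 0 < x then expR (- e * x^-1) else 0.
Proof. by rewrite /flat hornerC mul1r. Qed.

Lemma flat1_ge0 (e x : R) : 0 <= flat e 1 x.
Proof. by rewrite flat1E; case: ifP => // _; exact: expR_ge0. Qed.

Lemma flat1_le1 (e x : R) : 0 <= e -> flat e 1 x <= 1.
Proof.
move=> e0; rewrite flat1E; case: ifPn => // x0.
by rewrite -[leRHS]expR0 ler_expR mulNr oppr_le0 mulr_ge0 // invr_ge0 ltW.
Qed.

Lemma tf_bump a b e : 0 < e -> tf (bump a b e).
Proof.
move=> e0; split.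
  apply: smoothM => n.
    have := Sm_affine 1 (- a) (smooth_flat e0 1 n).
    by rewrite (_ : (fun x => _) = (fun x => flat e 1 (x - a))) //; apply/funext => x; rewrite mul1r.
  have := Sm_affine (-1) b (smooth_flat e0 1 n).
  rewrite (_ : (fun x => _) = (fun x => flat e 1 (b - x))) //; apply/funext => x.
  by rewrite mulN1r addrC.
exists (`|a| + `|b|) => t; rewrite /bump !flat1E => h.
case: ifPn => h1; rewrite ?mul0r //; case: ifPn => h2; rewrite ?mulr0 //.
move: h; rewrite ltNge => /negP[]; rewrite ler_norml.
have := ler_norm b; have := ler_norm (- a); rewrite normrN.
have := normr_ge0 a; have := normr_ge0 b => *; apply/andP; split; lra.
Qed.

Lemma bump_cvg a b t : bump a b (n.+1%:R^-1) t @[n --> \oo] --> (\1_(`]a, b[%classic) t : R).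
Proof.
have hexp (y : R) : expR (- n.+1%:R^-1 * y) @[n --> \oo] --> (1 : R).
  rewrite -[X in _ --> X]expR0; apply: continuous_cvg; first exact: continuous_expR.
  have h : - n.+1%:R^-1 * y @[n --> \oo] --> - 0 * y.
    by apply: cvgM; [apply: cvgN; exact: cvg_harmonic|exact: cvg_cst].
  by rewrite oppr0 mul0r in h; exact: h.
rewrite indicE mem_setE in_itv /= /bump.
under eq_fun do rewrite !flat1E !subr_gt0.
case: (ltP a t) => at_ /=; last by under eq_fun do rewrite mul0r; exact: cvg_cst.
case: (ltP t b) => tb /=; last by under eq_fun do rewrite mulr0; exact: cvg_cst.
by have h := cvgM (hexp (t - a)^-1) (hexp (b - t)^-1); rewrite mulr1 in h; exact: h.
Qed.

Lemma bump_bound a b e t : 0 <= e -> a <= b -> `|bump a b e t| <= win a b t.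
Proof.
move=> e0 ab; rewrite win_le // indicE mem_setE in_itv /=.
rewrite ger0_norm; last by rewrite mulr_ge0 ?flat1_ge0.
case: (ltP a t) => at_; last first.
  by rewrite /bump flat1E ifF ?mul0r //; apply/negbTE; rewrite -leNgt subr_le0.
case: (leP t b) => tb /=; last first.
  by rewrite /bump [X in _ * X]flat1E ifF ?mulr0 //; apply/negbTE; rewrite -leNgt subr_le0 ltW.
by rewrite /bump mulr_ile1 ?flat1_ge0 ?flat1_le1.
Qed.

(** The fundamental lemma of the calculus of variations: bumps converge
    boundedly to indicators of intervals, so that all integrals of k over
    intervals vanish. *)
Lemma tf_zero_ae k : Lloc k -> (forall psi, tf psi -> I (fun t => psi t * k t) = 0) ->
  aeeqr k (fun=> 0).
Proof.
move=> lk h; apply: win_zero_ae => // a b.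
wlog ab : a b / a <= b.
  move=> H; have [/H //|ba] := leP a b.
  rewrite (@I_ext _ _ (fun t => - (win b a t * k t))); last by move=> t; rewrite (win_swap a b) mulNr.
  by rewrite I_N ?H ?oppr0 ?ltW //; exact: lk.2.
have e (n : nat) : 0 < n.+1%:R^-1 :> R by rewrite invr_gt0.
have c : I (fun t => bump a b (n.+1%:R^-1) t * k t) @[n --> \oo] -->
    I (fun t => \1_(`]a, b[%classic) t * k t).
  apply: (@DCT _ (fun n t => bump a b (n.+1%:R^-1) t * k t) _ (fun t => `|win a b t * k t|)).
  - by move=> n; exact: Int_meas (tf_Int (tf_bump a b (e n)) lk).
  - by apply: measM; [exact: measurable_indic|case: lk].
  - exact/IntA/(lk.2 a b).
  - by move=> t; apply: cvgM; [exact: bump_cvg|exact: cvg_cst].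
  - move=> n t; rewrite normrM [leRHS]normrM ler_wpM2r //; apply: (@le_trans _ _ (win a b t)).
      by apply: bump_bound => //; exact: ltW.
    exact: ler_norm.
have c0 : I (fun t => bump a b (n.+1%:R^-1) t * k t) @[n --> \oo] --> (0 : R).
  have -> : (fun n : nat => I (fun t => bump a b (n.+1%:R^-1) t * k t)) = (fun=> 0).
    by apply/funext => n; rewrite h //; exact: tf_bump.
  exact: cvg_cst.
rewrite -(cvg_unique _ c c0) //.
apply: I_ae; first exact: Int_meas (lk.2 a b).
  by apply: measM; [exact: measurable_indic|case: lk].
exists [set b]; split; [by []|exact: lebesgue_measure_set1|].
move=> t /= ht; apply: contrapT => tb; apply: ht => _; congr (_ * _).
rewrite win_le // !indicE !mem_setE !in_itv /=; congr (_%:R); congr (_ && _).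
by rewrite lt_neqAle; case: eqP.
Qed.

End TestFunctions.

Local Open Scope complex_scope.

(** * Weak derivatives *)

Section DuBoisReymond.
Variable R : realType.
Local Notation mu := (@lebesgue_measure R).
Implicit Types f g k l psi : R -> R.

Lemma tf_integrable psi : tf psi -> Int psi.
Proof. by move=> h; apply: Int_ext (tf_Int h (@Lloc1 R)) => t; rewrite mulr1. Qed.

(** The primitive is 0 to the left of the support, and also to its right
    because the total integral vanishes. *)
Lemma tf_antiderivative (th : R -> R) : tf th -> I th = 0 -> exists2 psi, tf psi & derive1 psi = th.
Proof.
move=> tth th0; have [sm [N hN]] := tth; have ith := tf_integrable tth.
pose psi x := I (fun t => step x t * th t).
have psiE : psi = (fun x => \int[mu]_(t in [set` Interval -oo%O (BRight x)]) th t).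
  apply/funext => x; rewrite Rintegral_mkcond; apply: eq_Rintegral => t _.
  rewrite patchE /step mem_setE in_itv /=.
  by case: (t <= x); rewrite ?mul1r ?mul0r.
have d x : is_derive x (1 : R) psi (th x).
  have i1 : mu.-integrable [set` Interval -oo%O (BRight (x + 1))] (EFin \o th).
    by apply: integrableS ith.
  have xx : x < x + 1 by rewrite ltrDl.
  have [|h1 h2] := continuous_FTC1 xx i1 (ltNyr x) (f := th).
    exact: tf_cont.
  by rewrite psiE; apply: DeriveDef; [exact: h1|rewrite -derive1E; exact: h2].
have dE : derive1 psi = th by apply/funext => x; rewrite derive1E; case: (d x).
exists psi => //; split.
  case=> // n; split; first by move=> x; case: (d x).
  by rewrite dE; exact: sm.
exists (`|N|) => t Nt.
have out u : N < `|u| -> th u = 0 by exact: hN.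
have [t0|t0] := leP 0 t.
  rewrite -th0; apply: I_ext => u; rewrite /step; case: (leP u t) => ut; rewrite ?mul1r //.
  rewrite mul0r out //; have := ler_norm u; have := ler_norm N.
  by rewrite (ger0_norm t0) in Nt; lra.
rewrite /psi (@I_ext _ _ (fun=> 0)) ?I_0 // => u; rewrite /step.
case: (leP u t) => ut; rewrite ?mul0r // mul1r out //.
have := ler_norm (- u); have := ler_norm N; rewrite normrN.
by rewrite (ltr0_norm t0) in Nt; lra.
Qed.

Lemma exists_unit_bump : exists2 eta : R -> R, tf eta & I eta = 1.
Proof.
have tb := @tf_bump R 0 1 1 ltr01; have ib := tf_integrable tb.
have b0 (t : R) : 0 <= bump 0 1 1 t by rewrite mulr_ge0 ?flat1_ge0.
have Inz : I (bump (0 : R) 1 1) != 0.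
  apply/eqP => h; have h1 := I_eq0_ae ib b0 h.
  have h2 := AC_ae_eq (smooth_AC tb.1) (@AC_cst R 0) h1.
  have /eqP := congr1 (fun f : R -> R => f (1 / 2)) h2; apply/negP.
  rewrite /bump !flat1E !ifT; [|lra|lra].
  by rewrite mulf_neq0 // gt_eqF ?expR_gt0.
exists (fun x => (I (bump 0 1 1))^-1 * bump 0 1 1 x); first exact: tfZ.
by rewrite I_Z // mulVf.
Qed.

(** Correcting a test function th by a multiple of a fixed one, eta, of
    integral 1 makes its integral 0, hence makes it a derivative; thus f -
    \int eta f is orthogonal to every th. *)
Lemma weakly_constant f : Lloc f -> (forall psi, tf psi -> I (fun t => derive1 psi t * f t) = 0) ->
  exists c, aeeqr f (fun=> c).
Proof.
move=> lf h; have [eta te eta1] := exists_unit_bump.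
have ie := tf_integrable te; have ief := tf_Int te lf.
exists (I (fun t => eta t * f t)); set c := I _.
have lc : Lloc (fun t => f t - c).
  apply: LlocD => //; rewrite (_ : (fun=> - c) = (fun t => (- c) * 1)); last by apply/funext => t; rewrite mulr1.
  apply: LlocM; [exact: measc| |exact: Lloc1].
  by move=> N; exists `|- c|.
have : aeeqr (fun t => f t - c) (fun=> 0).
  apply: tf_zero_ae => // th tth; have ith := tf_integrable tth.
  have tt : tf (fun t => th t - I th * eta t) by apply: tfB => //; exact: tfZ.
  have [|psi tp dp] := tf_antiderivative tt.
    by rewrite I_B ?I_Z ?eta1 ?mulr1 ?subrr //; exact: IntZ.
  have := h psi tp; rewrite dp.
  rewrite (@I_ext _ _ (fun t => th t * f t - I th * (eta t * f t))); last by move=> t; ring.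
  rewrite I_B ?I_Z //; [|exact: tf_Int|exact: IntZ]; rewrite -/c => h1.
  rewrite (@I_ext _ _ (fun t => th t * f t - c * th t)); last by move=> t; ring.
  rewrite I_B ?I_Z //; [|exact: tf_Int|exact: IntZ].
  by rewrite [c * _]mulrC.
by apply: ae_map1 => t ht _; apply/eqP; rewrite -subr_eq0 ht.
Qed.

Definition wd f k := [/\ Lloc f, Lloc k & forall psi, tf psi ->
  I (fun t => derive1 psi t * f t) = - I (fun t => psi t * k t)].

Lemma tf_I_ae psi f g : tf psi -> Lloc f -> Lloc g -> aeeqr f g ->
  I (fun t => psi t * f t) = I (fun t => psi t * g t).
Proof.
move=> tp lf lg fg; apply: I_ae; try by apply: Int_meas; exact: tf_Int.
by apply: ae_map1 fg => t h1 t1; rewrite h1.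
Qed.

Lemma AC_wd f f0 k : Lloc f -> aeeqr f f0 -> isAC f0 k -> wd f k.
Proof.
move=> lf ff0 fk; split=> //; first by case: fk.
move=> psi tp; rewrite -(tf_AC tp fk).
by apply: tf_I_ae ff0 => //; [exact: tf_derive|exact: AC_Lloc fk].
Qed.

(** The lemma of du Bois-Reymond: f minus a primitive of k has weak derivative
    0, hence is constant. *)
Lemma wd_AC f k : wd f k -> exists2 f0, isAC f0 k & aeeqr f f0.
Proof.
move=> [lf lk h]; pose F x := I (fun t => win 0 x t * k t).
have Fk : isAC F k := AC_prim lk; have lF := AC_Lloc Fk.
have lN : Lloc (fun t => - F t) := AC_Lloc (AC_N Fk).
have [||c hc] := @weakly_constant (fun t => f t - F t).
- exact: LlocD.
- move=> psi tp; have td := tf_derive tp.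
  rewrite (@I_ext _ _ (fun t => derive1 psi t * f t - derive1 psi t * F t)); last by move=> t; ring.
  by rewrite I_B; [|exact: tf_Int..]; rewrite h // (tf_AC tp Fk) subrr.
exists (fun x => F x + c).
  by apply: AC_eq (AC_add Fk (AC_cst c)) _ _ => t //; rewrite addr0.
by apply: ae_map1 hc => t ht t1; rewrite -ht //; ring.
Qed.

Lemma tf_ae_uniq k l : Lloc k -> Lloc l ->
  (forall psi, tf psi -> I (fun t => psi t * k t) = I (fun t => psi t * l t)) -> aeeqr k l.
Proof.
move=> lk ll h.
have lkl : Lloc (fun t => k t - l t) := (AC_B (AC_prim lk) (AC_prim ll)).1.
have : aeeqr (fun t => k t - l t) (fun=> 0).
  apply: tf_zero_ae => // psi tp.
  rewrite (@I_ext _ _ (fun t => psi t * k t - psi t * l t)); last by move=> t; ring.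
  by rewrite I_B ?h ?subrr //; exact: tf_Int.
by apply: ae_map1 => t ht _; apply/eqP; rewrite -subr_eq0 ht.
Qed.

Lemma AC_deriv_uniq f g k l : isAC f k -> isAC g l -> aeeqr f g -> aeeqr k l.
Proof.
move=> fk gl fg; apply: tf_ae_uniq; [by case: fk|by case: gl|].
move=> psi tp; apply: oppr_inj; rewrite -(tf_AC tp fk) -(tf_AC tp gl).
apply: tf_I_ae fg; [exact: tf_derive|exact: AC_Lloc fk|exact: AC_Lloc gl].
Qed.

End DuBoisReymond.

Section ComplexWeak.
Variable R : realType.
Local Notation C := R[i].
Local Notation mu := (@lebesgue_measure R).
Implicit Types (f g : R -> C) (a b : R -> R).

Definition cx a b : R -> C := fun x => a x +i* b x.

Lemma ReF_cx a b : ReF (cx a b) = a. Proof. by []. Qed.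
Lemma ImF_cx a b : ImF (cx a b) = b. Proof. by []. Qed.

Lemma L1locP f : L1loc f <-> Lloc (ReF f) /\ Lloc (ImF f).
Proof. by rewrite /L1loc !Lloc_locally_integrable. Qed.

Lemma CintM (s : R -> R) f :
  Cint (fun x => (s x)%:C * f x) = I (fun x => s x * ReF f x) +i* I (fun x => s x * ImF f x).
Proof.
rewrite /Cint -!/(I _); congr (_ +i* _); apply: I_ext => x; rewrite /ReF /ImF.
  by case: (f x) => u v /=; rewrite mul0r subr0.
by case: (f x) => u v /=; rewrite mul0r addr0.
Qed.

Lemma is_wderiv1P f g : is_wderiv 1 f g <-> wd (ReF f) (ReF g) /\ wd (ImF f) (ImF g).
Proof.
split=> [[/L1locP[lf1 lf2] /L1locP[lg1 lg2] h]|[[lf1 lg1 h1] [lf2 lg2 h2]]].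
  split; split=> // psi tp; have := h psi ((tfP psi).2 tp);
    by rewrite !CintM expr1 mulN1r => -[].
split; [exact/L1locP|exact/L1locP|] => psi /tfP tp.
by rewrite !CintM expr1 mulN1r /= h1 // h2.
Qed.

Lemma is_wderiv2P f g : is_wderiv 2 f g <->
  [/\ L1loc f, L1loc g & forall psi, tf psi ->
   I (fun t => derive1 (derive1 psi) t * ReF f t) = I (fun t => psi t * ReF g t) /\
   I (fun t => derive1 (derive1 psi) t * ImF f t) = I (fun t => psi t * ImF g t)].
Proof.
split=> -[lf lg h]; split=> // psi tp.
  have := h psi ((tfP psi).2 tp).
  by rewrite !CintM expr2 mulN1r opprK mul1r => -[].
move/tfP: tp => tp; have [h1 h2] := h psi tp.
by rewrite !CintM expr2 mulN1r opprK mul1r; congr (_ +i* _).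
Qed.

Definition aeeqc f g : Prop := f = g %[ae mu].

Lemma aeeqcP f g : aeeqc f g <-> aeeqr (ReF f) (ReF g) /\ aeeqr (ImF f) (ImF g).
Proof.
split=> [h|[h1 h2]].
  by split; apply: ae_map1 h => x hx t; rewrite /ReF /ImF hx.
apply: ae_map2 h1 h2 => x h1 h2 t.
by move: (h1 t) (h2 t); rewrite /ReF /ImF; case: (f x) (g x) => [u v] [w z] /= -> ->.
Qed.

Lemma wderivP n f : weakly_derivable n f -> is_wderiv n f (wderiv n f).
Proof. by move=> h; exact: (xgetPex (fun=> 0) h). Qed.

Lemma is_wderiv_uniq n f g h : is_wderiv n f g -> is_wderiv n f h -> aeeqc g h.
Proof.
move=> [_ /L1locP[lg1 lg2] hg] [_ /L1locP[lh1 lh2] hh].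
have key psi : tf psi -> Cint (fun x => (psi x)%:C * g x) = Cint (fun x => (psi x)%:C * h x).
  move=> /tfP tp; have := hg psi tp; rewrite hh //.
  by move=> /(congr1 (fun z => (-1) ^+ n * z)); rewrite !mulrA -expr2 sqrr_sign !mul1r.
apply/aeeqcP; split; apply: tf_ae_uniq => // psi tp; have := key psi tp;
  by rewrite !CintM => -[].
Qed.

Lemma wderiv_ae n f g : is_wderiv n f g -> aeeqc (wderiv n f) g.
Proof. by move=> h; apply: (@is_wderiv_uniq n f) => //; apply: wderivP; exists g. Qed.

Definition AC2 (p p1 p2 : R -> R) := isAC p p1 /\ isAC p1 p2.

(** Weak derivatives of order 2 of the defining identity are turned into
    iterated ones: testing with psi' shows that the second weak derivative of
    f is the weak derivative of the first. *)
Lemma weak2_AC f : weakly_derivable 1 f -> weakly_derivable 2 f ->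
  exists p p1 q q1, [/\ AC2 p p1 (ReF (wderiv 2 f)), AC2 q q1 (ImF (wderiv 2 f)),
    aeeqc f (cx p q) & aeeqc (wderiv 1 f) (cx p1 q1)].
Proof.
move=> /wderivP/is_wderiv1P [w1 w2] /wderivP/is_wderiv2P [_ /L1locP[l1 l2] h].
have wd1 : wd (ReF (wderiv 1 f)) (ReF (wderiv 2 f)).
  case: w1 => lf lk hw; split=> // psi tp.
  have [<- _] := h psi tp.
  by rewrite (hw _ (tf_derive tp)) opprK.
have wd2 : wd (ImF (wderiv 1 f)) (ImF (wderiv 2 f)).
  case: w2 => lf lk hw; split=> // psi tp.
  have [_ <-] := h psi tp.
  by rewrite (hw _ (tf_derive tp)) opprK.
have [p1 hp1 ep1] := wd_AC wd1; have [q1 hq1 eq1] := wd_AC wd2.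
have [p hp ep] := wd_AC w1; have [q hq eq] := wd_AC w2.
exists p, p1, q, q1; split.
- by split=> //; apply: AC_ae hp (AC_meas hp1) ep1.
- by split=> //; apply: AC_ae hq (AC_meas hq1) eq1.
- by apply/aeeqcP.
- by apply/aeeqcP.
Qed.

Lemma AC2_is_wderiv p p1 p2 q q1 q2 : AC2 p p1 p2 -> AC2 q q1 q2 ->
  is_wderiv 1 (cx p q) (cx p1 q1) /\ is_wderiv 2 (cx p q) (cx p2 q2).
Proof.
move=> [hp hp1] [hq hq1]; split.
  by apply/is_wderiv1P; split; [exact: AC_wd (AC_Lloc hp) (ae_refl _) hp|exact: AC_wd (AC_Lloc hq) (ae_refl _) hq].
apply/is_wderiv2P; split.
- by apply/L1locP; split; [exact: AC_Lloc hp|exact: AC_Lloc hq].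
- by apply/L1locP; split; [case: hp1|case: hq1].
move=> psi tp; have td := tf_derive tp.
by rewrite (tf_AC td hp) (tf_AC tp hp1) (tf_AC td hq) (tf_AC tp hq1) !opprK.
Qed.

End ComplexWeak.

Local Close Scope complex_scope.

(** * The weights 1 + x^2 and sech^2 *)

Section Weights.
Variable R : realType.
Local Notation mu := (@lebesgue_measure R).
Implicit Types f g h k : R -> R.

(** Monotone convergence along the windows ]-n, n], whose integrals are
    increments of F. *)
Lemma Int_bounded_primitive F k M : isAC F k -> (forall x, 0 <= k x) ->
  (forall x, `|F x| <= M) -> Int k.
Proof.
move=> Fk k0 FM; have mk := AC_measd Fk.
pose g n x := (win (- n%:R) n%:R x * k x)%:E : \bar R.
have nn (n : nat) : - (n%:R : R) <= n%:R by have := ler0n R n; lra.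
have g0 n x : 0 <= win (- n%:R) n%:R x * k x by rewrite mulr_ge0 // win_le // indicE ler0n.
have lim x : win (- n%:R) n%:R x * k x @[n --> \oo] --> k x.
  have h : (step n%:R x - step (- n%:R) x) * k x @[n --> \oo] --> (1 - 0) * k x.
    apply: cvgM; last exact: cvg_cst.
    by apply: cvgB; [exact: step_cvg1|exact: step_cvg0].
  by rewrite subr0 mul1r in h; exact: h.
have mono : forall x, [set: R] x -> nondecreasing_seq (g^~ x).
  move=> x _ m n mn; rewrite lee_fin ler_wpM2r //.
  rewrite !win_le // !indicE !mem_setE !in_itv /=.
  have : (m%:R : R) <= n%:R by rewrite ler_nat.
  move=> mnR; case: (ltP (- m%:R) x) => h1 /=; rewrite ?ler0n //.
  case: (leP x m%:R) => h2 /=; rewrite ?ler0n //.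
  have -> : - n%:R < x by lra.
  by have -> : x <= n%:R by lra.
have mg n : measurable_fun setT (g n).
  by apply/measurable_EFinP; exact: Int_meas (AC_Int _ _ Fk).
have := cvg_monotone_convergence (mu := mu) measurableT mg (fun n x _ => g0 n x) mono.
have -> : (fun x => limn (g^~ x)) = EFin \o k.
  apply/funext => x; apply/cvg_lim => //.
  by apply: cvg_EFin; [exact: nearW|exact: lim].
move=> c; apply/integrableP; split; first exact/measurable_EFinP.
have -> : (fun x => `|(EFin \o k) x|%E) = EFin \o k.
  by apply/funext => x /=; rewrite ger0_norm.
apply: (@le_lt_trans _ _ (2 * M)%:E); last exact: ltry.
apply: (cvge_to_le c); apply: nearW => n /=.
rewrite /g (IE (AC_Int _ _ Fk)) -(AC_E _ _ Fk) lee_fin.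
have := FM n%:R; have := FM (- n%:R); rewrite !ler_norml => /andP[? ?] /andP[? ?]; lra.
Qed.

(** A weight that grows slowly enough to be absorbed by sech and by the kernel
    exp (- 2 |x - y|), but whose inverse is integrable and square-integrable.
    *)
Definition w (x : R) : R := 1 + x ^+ 2.

Lemma w_ge1 x : 1 <= w x. Proof. by rewrite /w lerDl sqr_ge0. Qed.
Lemma w_gt0 x : 0 < w x. Proof. exact: lt_le_trans ltr01 (w_ge1 x). Qed.

Lemma wV_ge0 x : 0 <= (w x)^-1. Proof. by rewrite invr_ge0 ltW // w_gt0. Qed.
Lemma wV_le1 x : (w x)^-1 <= 1. Proof. by rewrite invf_le1 ?w_gt0 // w_ge1. Qed.

Lemma cont_w : continuous w. Proof. exact: continuous_oneDsqr. Qed.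
Lemma cont_wV : continuous (fun x => (w x)^-1). Proof. exact: continuous_oneDsqrV. Qed.

Lemma Int_wV : Int (fun x => (w x)^-1).
Proof.
apply: (@Int_bounded_primitive (@atan R) _ (pi / 2)).
- by apply: AC_C1; exact: cont_wV.
- by move=> x; rewrite invr_ge0 ltW // w_gt0.
- by move=> x; rewrite ler_norml !ltW // ?atan_gtNpi2 ?atan_ltpi2.
Qed.

Lemma Sq_wV : Sq (fun x => (w x)^-1).
Proof.
split; first by apply: meas_cont; exact: cont_wV.
apply: (Int_le _ Int_wV); first by apply: measX; apply: meas_cont; exact: cont_wV.
by move=> x; rewrite ger0_norm ?sqr_ge0 // expr2 ler_piMr ?wV_ge0 ?wV_le1.
Qed.

Lemma LfunSq f : f \in Lfun mu 2%:E <-> Sq f.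
Proof.
split=> [hf|[mf hf]].
  split; last exact: Lfun2_integrable_sqr.
  by move: hf; rewrite inE => /andP[]; rewrite inE.
rewrite inE; apply/andP; split; first by rewrite inE.
rewrite inE /= /finite_norm unlock; apply: poweR_lty.
have /integrableP[_] := hf; congr (_ < _)%E; apply: eq_integral => x _ /=.
by rewrite ger0_norm ?sqr_ge0 // powR_mulrn // real_normK ?num_real.
Qed.

End Weights.

Section Hyperbolic.
Variable R : realType.
Implicit Types x y : R.

Definition sech2 x : R := 1 - phi x ^+ 2.

Lemma cosh_gt0 x : 0 < cosh x.
Proof. by rewrite /cosh divr_gt0 // addr_gt0 ?expR_gt0. Qed.

Lemma expRxN x : expR x * expR (- x) = 1.
Proof. by rewrite -expRD subrr expR0. Qed.

Lemma sech2_cosh x : cosh x ^+ 2 * sech2 x = 1.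
Proof.
rewrite /cosh /sech2 /phi /tanh; have := expRxN x.
have : 0 < expR x + expR (- x) by rewrite addr_gt0 ?expR_gt0.
move: (expR x) (expR (- x)) => a b ab0 ab.
have -> : ((a + b) / 2) ^+ 2 * (1 - ((a - b) / (a + b)) ^+ 2) = a * b.
  by field; rewrite gt_eqF.
exact: ab.
Qed.

Lemma sech2E x : sech2 x = (cosh x ^+ 2)^-1.
Proof.
have c := cosh_gt0 x.
by rewrite -[LHS](mulKf (lt0r_neq0 (exprn_gt0 2 c))) sech2_cosh mulr1.
Qed.

Lemma sech2_gt0 x : 0 < sech2 x.
Proof. by rewrite sech2E invr_gt0 exprn_gt0 ?cosh_gt0. Qed.

Lemma phi2E x : phi x ^+ 2 = 1 - sech2 x. Proof. by rewrite /sech2; ring. Qed.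

Lemma phi_le1 x : `|phi x| <= 1.
Proof.
rewrite -[leRHS](@normr1 R) -ler_sqr ?nnegrE // !real_normK ?num_real // expr1n phi2E.
by have := sech2_gt0 x; lra.
Qed.

Lemma sech2_le1 x : sech2 x <= 1.
Proof. by rewrite /sech2; have := sqr_ge0 (phi x); lra. Qed.

Lemma is_derive_phi x : is_derive x (1 : R) (@phi R) (sech2 x).
Proof.
have h0 : expR x + expR (- x) != 0 by rewrite gt_eqF // addr_gt0 ?expR_gt0.
have hN : is_derive x (1 : R) (fun y : R => expR (- y)) (- expR (- x)).
  have h1 : is_derive x (1 : R) (fun y : R => - y) (-1) by apply: is_derive_eq.
  have := @is_derive1_comp _ expR (fun y : R => - y) x _ _ (is_derive_expR (- x)) h1.
  by rewrite mulrN1.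
have hD : is_derive x (1 : R) (fun y => expR y + expR (- y)) _ := is_deriveD (is_derive_expR x) hN.
have hB : is_derive x (1 : R) (fun y => expR y - expR (- y)) _ := is_deriveB (is_derive_expR x) hN.
have h2 := @is_deriveV R (fun y => expR y + expR (- y)) x _ _ h0 hD.
have h3 : is_derive x (1 : R) (@phi R) _ := is_deriveM hB h2.
apply: (is_derive_eq h3).
rewrite /sech2 /phi /tanh /GRing.scale /=; move: h0.
by move: (expR x) (expR (- x)) => a b ab0; field.
Qed.

Lemma cont_phi : continuous (@phi R).
Proof.
move=> x; apply: differentiable_continuous; apply/derivable1_diffP.
by case: (is_derive_phi x).
Qed.

Lemma cont_sech2 : continuous sech2.
Proof.
move=> x; apply: cvgB; first exact: cvg_cst.
by apply: cvgM; exact: cont_phi.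
Qed.

Lemma AC_phi : isAC (@phi R) sech2.
Proof. by apply: AC_C1; [exact: is_derive_phi|exact: cont_sech2]. Qed.

Lemma Int_sech2 : Int sech2.
Proof. exact: (Int_bounded_primitive AC_phi (fun x => ltW (sech2_gt0 x)) phi_le1). Qed.

(** The fourth power of 1 + y / 4 <= exp (y / 4), at y = |x|; half of exp |x|
    is at most cosh x, whence 512 = 2 * 256. *)
Lemma cosh_lower x : w x ^+ 2 <= 512 * cosh x.
Proof.
have key y : 0 <= y -> w y ^+ 2 <= 256 * expR y.
  move=> y0; have h := expR_ge1Dx (y / 4).
  have e : expR y = expR (y / 4) ^+ 4.
    by rewrite -expRM_natl; congr expR; field.
  rewrite e; set z := expR _ in h *.
  have h2 : w y <= 16 * z ^+ 2.
    have h3 : (1 + y / 4) ^+ 2 <= z ^+ 2 by rewrite lerXn2r ?nnegrE ?expR_ge0 //; lra.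
    have y2 := sqr_ge0 y; rewrite /w; apply: le_trans (_ : 16 * (1 + y / 4) ^+ 2 <= _); last by lra.
    have -> : 16 * (1 + y / 4) ^+ 2 = 16 + 8 * y + y ^+ 2 by field.
    lra.
  have -> : 256 * z ^+ 4 = (16 * z ^+ 2) ^+ 2 by ring.
  have w0 := ltW (w_gt0 y).
  by rewrite lerXn2r ?nnegrE // (le_trans w0 h2).
rewrite /cosh; have [x0|x0] := leP 0 x.
  have := key _ x0; have := expR_gt0 (- x); lra.
have Nx : 0 <= - x by lra.
have e : w (- x) = w x by rewrite /w sqrrN.
by have := key _ Nx; rewrite e; have := expR_gt0 x; lra.
Qed.

Lemma sech2_decay x : w x ^+ 4 * sech2 x <= 512 ^+ 2.
Proof.
have -> : w x ^+ 4 * sech2 x = (w x ^+ 2) ^+ 2 * sech2 x by ring.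
rewrite sech2E ler_pdivrMr ?exprn_gt0 ?cosh_gt0 // -exprMn.
have c0 := ltW (cosh_gt0 x).
have h1 : w x ^+ 2 \is Num.nneg by rewrite nnegrE sqr_ge0.
have h2 : 512 * cosh x \is Num.nneg by rewrite nnegrE; apply: mulr_ge0 c0; exact: ler0n.
exact: (lerXn2r 2 h1 h2 (cosh_lower x)).
Qed.

Definition sech x : R := Num.sqrt (sech2 x).

Lemma sech_sq x : sech x ^+ 2 = sech2 x.
Proof. by rewrite sqr_sqrtr // ltW // sech2_gt0. Qed.

Lemma sech_gt0 x : 0 < sech x. Proof. by rewrite sqrtr_gt0 sech2_gt0. Qed.

Lemma sech_le1 x : sech x <= 1.
Proof. by rewrite -[leRHS]sqrtr1 ler_sqrt ?sech2_le1. Qed.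

Lemma cont_sech : continuous sech.
Proof. by move=> x; apply: continuous_comp; [exact: cont_sech2|exact: sqrt_continuous]. Qed.

Lemma Sq_wsech : Sq (fun x => w x * sech x).
Proof.
have m : meas (fun x => w x * sech x).
  by apply: measM; apply: meas_cont; [exact: cont_w|exact: cont_sech].
split=> //; apply: (Int_le _ (IntZ (512 ^+ 2) (Int_wV R))); first exact: measX.
move=> x; rewrite ger0_norm ?sqr_ge0 // exprMn sech_sq ler_pdivlMr ?w_gt0 //.
apply: le_trans (sech2_decay x).
have -> : w x ^+ 2 * sech2 x * w x = w x ^+ 3 * sech2 x by ring.
have -> : w x ^+ 4 * sech2 x = w x * (w x ^+ 3 * sech2 x) by ring.
have w0 := ltW (w_gt0 x); have s0 := ltW (sech2_gt0 x).
by rewrite ler_peMl ?w_ge1 // mulr_ge0 ?exprn_ge0.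
Qed.

End Hyperbolic.

(** * The inverse of cosh^2 L_+ + 6 *)

Section WeightedSpace.
Variable R : realType.
Implicit Types f g h k : R -> R.
Local Notation w := (@w R).
Local Notation sech := (@sech R).
Local Notation sech2 := (@sech2 R).

(** The real-valued elements of the space H. *)
Definition HR g := meas g /\ Sq (fun x => sech x * g x).
Definition nrm2 g : R := I (fun x => sech2 x * g x ^+ 2).
(** This seminorm is what the integral operators see of g; it is controlled by
    the norm of H ([wmass_le]), because w sech is square-integrable. *)
Definition wmass g : R := I (fun x => w x * sech2 x * `|g x|).
Lemma meas_sech : meas sech. Proof. by apply: meas_cont; exact: cont_sech. Qed.
Lemma meas_sech2 : meas sech2. Proof. by apply: meas_cont; exact: cont_sech2. Qed.

Lemma nrm2E g : nrm2 g = I (fun x => (sech x * g x) ^+ 2).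
Proof. by apply: I_ext => x; rewrite exprMn sech_sq. Qed.

Lemma HR_Int2 g : HR g -> Int (fun x => sech2 x * g x ^+ 2).
Proof. by move=> [_ [_ h]]; apply: Int_ext h => x; rewrite exprMn sech_sq. Qed.

Lemma HRD f g : HR f -> HR g -> HR (fun x => f x + g x).
Proof.
move=> [mf sf] [mg sg]; split; first exact: measD.
have := SqD sf sg; rewrite (_ : (fun x => _) = (fun x => sech x * (f x + g x))) //.
by apply/funext => x; ring.
Qed.

Lemma HRZ c g : HR g -> HR (fun x => c * g x).
Proof.
move=> [mg sg]; split; first by apply: measM => //; exact: measc.
have := SqZ c sg; rewrite (_ : (fun x => _) = (fun x => sech x * (c * g x))) //.
by apply/funext => x; ring.
Qed.

Lemma HR_bounded g M : meas g -> (forall x, `|g x| <= M) -> HR g.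
Proof.
move=> mg h; split=> //.
have ss : Sq sech.
  split; first exact: meas_sech.
  by apply: Int_ext (Int_sech2 R) => x; rewrite sech_sq.
have := Sq_bd mg ss h; rewrite (_ : (fun x => _) = (fun x => sech x * g x)) //.
by apply/funext => x; rewrite mulrC.
Qed.

Lemma Sq_HR g : Sq g -> HR g.
Proof.
move=> sg; split; first by case: sg.
apply: (Sq_bd (M := 1)) => //; first exact: meas_sech.
by move=> x; rewrite ger0_norm ?sech_le1 // ltW // sech_gt0.
Qed.

Lemma HR_ae f g : HR f -> meas g -> aeeqr f g -> HR g.
Proof.
move=> [mf sf] mg fg; split=> //; apply: (Sq_ae sf); first by apply: measM => //; exact: meas_sech.
exact: (ae_comp1 (fun x y => sech x * y) fg).
Qed.

Lemma HR_Sq_abs g : HR g -> Sq (fun x => sech x * `|g x|).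
Proof.
move=> [mg [m i]]; split; first by apply: measM; [exact: meas_sech|exact: measA].
by apply: Int_ext i => x; rewrite !exprMn real_normK ?num_real.
Qed.

Lemma HR_Int_w g : HR g -> Int (fun x => w x * sech2 x * `|g x|).
Proof.
move=> hg; apply: Int_ext (SqM (Sq_wsech R) (HR_Sq_abs hg)) => x.
by rewrite -sech_sq; ring.
Qed.

Lemma HR_Int g : HR g -> Int (fun x => sech2 x * g x).
Proof.
move=> hg; apply: (Int_le _ (HR_Int_w hg)).
  by apply: measM; [exact: meas_sech2|case: hg].
move=> x; rewrite normrM (ger0_norm (ltW (sech2_gt0 x))) -mulrA ler_peMl ?w_ge1 //.
by rewrite mulr_ge0 // ltW // sech2_gt0.
Qed.

Lemma HR_IntM f g : HR f -> HR g -> Int (fun x => sech2 x * (f x * g x)).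
Proof.
move=> [_ sf] [_ sg]; apply: Int_ext (SqM sf sg) => x; rewrite -sech_sq; ring.
Qed.

Definition wmass_const : R := I (fun x => (w x * sech x) ^+ 2).

Lemma wmass_le g : HR g -> wmass g ^+ 2 <= wmass_const * nrm2 g.
Proof.
move=> hg; have := CS (Sq_wsech R) (HR_Sq_abs hg).
rewrite (@I_ext _ _ (fun x => w x * sech2 x * `|g x|)); last by move=> x; rewrite -sech_sq; ring.
rewrite [X in _ <= _ * X](@I_ext _ _ (fun x => sech2 x * g x ^+ 2)) //.
by move=> x; rewrite exprMn sech_sq real_normK ?num_real.
Qed.

Lemma wmass_ge0 g : 0 <= wmass g.
Proof.
apply: I_ge0 => x; have w0 := ltW (w_gt0 x); have s0 := ltW (sech2_gt0 x).
by rewrite !mulr_ge0.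
Qed.

Lemma I_dominated f g : Int g -> meas f -> (forall x, `|f x| <= g x) -> Int f /\ `|I f| <= I g.
Proof.
move=> ig mf h; have if_ : Int f by exact: Int_le h.
by split=> //; apply: le_trans (I_abs if_) _; apply: I_le => //; exact: IntA.
Qed.

End WeightedSpace.

Section PlusResolvent.
Variable R : realType.
Implicit Types (f g h k : R -> R) (x y : R).
Local Notation w := (@w R).
Local Notation sech := (@sech R).
Local Notation sech2 := (@sech2 R).

(** Peetre's inequality w (y + z) <= 2 w y w z, together with 1 + z^2 <= (1 +
    |z|)^2 <= exp (2 |z|). *)
Lemma w_shift x y : w x <= 2 * w y * expR (2 * `|x - y|).
Proof.
have h : w (`|x - y|) <= expR (2 * `|x - y|).
  have p := normr_ge0 (x - y); rewrite expRM_natl.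
  apply: le_trans (_ : (1 + `|x - y|) ^+ 2 <= _).
    rewrite /w; have -> : (1 + `|x - y|) ^+ 2 = 1 + `|x - y| ^+ 2 + 2 * `|x - y| by ring.
    lra.
  have h1 := expR_ge1Dx `|x - y|.
  by rewrite lerXn2r ?nnegrE ?expR_ge0 // addr_ge0.
apply: le_trans (_ : 2 * w y * w `|x - y| <= _); last first.
  by rewrite ler_wpM2l // mulr_ge0 // ltW // w_gt0.
rewrite /w real_normK ?num_real //.
have -> : x = y + (x - y) by ring.
move: (x - y) => z; have -> : y + z - y = z by ring.
have := sqr_ge0 (y - z); have := sqr_ge0 y; have := sqr_ge0 z.
have := sqr_ge0 (y * z); rewrite exprMn => *; lra.
Qed.

Lemma kernel_left x y : step x y * (expR (- 2 * x) * expR (2 * y)) <= 2 * w y / w x.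
Proof.
rewrite ler_pdivlMr ?w_gt0 // /step; case: (leP y x) => yx; last first.
  by rewrite mul0r mul0r mulr_ge0 // ltW // w_gt0.
rewrite mul1r -expRD.
have := w_shift x y; rewrite ger0_norm ?subr_ge0 // => h.
have e : expR (- 2 * x + 2 * y) * expR (2 * (x - y)) = 1.
  by rewrite -expRD (_ : _ + _ = 0) ?expR0 //; ring.
have p := expR_gt0 (- 2 * x + 2 * y).
have : expR (- 2 * x + 2 * y) * w x <= expR (- 2 * x + 2 * y) * (2 * w y * expR (2 * (x - y))).
  by rewrite ler_pM2l.
by rewrite mulrCA e mulr1.
Qed.

Lemma kernel_right x y : (1 - step x y) * (expR (2 * x) * expR (- 2 * y)) <= 2 * w y / w x.
Proof.
rewrite ler_pdivlMr ?w_gt0 // /step; case: (leP y x) => yx.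
  by rewrite subrr mul0r mul0r mulr_ge0 // ltW // w_gt0.
rewrite subr0 mul1r -expRD.
have := w_shift x y; rewrite ltr0_norm ?subr_lt0 // => h.
have e : expR (2 * x + - 2 * y) * expR (2 * - (x - y)) = 1.
  by rewrite -expRD (_ : _ + _ = 0) ?expR0 //; ring.
have p := expR_gt0 (2 * x + - 2 * y).
have : expR (2 * x + - 2 * y) * w x <= expR (2 * x + - 2 * y) * (2 * w y * expR (2 * - (x - y))).
  by rewrite ler_pM2l.
by rewrite mulrCA e mulr1.
Qed.

(** The two halves of the convolution of sech^2 g with exp (- 2 |x|), the part
    of y <= x and that of y > x. *)
Definition Gl g x : R := expR (- 2 * x) * I (fun y => step x y * (expR (2 * y) * (sech2 y * g y))).
Definition Gr g x : R := expR (2 * x) * I (fun y => (1 - step x y) * (expR (- 2 * y) * (sech2 y * g y))).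

Lemma cont_exp (c : R) : continuous (fun x : R => expR (c * x)).
Proof.
move=> x; apply: continuous_comp; last exact: continuous_expR.
by apply: cvgM; [exact: cvg_cst|exact: cvg_id].
Qed.

Lemma is_derive_exp (c x : R) : is_derive x (1 : R) (fun y : R => expR (c * y)) (c * expR (c * x)).
Proof.
have h1 : is_derive x (1 : R) (fun y : R => c * y) c.
  by apply: is_derive_eq; rewrite /GRing.scale /= mulr1.
have := @is_derive1_comp _ expR (fun y : R => c * y) x _ _ (is_derive_expR (c * x)) h1.
by rewrite mulrC.
Qed.

Lemma AC_exp (c : R) : isAC (fun x => expR (c * x)) (fun x => c * expR (c * x)).
Proof.
apply: AC_C1; first exact: is_derive_exp.
by move=> x; apply: cvgM; [exact: cvg_cst|exact: cont_exp].
Qed.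

Section Fixed.
Variable g : R -> R.
Hypothesis hg : HR g.
Let mg : meas g. Proof. by case: hg. Qed.
Let msg : meas (fun y => sech2 y * g y).
Proof. by apply: measM => //; exact: meas_sech2. Qed.
Let N := wmass g.
Let iN := HR_Int_w hg.

Let mexp (c : R) : meas (fun y => expR (c * y)). Proof. by apply: meas_cont; exact: cont_exp. Qed.

Lemma Gl_dom x : let f := fun y => expR (- 2 * x) * (step x y * (expR (2 * y) * (sech2 y * g y))) in
  Int f /\ `|I f| <= 2 / w x * N.
Proof.
move=> f; rewrite -I_Z //; apply: I_dominated.
- exact: IntZ.
- apply: measM; first exact: measc.
  by apply: measM; [exact: meas_step|exact: measM].
move=> y; rewrite /f.
have -> : expR (-2 * x) * (step x y * (expR (2 * y) * (sech2 y * g y))) =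
  (step x y * (expR (-2 * x) * expR (2 * y))) * (sech2 y * g y) by ring.
have s0 := ltW (sech2_gt0 y).
rewrite normrM ger0_norm; last by rewrite !mulr_ge0 ?expR_ge0 ?step_ge0.
rewrite normrM (ger0_norm s0).
have -> : 2 / w x * (w y * sech2 y * `|g y|) = (2 * w y / w x) * (sech2 y * `|g y|) by ring.
by rewrite ler_wpM2r ?kernel_left // mulr_ge0.
Qed.

Lemma Gr_dom x : let f := fun y => expR (2 * x) * ((1 - step x y) * (expR (- 2 * y) * (sech2 y * g y))) in
  Int f /\ `|I f| <= 2 / w x * N.
Proof.
move=> f; rewrite -I_Z //; apply: I_dominated.
- exact: IntZ.
- apply: measM; first exact: measc.
  by apply: measM; [apply: measB; [exact: measc|exact: meas_step]|exact: measM].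
move=> y; rewrite /f.
have -> : expR (2 * x) * ((1 - step x y) * (expR (- 2 * y) * (sech2 y * g y))) =
  ((1 - step x y) * (expR (2 * x) * expR (- 2 * y))) * (sech2 y * g y) by ring.
have s0 := ltW (sech2_gt0 y); have s1 := step_le1 x y.
rewrite normrM ger0_norm; last by rewrite !mulr_ge0 ?expR_ge0 ?subr_ge0.
rewrite normrM (ger0_norm s0).
have -> : 2 / w x * (w y * sech2 y * `|g y|) = (2 * w y / w x) * (sech2 y * `|g y|) by ring.
by rewrite ler_wpM2r ?kernel_right // mulr_ge0.
Qed.

Lemma Gl_Int x : Int (fun y => step x y * (expR (2 * y) * (sech2 y * g y))).
Proof.
have [h _] := Gl_dom x; apply: Int_ext (IntZ (expR (2 * x)) h) => y.
rewrite mulrA -expRD (_ : _ + _ = 0) ?expR0 ?mul1r //; ring.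
Qed.

Lemma Gr_Int x : Int (fun y => (1 - step x y) * (expR (- 2 * y) * (sech2 y * g y))).
Proof.
have [h _] := Gr_dom x; apply: Int_ext (IntZ (expR (- 2 * x)) h) => y.
rewrite mulrA -expRD (_ : _ + _ = 0) ?expR0 ?mul1r //; ring.
Qed.

Lemma Gl_bound x : `|Gl g x| <= 2 / w x * N.
Proof. by have [_] := Gl_dom x; rewrite I_Z //; exact: Gl_Int. Qed.

Lemma Gr_bound x : `|Gr g x| <= 2 / w x * N.
Proof. by have [_] := Gr_dom x; rewrite I_Z //; exact: Gr_Int. Qed.

Let lsg : Lloc (fun y => sech2 y * g y). Proof. exact/Int_Lloc/HR_Int. Qed.

Lemma Gl_AC : isAC (Gl g) (fun x => sech2 x * g x - 2 * Gl g x).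
Proof.
have h : isAC (fun x => I (fun y => step x y * (expR (2 * y) * (sech2 y * g y))))
    (fun y => expR (2 * y) * (sech2 y * g y)).
  split; first by apply: LlocM => //; apply: locbd_cont; exact: cont_exp.
  move=> a b; rewrite -I_B; [|exact: Gl_Int..].
  by apply: I_ext => t; rewrite /win; ring.
apply: AC_eq (AC_mul (AC_exp (- 2)) h) _ _ => [//|x]; rewrite /Gl.
rewrite [X in _ + X]mulrA -expRD (_ : _ + 2 * x = 0) ?expR0 ?mul1r; ring.
Qed.

Lemma Gr_AC : isAC (Gr g) (fun x => 2 * Gr g x - sech2 x * g x).
Proof.
have h : isAC (fun x => I (fun y => (1 - step x y) * (expR (- 2 * y) * (sech2 y * g y))))
    (fun y => - (expR (- 2 * y) * (sech2 y * g y))).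
  have l : Lloc (fun y => expR (- 2 * y) * (sech2 y * g y)).
    by apply: LlocM => //; apply: locbd_cont; exact: cont_exp.
  split; first exact: (AC_N (AC_prim l)).1.
  move=> a b; rewrite -I_B; [|exact: Gr_Int..].
  by apply: I_ext => t; rewrite /win; ring.
apply: AC_eq (AC_mul (AC_exp 2) h) _ _ => [//|x]; rewrite /Gr.
rewrite mulrN [X in _ - X]mulrA -expRD (_ : 2 * x + _ = 0) ?expR0 ?mul1r; ring.
Qed.

(** Convolution with the Green function exp (- 2 |x|) / 4 of - d^2 + 4,
    applied to sech^2 g. As L_+ = - d^2 + 4 - 6 sech^2, it solves (cosh^2 L_+
    + 6) p = g. *)
Definition Rp x : R := 4^-1 * (Gl g x + Gr g x).
Definition Rp1 x : R := 2^-1 * (Gr g x - Gl g x).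

Lemma Rp_AC2 : AC2 Rp Rp1 (fun x => 4 * Rp x - sech2 x * g x).
Proof.
split.
  apply: AC_eq (AC_Z 4^-1 (AC_add Gl_AC Gr_AC)) _ _ => // x; by rewrite /Rp1; field.
apply: AC_eq (AC_Z 2^-1 (AC_B Gr_AC Gl_AC)) _ _ => // x; by rewrite /Rp; field.
Qed.

Lemma Rp_bound x : `|Rp x| <= N / w x.
Proof.
rewrite /Rp normrM ger0_norm ?invr_ge0 //.
have := Gl_bound x; have := Gr_bound x; have := ler_normD (Gl g x) (Gr g x).
rewrite (_ : 2 / w x * N = 2 * (N / w x)); last by ring.
lra.
Qed.

Lemma Rp1_bound x : `|Rp1 x| <= 2 * (N / w x).
Proof.
rewrite /Rp1 normrM ger0_norm ?invr_ge0 //.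
have := Gl_bound x; have := Gr_bound x; have := ler_normB (Gr g x) (Gl g x).
rewrite (_ : 2 / w x * N = 2 * (N / w x)); last by ring.
lra.
Qed.

Lemma Rp_Sq : Sq Rp /\ Sq Rp1.
Proof.
have [h1 h2] := Rp_AC2; split.
  by apply: (Sq_le (AC_meas h1) (SqZ N (Sq_wV R))) => x; exact: Rp_bound.
apply: (Sq_le (AC_meas h2) (SqZ (2 * N) (Sq_wV R))) => x; rewrite -mulrA; exact: Rp1_bound.
Qed.

End Fixed.

Lemma Rp_linear a f g : HR f -> HR g ->
  Rp (fun x => a * f x + g x) = (fun x => a * Rp f x + Rp g x).
Proof.
move=> hf hg; apply/funext => x; rewrite /Rp /Gl /Gr.
rewrite (@I_ext _ (fun y => step x y * _) (fun y => a * (step x y * (expR (2 * y) * (sech2 y * f y)))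
  + step x y * (expR (2 * y) * (sech2 y * g y)))); last by move=> y; ring.
rewrite (@I_ext _ (fun y => (1 - step x y) * _) (fun y => a * ((1 - step x y) * (expR (- 2 * y) * (sech2 y * f y)))
  + (1 - step x y) * (expR (- 2 * y) * (sech2 y * g y)))); last by move=> y; ring.
have i1 := Gl_Int hf x; have i2 := Gl_Int hg x; have i3 := Gr_Int hf x; have i4 := Gr_Int hg x.
rewrite !I_D ?I_Z //; try exact: IntZ.
ring.
Qed.

(** The difference z of two solutions satisfies z'' = 4 z, and the integral of
    (z z')' = z'^2 + 4 z^2 vanishes. *)
Lemma Rp_unique p p1 p2 g : HR g -> AC2 p p1 p2 -> Sq p -> Sq p1 ->
  aeeqr p2 (fun x => 4 * p x - sech2 x * g x) -> p = Rp g.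
Proof.
move=> hg [hp hp1] sp sp1 e; have [hr hr1] := Rp_AC2 hg; have [sr sr1] := Rp_Sq hg.
pose z x := p x - Rp g x; pose z1 x := p1 x - Rp1 g x.
have hz : isAC z z1 := AC_B hp hr.
have hz1 : isAC z1 (fun x => 4 * z x).
  apply: AC_ae (AC_B hp1 hr1) _ _.
    by apply: measM; [exact: measc|exact: AC_meas hz].
  by apply: ae_map1 e => x h t; rewrite h // /z; ring.
have sz : Sq z by exact: SqB.
have sz1 : Sq z1 by exact: SqB.
have h := AC_mul hz hz1.
have [M hM] := AC_Sq_bounded hz sz sz1.
have ih : Int (fun t => z1 t * z1 t + z t * (4 * z t)).
  apply: IntD; first exact: SqM.
  by apply: Int_ext (IntZ 4 (SqM sz sz)) => t; ring.
have I0 := AC_total h ih (Sq_bd (AC_meas hz) sz1 hM).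
have nn t : 0 <= z1 t * z1 t + z t * (4 * z t).
  by have := sqr_ge0 (z1 t); have := sqr_ge0 (z t); rewrite !expr2; lra.
have ae0 := I_eq0_ae ih nn I0.
apply: (AC_ae_eq hp hr); apply: ae_map1 ae0 => t ht _; apply/eqP; rewrite -subr_eq0.
have := ht Logic.I; rewrite -/(z t) -sqrf_eq0 => h0; apply/eqP.
by have := sqr_ge0 (z1 t); have := sqr_ge0 (z t); rewrite !expr2; lra.
Qed.

End PlusResolvent.

(** * An inverse related to cosh^2 L_- *)

Section MinusResolvent.
Variable R : realType.
Implicit Types (f g h k v : R -> R) (x y : R).
Local Notation w := (@w R).
Local Notation sech := (@sech R).
Local Notation sech2 := (@sech2 R).

Definition smass : R := I sech2.
(** Integration against sech^2. Being in the domain of L_- only constrains v',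
    so that this functional is needed to see the constants. *)
Definition smean g : R := I (fun x => sech2 x * g x).
(** The mean of g is removed because - v'' = sech^2 h with v' square-
    integrable forces the integral of sech^2 h to vanish. *)
Definition centred g x : R := sech2 x * (g x - smean g / smass).

(** The function v = Rm g solves - v'' = sech^2 (g - smean v). Its derivative
    is [Rm1]; the additive constant is fixed by smean v = smean g / smass, the
    value which integrating the equation imposes. *)
Definition Rm1 g x : R := - I (fun t => step x t * centred g t).
Definition Rm0 g x : R := I (fun t => win 0 x t * Rm1 g t).
Definition Rm g x : R := Rm0 g x + (smean g / smass - smean (Rm0 g)) / smass.

Lemma smass_gt0 : 0 < smass.
Proof.
have i := Int_sech2 R; have h := AC_phi R.
have : (@phi R) 1 - phi 0 <= smass.
  rewrite (AC_E 0 1 h); apply: I_le => //; first exact: AC_Int h.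
  move=> t; rewrite ler_piMl ?(ltW (sech2_gt0 _)) //.
  exact: le_trans (ler_norm _) (win_norm _ _ _).
have -> : phi 0 = 0 :> R by rewrite /phi /tanh oppr0 subrr mul0r.
apply: lt_le_trans; rewrite subr0 /phi /tanh.
apply: divr_gt0; last by rewrite addr_gt0 ?expR_gt0.
by rewrite subr_gt0 ltr_expR; lra.
Qed.

Section Fixed.
Variable g : R -> R.
Hypothesis hg : HR g.

Let s0 x : 0 <= sech2 x. Proof. exact: ltW (sech2_gt0 x). Qed.
Let w0 x : 0 <= w x. Proof. exact: ltW (w_gt0 x). Qed.

Let hc : HR (fun x => g x - smean g / smass).
Proof. by apply: HRD => //; exact: (HR_bounded (measc _) (fun=> lexx _)). Qed.

Definition Nc : R := wmass (fun x => g x - smean g / smass).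

Let ic : Int (centred g). Proof. exact: HR_Int. Qed.

Lemma I_centred : I (centred g) = 0.
Proof.
rewrite (@I_ext _ _ (fun x => sech2 x * g x - smean g / smass * sech2 x)); last first.
  by move=> x; rewrite /centred; ring.
rewrite I_B ?I_Z; [|exact: Int_sech2|exact: HR_Int|exact/IntZ/Int_sech2].
by rewrite -/smass divfK ?subrr // gt_eqF // smass_gt0.
Qed.

Lemma Rm1_AC : isAC (Rm1 g) (fun x => - centred g x).
Proof.
split; first exact: (AC_N (AC_prim (Int_Lloc ic))).1.
move=> a b; rewrite /Rm1 opprK addrC -I_B; [|exact: Int_step..].
by apply: I_ext => t; rewrite /win; ring.
Qed.

Lemma Rm1_right x : Rm1 g x = I (fun t => (1 - step x t) * centred g t).
Proof.
rewrite (@I_ext _ _ (fun t => centred g t - step x t * centred g t)); last by move=> t; ring.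
by rewrite I_B ?I_centred ?sub0r //; exact: Int_step.
Qed.

(** As the integral of [centred g] vanishes, Rm1 g x is a tail integral on
    either side; on the side away from 0 the weight w is at least w x. *)
Lemma Rm1_bound x : `|Rm1 g x| <= Nc / w x.
Proof.
have iN := HR_Int_w hc; have mc := Int_meas ic.
have abs_c t : `|centred g t| = sech2 t * `|g t - smean g / smass|.
  by rewrite normrM (ger0_norm (s0 t)).
have main (th : R -> R) : meas th -> (forall t, 0 <= th t <= 1) ->
    (forall t, th t != 0 -> w x <= w t) -> `|I (fun t => th t * centred g t)| <= Nc / w x.
  move=> mth h1 h2; rewrite mulrC /Nc /wmass -I_Z //.
  apply: (I_dominated (IntZ _ iN) _ _).2; first exact: measM.
  move=> t; have /andP[t0 t1] := h1 t; rewrite normrM (ger0_norm t0) abs_c.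
  have q : 0 <= sech2 t * `|g t - smean g / smass| by rewrite mulr_ge0.
  rewrite -[w t * _ * _]mulrA mulrA ler_wpM2r // ler_pdivlMl ?w_gt0 // mulrC.
  have [->|/h2 h3] := eqVneq (th t) 0; first by rewrite mul0r.
  by apply: le_trans h3; rewrite ler_piMl.
have [x0|x0] := leP x 0.
  rewrite /Rm1 normrN; apply: main; first exact: meas_step.
    by move=> t; rewrite step_ge0 step_le1.
  move=> t; rewrite /step; case: (leP t x) => tx; rewrite ?eqxx // => _.
  by rewrite /w lerD2l -[x ^+ 2]sqrrN -[t ^+ 2]sqrrN lerXn2r ?nnegrE; lra.
rewrite Rm1_right; apply: main.
- by apply: measB; [exact: measc|exact: meas_step].
- by move=> t; have := step_ge0 x t; have := step_le1 x t => *; apply/andP; split; lra.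
move=> t; rewrite /step; case: (leP t x) => tx; rewrite ?subrr ?eqxx // => _.
by rewrite /w lerD2l lerXn2r ?nnegrE; lra.
Qed.

Lemma Rm1_Int : Int (Rm1 g).
Proof.
apply: (Int_le (AC_meas Rm1_AC) (IntZ Nc (Int_wV R))) => x; exact: Rm1_bound.
Qed.

Lemma Rm1_Sq : Sq (Rm1 g).
Proof.
by apply: (Sq_le (AC_meas Rm1_AC) (SqZ Nc (Sq_wV R))) => x; exact: Rm1_bound.
Qed.

Lemma Rm0_AC : isAC (Rm0 g) (Rm1 g).
Proof. exact/AC_prim/Int_Lloc/Rm1_Int. Qed.

Lemma Rm0_bound x : `|Rm0 g x| <= Nc * I (fun t => (w t)^-1).
Proof.
rewrite -I_Z; last exact: Int_wV.
apply: (I_dominated (IntZ _ (Int_wV R)) _ _).2.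
  by apply: measM; [exact: meas_win|exact: Int_meas Rm1_Int].
move=> t; rewrite normrM; apply: le_trans (Rm1_bound t).
by rewrite ler_piMl ?win_norm.
Qed.

Let h0 : HR (Rm0 g). Proof. exact: HR_bounded (AC_meas Rm0_AC) Rm0_bound. Qed.

Lemma Rm_AC2 : AC2 (Rm g) (Rm1 g) (fun x => - centred g x).
Proof.
split; last exact: Rm1_AC.
by apply: AC_eq (AC_add Rm0_AC (AC_cst _)) _ _ => // x; rewrite addr0.
Qed.

Lemma smean_Rm : smean (Rm g) = smean g / smass.
Proof.
rewrite /smean (@I_ext _ _ (fun x => sech2 x * Rm0 g x
   + (smean g / smass - smean (Rm0 g)) / smass * sech2 x)); last by move=> x; rewrite /Rm; ring.
rewrite I_D ?I_Z; [|exact: Int_sech2|exact: HR_Int|exact/IntZ/Int_sech2].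
rewrite -/(smean _) -/(smean g) -/smass divfK ?gt_eqF ?smass_gt0 //; ring.
Qed.

End Fixed.

Lemma smean_linear a f g : HR f -> HR g ->
  smean (fun x => a * f x + g x) = a * smean f + smean g.
Proof.
move=> hf hg; rewrite /smean (@I_ext _ _ (fun x => a * (sech2 x * f x) + sech2 x * g x)); last by move=> x; ring.
by rewrite I_D ?I_Z //; [exact: HR_Int|exact/IntZ/HR_Int|exact: HR_Int].
Qed.

Lemma Rm1_linear a f g : HR f -> HR g ->
  Rm1 (fun x => a * f x + g x) = (fun x => a * Rm1 f x + Rm1 g x).
Proof.
move=> hf hg; apply/funext => x; rewrite /Rm1.
have c0 (h : R -> R) : HR h -> HR (fun x => h x - smean h / smass).
  by move=> hh; apply: HRD => //; exact: (HR_bounded (measc _) (fun=> lexx _)).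
have i1 : Int (fun t => step x t * centred f t) by apply/Int_step/HR_Int/c0.
have i2 : Int (fun t => step x t * centred g t) by apply/Int_step/HR_Int/c0.
rewrite (@I_ext _ _ (fun t => a * (step x t * centred f t) + step x t * centred g t)).
  by rewrite I_D ?I_Z //; [rewrite opprD mulrN|exact: IntZ].
by move=> t; rewrite /centred smean_linear //; move: (smean f) (smean g) (smass^-1) => *; ring.
Qed.

Lemma Rm_linear a f g : HR f -> HR g ->
  Rm (fun x => a * f x + g x) = (fun x => a * Rm f x + Rm g x).
Proof.
move=> hf hg.
have e0 : Rm0 (fun x => a * f x + g x) = (fun x => a * Rm0 f x + Rm0 g x).
  apply/funext => x; rewrite /Rm0 Rm1_linear //.
  rewrite (@I_ext _ _ (fun t => a * (win 0 x t * Rm1 f t) + win 0 x t * Rm1 g t)); last by move=> t; rewrite mulrDr mulrCA.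
  have i1 := AC_Int 0 x (Rm0_AC hf); have i2 := AC_Int 0 x (Rm0_AC hg).
  by rewrite I_D ?I_Z //; exact: IntZ.
have h0 (h : R -> R) : HR h -> HR (Rm0 h).
  by move=> hh; exact: HR_bounded (AC_meas (Rm0_AC hh)) (Rm0_bound hh).
apply/funext => x; rewrite /Rm e0 !smean_linear //; [|exact: h0|exact: h0].
have alg (A B c d e e' k : R) : a * A + B + ((a * c + d) * k - (a * e + e')) * k =
    a * (A + (c * k - e) * k) + (B + (d * k - e') * k) by ring.
exact: alg.
Qed.

(** Each step of the construction of Rm is bounded by wmass g: the mean, then
    Rm1 after dividing by w, and its primitive because 1/w is integrable. *)
Lemma Rm_bound : exists2 C, 0 <= C & forall g, HR g -> forall x, `|Rm g x| <= C * wmass g.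
Proof.
have sm := smass_gt0; have sV : 0 <= smass^-1 by rewrite invr_ge0 ltW.
have smean_le g : HR g -> `|smean g| <= wmass g.
  move=> hg; apply: (I_dominated (HR_Int_w hg) _ _).2.
    by apply: measM; [exact: meas_sech2|case: hg].
  move=> x; rewrite normrM (ger0_norm (ltW (sech2_gt0 x))) -mulrA ler_peMl ?w_ge1 //.
  by rewrite mulr_ge0 // ltW // sech2_gt0.
have h1 : HR (fun=> 1 : R) by exact: (HR_bounded (measc _) (fun=> lexx _)).
pose c1 := 1 + smass^-1 * wmass (fun=> 1 : R).
have c10 : 0 <= c1 by rewrite addr_ge0 ?mulr_ge0 ?wmass_ge0.
have Nc_le g : HR g -> Nc g <= c1 * wmass g.
  move=> hg; rewrite /Nc; set m := smean g / smass.
  have hm : HR (fun x => g x - m) by apply: HRD => //; exact: (HR_bounded (measc _) (fun=> lexx _)).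
  apply: (@le_trans _ _ (wmass g + `|m| * wmass (fun=> 1 : R))).
    rewrite /wmass -I_Z; last exact: HR_Int_w.
    rewrite -I_D; [|exact: HR_Int_w|exact/IntZ/HR_Int_w].
    apply: I_le; [exact: HR_Int_w|by apply: IntD; [exact: HR_Int_w|exact/IntZ/HR_Int_w]|].
    move=> x; have q : 0 <= w x * sech2 x by rewrite mulr_ge0 // ltW ?w_gt0 ?sech2_gt0.
    rewrite normr1 mulr1 [`|m| * _]mulrC -mulrDr ler_wpM2l //.
    exact: ler_normB.
  rewrite /c1 mulrDl mul1r lerD2l -mulrA [wmass (fun=> 1) * _]mulrC mulrA.
  rewrite ler_wpM2r ?wmass_ge0 // normrM [`|smass^-1|]ger0_norm // mulrC.
  by rewrite ler_wpM2l // smean_le.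
pose c2 := I (fun t : R => (w t)^-1).
have c20 : 0 <= c2 by apply: I_ge0 => x; exact: wV_ge0.
pose c3 := c1 * c2.
have Rm0_le g : HR g -> forall x, `|Rm0 g x| <= c3 * wmass g.
  move=> hg x; apply: le_trans (Rm0_bound hg x) _; rewrite -/c2 /c3.
  by rewrite mulrAC ler_wpM2r // Nc_le.
have c30 : 0 <= c3 by exact: mulr_ge0.
exists (c3 + (smass^-1 + c3 * smass) * smass^-1).
  by rewrite addr_ge0 // mulr_ge0 // addr_ge0 // mulr_ge0 // ltW.
move=> g hg x.
have N0 := wmass_ge0 g.
have hm : `|smean (Rm0 g)| <= c3 * wmass g * smass.
  rewrite -I_Z; last exact: Int_sech2.
  apply: (I_dominated (IntZ _ (Int_sech2 R)) _ _).2.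
    by apply: measM; [exact: meas_sech2|exact: AC_meas (Rm0_AC hg)].
  move=> t; rewrite normrM (ger0_norm (ltW (sech2_gt0 t))) mulrC ler_wpM2r ?Rm0_le //.
  exact: ltW (sech2_gt0 t).
rewrite mulrDl; apply: le_trans (ler_normD _ _) _; apply: lerD; first exact: Rm0_le.
rewrite normrM [`|smass^-1|]ger0_norm // mulrAC ler_wpM2r //.
apply: le_trans (ler_normB _ _) _; rewrite mulrDl; apply: lerD.
  by rewrite normrM [`|smass^-1|]ger0_norm // mulrC ler_wpM2l // smean_le.
by rewrite mulrAC.
Qed.

Lemma Rm_HR g : HR g -> HR (Rm g).
Proof.
move=> hg; have [C C0 hC] := Rm_bound.
exact: HR_bounded (AC_meas (Rm_AC2 hg).1) (hC g hg).
Qed.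

(** Integrating the equation determines smean v; then v' is the integral of
    v'' from minus infinity, and the constant is determined by smean v again.
    *)
Lemma Rm_unique v v1 v2 g : HR g -> HR v -> AC2 v v1 v2 -> Sq v1 ->
  aeeqr v2 (fun x => sech2 x * (smean v - g x)) -> v = Rm g.
Proof.
move=> hg hv [av av1] sv1 e.
have h0 : HR (fun x => smean v - g x).
  apply: HRD; first exact: (HR_bounded (measc _) (fun=> lexx _)).
  by have := HRZ (-1) hg; rewrite (_ : (fun x => _) = (fun x => - g x)) //; apply/funext => x; rewrite mulN1r.
have av1' := AC_ae av1 (Int_meas (HR_Int h0)) e.
have tot := AC_total av1' (HR_Int h0) sv1.
have sm := smass_gt0.
have mE : smean v = smean g / smass.
  have : I (fun x => smean v * sech2 x - sech2 x * g x) = 0.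
    by rewrite -[RHS]tot; apply: I_ext => x; ring.
  rewrite I_B ?I_Z; [|exact: Int_sech2|exact/IntZ/Int_sech2|exact: HR_Int].
  move=> /eqP; rewrite subr_eq0 => /eqP E; have {}E : smean v * smass = smean g := E.
  by rewrite -E mulfK // gt_eqF.
have v1E : v1 = Rm1 g.
  apply/funext => x; rewrite (AC_Sq_left av1' (HR_Int h0) sv1) /Rm1 -I_N.
    by apply: I_ext => t; rewrite /centred mE; ring.
  by apply: Int_step; apply: HR_Int; rewrite -mE; apply: HRD => //; exact: (HR_bounded (measc _) (fun=> lexx _)).
have [ar _] := Rm_AC2 hg; rewrite v1E in av.
have cst x : v x = Rm g x + (v 0 - Rm g 0).
  have := AC_E 0 x av; rewrite -(AC_E 0 x ar); lra.
set c := v 0 - Rm g 0 in cst.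
have c0 : c = 0.
  have : smean v = smean (Rm g) + c * smass.
    rewrite -I_Z; last exact: Int_sech2.
    rewrite /smean -I_D; [|exact/HR_Int/Rm_HR|exact/IntZ/Int_sech2].
    by apply: I_ext => x; rewrite cst; ring.
  rewrite smean_Rm // mE => /eqP; rewrite -subr_eq0 opprD addrA subrr sub0r oppr_eq0 mulf_eq0.
  by rewrite [smass == 0]gt_eqF // orbF => /eqP.
by apply/funext => x; rewrite cst c0 addr0.
Qed.

End MinusResolvent.

(** * Energy identities *)

Section Energy.
Variable R : realType.
Implicit Types (p q g f : R -> R) (x : R).
Local Notation sech := (@sech R).
Local Notation sech2 := (@sech2 R).
Local Notation phi := (@phi R).

Lemma meas_phi : meas phi. Proof. by apply: meas_cont; exact: cont_phi. Qed.

(** p is in the domain and cosh^2 L_+ p = - g. *)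
Definition plus_eq p p1 g :=
  [/\ isAC p p1, isAC p1 (fun x => (6 * phi x ^+ 2 - 2) * p x + sech2 x * g x),
      Sq p, Sq p1 & HR g].
(** q is in the domain and cosh^2 L_- q = g. *)
Definition minus_eq q q1 g :=
  [/\ isAC q q1, isAC q1 (fun x => - (2 * sech2 x * q x) - sech2 x * g x),
      HR q, Sq q1 & HR g].

Lemma potential_le x : `|6 * phi x ^+ 2 - 2| <= 4.
Proof.
rewrite phi2E; have := sech2_gt0 x; have := sech2_le1 x => *.
by rewrite ler_norml; apply/andP; split; lra.
Qed.

Lemma meas_potential : meas (fun x => 6 * phi x ^+ 2 - 2).
Proof.
apply: measB; last exact: measc.
by apply: measM; [exact: measc|apply: measX; exact: meas_phi].
Qed.

Lemma Sq_potential p : Sq p -> Sq (fun x => (6 * phi x ^+ 2 - 2) * p x).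
Proof. by move=> sp; apply: Sq_bd potential_le => //; exact: meas_potential. Qed.

(** The right-hand side is symmetric in p and q: L_+ is symmetric. *)
Lemma green_plus p p1 f q q1 g : plus_eq p p1 f -> plus_eq q q1 g ->
  I (fun x => p x * ((6 * phi x ^+ 2 - 2) * q x)) + I (fun x => sech2 x * (p x * g x)) =
  - I (fun x => p1 x * q1 x).
Proof.
move=> [ap _ sp sp1 _] [_ aq1 sq sq1 hg].
have [M hM] := AC_Sq_bounded ap sp sp1.
have i1 : Int (fun x => p1 x * q1 x) by exact: SqM.
have i2 : Int (fun x => p x * ((6 * phi x ^+ 2 - 2) * q x)).
  by apply: SqM => //; exact: Sq_potential.
have i3 : Int (fun x => sech2 x * (p x * g x)) by apply: HR_IntM => //; exact: Sq_HR.
have h := AC_mul ap aq1.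
have ih : Int (fun t => p1 t * q1 t + p t * ((6 * phi t ^+ 2 - 2) * q t + sech2 t * g t)).
  by apply: Int_ext (IntD i1 (IntD i2 i3)) => t; ring.
have := AC_total h ih (Sq_bd (AC_meas ap) sq1 hM).
rewrite (@I_ext _ _ (fun t => p1 t * q1 t + (p t * ((6 * phi t ^+ 2 - 2) * q t) + sech2 t * (p t * g t)))).
  by rewrite !I_D //; [lra|exact: IntD].
by move=> t; ring.
Qed.

Lemma minus_rhs q q1 g : minus_eq q q1 g -> exists2 h, HR h &
  q = Rm h /\ isAC q1 (fun x => - centred h x).
Proof.
move=> [aq aq1 hq sq1 hg].
pose h x := smean q + (2 * q x + g x).
have hh : HR h.
  apply: HRD; first exact: (HR_bounded (measc _) (fun=> lexx _)).
  by apply: HRD => //; exact: HRZ.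
have e : q = Rm h.
  apply: (@Rm_unique _ q q1 _ h) => //; first by split; [exact: aq|exact: aq1].
  by apply: aeW => x _; rewrite /h; ring.
exists h => //; split=> //.
have [ar ar1] := Rm_AC2 hh; rewrite -e in ar.
have q1E : q1 = Rm1 h.
  by apply: (AC_ae_eq aq1 ar1); exact: (AC_deriv_uniq aq ar (ae_refl _)).
by rewrite q1E.
Qed.

(** The function q need not be square-integrable; its boundedness is what
    makes the boundary terms of Green's formula vanish. *)
Lemma minus_bounded q q1 g : minus_eq q q1 g -> exists M, forall x, `|q x| <= M.
Proof.
move=> /minus_rhs [h hh [-> _]]; have [C C0 hC] := Rm_bound R.
by exists (C * wmass h); exact: hC.
Qed.

Lemma green_minus p p1 f q q1 g : minus_eq p p1 f -> minus_eq q q1 g ->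
  2 * I (fun x => sech2 x * (p x * q x)) + I (fun x => sech2 x * (p x * g x)) =
  I (fun x => p1 x * q1 x).
Proof.
move=> hp hqq; have [M hM] := minus_bounded hp.
case: hp hqq => ap _ hp sp1 _ [_ aq1 hq sq1 hg].
have i1 : Int (fun x => p1 x * q1 x) by exact: SqM.
have i2 : Int (fun x => sech2 x * (p x * q x)) by exact: HR_IntM.
have i3 : Int (fun x => sech2 x * (p x * g x)) by exact: HR_IntM.
have h := AC_mul ap aq1.
have ih : Int (fun t => p1 t * q1 t + p t * (- (2 * sech2 t * q t) - sech2 t * g t)).
  by apply: Int_ext (IntB i1 (IntD (IntZ 2 i2) i3)) => t; ring.
have := AC_total h ih (Sq_bd (AC_meas ap) sq1 hM).
rewrite (@I_ext _ _ (fun t => p1 t * q1 t - (2 * (sech2 t * (p t * q t)) + sech2 t * (p t * g t)))).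
  rewrite I_B ?I_D ?I_Z //; [lra|exact: IntZ|apply: IntD => //; exact: IntZ].
by move=> t; ring.
Qed.

(** The first-order factor D = d + 2 phi of L_+ = D^* D, which kills the
    ground state sech^2 = phi' of L_+. *)
Definition ground p p1 x : R := p1 x + 2 * (phi x * p x).

(** The cross term 4 phi p p' is 2 phi (p^2)', and integrating it by parts
    produces the potential. *)
Lemma ground_energy p p1 f : plus_eq p p1 f ->
  Sq (ground p p1) /\
  I (fun x => ground p p1 x ^+ 2) =
  I (fun x => p1 x * p1 x) + I (fun x => p x * ((6 * phi x ^+ 2 - 2) * p x)).
Proof.
move=> [ap _ sp sp1 _].
have sphi : Sq (fun x => phi x * p x) := Sq_bd meas_phi sp (@phi_le1 R).
have [M hM] := AC_Sq_bounded ap sp sp1.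
have hp2 := AC_mul ap ap; have h := AC_mul (AC_phi R) hp2.
have hR := Sq_HR sp.
have i1 : Int (fun x => sech2 x * (p x * p x)) by exact: HR_IntM.
have i2 : Int (fun x => phi x * p x * p1 x) by exact: SqM.
have i3 : Int (fun x => p1 x * p1 x) by exact: SqM.
have i4 : Int (fun x => p x * ((6 * phi x ^+ 2 - 2) * p x)).
  by apply: SqM => //; exact: Sq_potential.
have ih : Int (fun t => sech2 t * (p t * p t) + phi t * (p1 t * p t + p t * p1 t)).
  by apply: Int_ext (IntD i1 (IntZ 2 i2)) => t; ring.
have sh : Sq (fun t => phi t * (p t * p t)).
  have sp2 : Sq (fun t => p t * p t) := Sq_bd (AC_meas ap) sp hM.
  exact: Sq_bd meas_phi sp2 (@phi_le1 R).
have := AC_total h ih sh.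
rewrite (@I_ext _ _ (fun t => sech2 t * (p t * p t) + 2 * (phi t * p t * p1 t))); last by move=> t; ring.
rewrite I_D ?I_Z //; last exact: IntZ.
move=> e; split; first by apply: SqD => //; exact: SqZ.
have -> : I (fun x => ground p p1 x ^+ 2) = I (fun x => p1 x * p1 x
   + (p x * ((6 * phi x ^+ 2 - 2) * p x) + 2 * (sech2 x * (p x * p x) + 2 * (phi x * p x * p1 x)))).
  by apply: I_ext => x; rewrite /ground /sech2; ring.
have i5 := IntD i1 (IntZ 2 i2).
rewrite I_D ?I_D ?I_Z ?I_D ?I_Z //; try by [exact: IntZ|apply: IntD => //; exact: IntZ].
lra.
Qed.

Lemma ground_zero p p1 f : plus_eq p p1 f -> aeeqr (ground p p1) (fun=> 0) ->
  aeeqr f (fun=> 0).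
Proof.
move=> [ap ap1 sp sp1 hf] h0.
have e1 : aeeqr p1 (fun x => (- 2) * (phi x * p x)).
  by apply: ae_map1 h0 => x h t; have := h t; rewrite /ground; lra.
have h := AC_Z (- 2) (AC_mul (AC_phi R) ap).
have e2 := AC_deriv_uniq ap1 h e1.
apply: ae_map2 e1 e2 => x h1 h2 t.
have := h2 t; rewrite (h1 t) /= => h3.
have : sech2 x * f x = 0.
  move: h3; rewrite /sech2; move: (phi x) (p x) (f x) => u v z h3.
  have : (6 * u ^+ 2 - 2) * v + (1 - u ^+ 2) * z - - (2) * ((1 - u ^+ 2) * v + u * (- (2) * (u * v))) = 0.
    by rewrite h3 subrr.
  by move=> h4; rewrite -[RHS]h4; ring.
by move=> /eqP; rewrite mulf_eq0 gt_eqF ?sech2_gt0 // => /eqP.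
Qed.

Lemma minus_zero q q1 g : minus_eq q q1 g -> aeeqr q (fun=> 0) -> aeeqr g (fun=> 0).
Proof.
move=> [aq aq1 hq sq1 hg] q0.
have e1 := AC_deriv_uniq aq (AC_cst 0) q0.
have e2 := AC_deriv_uniq aq1 (AC_cst 0) e1.
apply: ae_map2 q0 e2 => x h1 h2 t; have := h2 t; rewrite (h1 t) /= mulr0 oppr0 sub0r.
by move=> /eqP; rewrite oppr_eq0 mulf_eq0 gt_eqF ?sech2_gt0 // => /eqP.
Qed.

(** With u = a + i b and v = c + i d the hypotheses say that (u, v) is an
    eigenvector for lam = 1 + i. The form <v, L_- v> = lam <v, u>, weighted by
    sech^2 on the right, is a real number r. Hence <u, L_+ u> = - lam <u, v> =
    - r lam / conj lam = - i r; it is real too, so it vanishes. Then D u = 0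
    by [ground_energy], hence L_+ u = 0 and v = 0, and finally u = 0. *)
Lemma no_eigenvector a b c d a1 b1 c1 d1 :
  plus_eq a a1 (fun x => c x - d x) -> plus_eq b b1 (fun x => c x + d x) ->
  minus_eq c c1 (fun x => a x - b x) -> minus_eq d d1 (fun x => a x + b x) ->
  [/\ aeeqr a (fun=> 0), aeeqr b (fun=> 0), aeeqr c (fun=> 0) & aeeqr d (fun=> 0)].
Proof.
move=> pa pb mc md.
have [_ _ sa sa1 hcd] := pa; have [_ _ sb sb1 hcd'] := pb.
have [_ _ hc sc1 hab] := mc; have [_ _ hd sd1 hab'] := md.
have ha := Sq_HR sa; have hb := Sq_HR sb.
have dB f p q : HR f -> HR p -> HR q -> I (fun x => sech2 x * (f x * (p x - q x))) =
   I (fun x => sech2 x * (f x * p x)) - I (fun x => sech2 x * (f x * q x)).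
  move=> hf hp hq; rewrite -I_B; [|exact: HR_IntM..].
  by apply: I_ext => x; rewrite mulrBr mulrBr.
have dD f p q : HR f -> HR p -> HR q -> I (fun x => sech2 x * (f x * (p x + q x))) =
   I (fun x => sech2 x * (f x * p x)) + I (fun x => sech2 x * (f x * q x)).
  move=> hf hp hq; rewrite -I_D; [|exact: HR_IntM..].
  by apply: I_ext => x; rewrite mulrDr mulrDr.
have sym p q : I (fun x => sech2 x * (p x * q x)) = I (fun x => sech2 x * (q x * p x)).
  by apply: I_ext => x; rewrite [p x * _]mulrC.
have symV p q : I (fun x => p x * ((6 * phi x ^+ 2 - 2) * q x)) =
    I (fun x => q x * ((6 * phi x ^+ 2 - 2) * p x)).
  by apply: I_ext => x; rewrite mulrCA mulrC -mulrA [p x * _]mulrC -mulrA mulrC -!mulrA; ring.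
have sym1 p q : I (fun x => p x * q x) = I (fun x => q x * p x).
  by apply: I_ext => x; rewrite mulrC.
have e1 := green_minus mc md; have e2 := green_minus md mc.
have e3 := green_plus pa pb; have e4 := green_plus pb pa.
have e5 := green_plus pa pa; have e6 := green_plus pb pb.
have [Sa ga] := ground_energy pa; have [Sb gb] := ground_energy pb.
rewrite dD // in e1; rewrite dB // in e2; rewrite dD // in e3; rewrite dB // in e4.
rewrite dB // in e5; rewrite dD // in e6.
rewrite (sym c a) (sym c b) in e1.
rewrite (sym d a) (sym d b) (sym d c) (sym1 d1 c1) in e2.
rewrite (symV b a) (sym1 b1 a1) in e4.
have tot : I (fun x => ground a a1 x ^+ 2) + I (fun x => ground b b1 x ^+ 2) = 0.
  rewrite ga gb.
  move: e1 e2 e3 e4 e5 e6.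
  move: (I (fun x => sech2 x * (c x * d x))) (I (fun x => sech2 x * (a x * c x)))
    (I (fun x => sech2 x * (b x * c x))) (I (fun x => sech2 x * (a x * d x)))
    (I (fun x => sech2 x * (b x * d x))) (I (fun x => c1 x * d1 x))
    (I (fun x => a1 x * b1 x)) (I (fun x => a1 x * a1 x)) (I (fun x => b1 x * b1 x))
    (I (fun x => a x * ((6 * phi x ^+ 2 - 2) * b x)))
    (I (fun x => a x * ((6 * phi x ^+ 2 - 2) * a x)))
    (I (fun x => b x * ((6 * phi x ^+ 2 - 2) * b x))) => *; lra.
have na : 0 <= I (fun x => ground a a1 x ^+ 2) by apply: I_ge0 => x; exact: sqr_ge0.
have nb : 0 <= I (fun x => ground b b1 x ^+ 2) by apply: I_ge0 => x; exact: sqr_ge0.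
have z p : Sq p -> I (fun x => p x ^+ 2) = 0 -> aeeqr p (fun=> 0).
  move=> [_ ip] p0; have := I_eq0_ae ip (fun x => sqr_ge0 _) p0.
  by apply: ae_map1 => x h t; apply/eqP; rewrite -sqrf_eq0; apply/eqP; exact: h.
have za : aeeqr (ground a a1) (fun=> 0) by apply: z => //; lra.
have zb : aeeqr (ground b b1) (fun=> 0) by apply: z => //; lra.
have ca := ground_zero pa za; have cb := ground_zero pb zb.
have c0 : aeeqr c (fun=> 0).
  by apply: ae_map2 ca cb => x h1 h2 t; have := h1 t; have := h2 t; lra.
have d0 : aeeqr d (fun=> 0).
  by apply: ae_map2 ca cb => x h1 h2 t; have := h1 t; have := h2 t; lra.
have ac := minus_zero mc c0; have ad := minus_zero md d0.
split=> //.
  by apply: ae_map2 ac ad => x h1 h2 t; have := h1 t; have := h2 t; lra.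
by apply: ae_map2 ac ad => x h1 h2 t; have := h1 t; have := h2 t; lra.
Qed.

End Energy.

Local Open Scope complex_scope.

(** * The space of pairs *)

Section HilbertSpace.
Variable R : realType.
Local Notation C := R[i].
Local Notation X := ((R -> C) * (R -> C))%type.
Local Notation mu := (@lebesgue_measure R).
Local Notation sech2 := (@sech2 R).
Local Notation sech := (@sech R).
Implicit Types f g : R -> C.

Lemma L2P f : L2 f <-> Sq (ReF f) /\ Sq (ImF f).
Proof. by rewrite /L2 !LfunSq. Qed.

Lemma ReF_scale (r : R -> R) f : ReF (fun x => (r x)%:C * f x) = (fun x => r x * ReF f x).
Proof. by apply/funext => x; rewrite /ReF; case: (f x) => u v /=; rewrite mul0r subr0. Qed.

Lemma ImF_scale (r : R -> R) f : ImF (fun x => (r x)%:C * f x) = (fun x => r x * ImF f x).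
Proof. by apply/funext => x; rewrite /ImF; case: (f x) => u v /=; rewrite mul0r addr0. Qed.

Lemma locbd_sechV : locbd (fun x => (sech x)^-1).
Proof.
apply: locbd_cont => x; apply: cvgV; last exact: cont_sech.
by rewrite gt_eqF // sech_gt0.
Qed.

Lemma meas_sechV : meas (fun x => (sech x)^-1).
Proof.
apply: meas_cont => x; apply: cvgV; last exact: cont_sech.
by rewrite gt_eqF // sech_gt0.
Qed.

Lemma HR_of_Sq (g : R -> R) : Sq (fun x => sech x * g x) -> HR g.
Proof.
move=> h; split=> //; have [m _] := h; have := measM meas_sechV m.
rewrite (_ : (fun x => _) = g) //; apply/funext => x.
by rewrite mulKf // gt_eqF // sech_gt0.
Qed.

(** On a compact set 1 / sech is bounded: being locally square-integrable is a
    consequence of the weighted condition. *)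
Lemma HR_Sq_compact (K : set R) (g : R -> R) : compact K -> HR g -> Sq (fun x => \1_K x * g x).
Proof.
move=> cK [mg sg].
have [M [_ hM]] := compact_bounded cK.
have [B hB] := locbd_sechV (`|M| + 1).
have m : meas (fun x => \1_K x * g x).
  by apply: measM => //; apply: measurable_indic; exact: compact_measurable.
apply: (@Sq_le _ _ (fun x => `|B| * `|sech x * g x|)) => //.
  apply: SqZ; case: sg => ms is_; split; first exact: measA.
  by apply: Int_ext is_ => x; rewrite real_normK ?num_real.
move=> x; rewrite indicE; case: (boolP (x \in K)) => [xK|_]; last first.
  by rewrite mul0r normr0 mulr_ge0.
rewrite mul1r -[g x](mulKf (lt0r_neq0 (sech_gt0 x))) normrM mulKf ?gt_eqF ?sech_gt0 //.
rewrite ler_wpM2r //; apply: le_trans (ler_norm B); apply: hB.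
by apply: (hM _ _ x); [have := ler_norm M; lra|exact/set_mem].
Qed.

(** Membership in H, read on real and imaginary parts ([HP]). *)
Definition HC f := HR (ReF f) /\ HR (ImF f).

Lemma HP f : H f <-> HC f.
Proof.
split=> [[_ /L2P]|[h1 h2]].
  by rewrite ReF_scale ImF_scale => -[h1 h2]; split; exact: HR_of_Sq.
split; last by apply/L2P; rewrite ReF_scale ImF_scale; split; [case: h1|case: h2].
move=> K cK; apply/L2P; rewrite (@ReF_scale (\1_K)) (@ImF_scale (\1_K)).
by split; exact: HR_Sq_compact.
Qed.

Lemma HC_lin (a : C) f g : HC f -> HC g -> HC (fun x => a * f x + g x).
Proof.
case: a => a b [f1 f2] [g1 g2]; split.
  have := HRD (HRD (HRZ a f1) (HRZ (- b) f2)) g1; congr HR; apply/funext => x.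
  by rewrite /ReF /ImF; case: (f x) (g x) => [u v] [y z] /=; ring.
have := HRD (HRD (HRZ a f2) (HRZ b f1)) g2; congr HR; apply/funext => x.
by rewrite /ReF /ImF; case: (f x) (g x) => [u v] [y z] /=; ring.
Qed.

Definition br (p q : R -> R) : R := I (fun x => sech2 x * (p x * q x)).

Lemma br_linear a (p q r : R -> R) : HR p -> HR q -> HR r ->
  br p (fun x => a * q x + r x) = a * br p q + br p r.
Proof.
move=> hp hq hr; rewrite /br -I_Z; last exact: HR_IntM.
rewrite -I_D; [|exact/IntZ/HR_IntM|exact: HR_IntM].
by apply: I_ext => x; ring.
Qed.

Lemma brC p q : br p q = br q p.
Proof. by apply: I_ext => x; rewrite [p x * _]mulrC. Qed.

Lemma dotHE f g : HC f -> HC g -> dotH f g =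
  (br (ReF f) (ReF g) + br (ImF f) (ImF g)) +i* (br (ReF f) (ImF g) - br (ImF f) (ReF g)).
Proof.
move=> [f1 f2] [g1 g2]; rewrite /dotH /Cint -!/(I _); congr (_ +i* _).
  rewrite -I_D; [|exact: HR_IntM..]; apply: I_ext => x.
  by rewrite /ReF /ImF /sech2; case: (f x) (g x) => [u v] [y z] /=; ring.
rewrite -I_B; [|exact: HR_IntM..]; apply: I_ext => x.
by rewrite /ReF /ImF /sech2; case: (f x) (g x) => [u v] [y z] /=; ring.
Qed.

Lemma dotH_linear f a g h : HC f -> HC g -> HC h ->
  dotH f (fun x => a * g x + h x) = a * dotH f g + dotH f h.
Proof.
move=> hf hg hh; rewrite !dotHE //; last exact: HC_lin.
case: hf hg hh => f1 f2 [g1 g2] [h1 h2]; case: a => a b.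
have eR : ReF (fun x => (a +i* b) * g x + h x) = (fun x => a * ReF g x + (- b * ImF g x + ReF h x)).
  by apply/funext => x; rewrite /ReF /ImF; case: (g x) (h x) => [u v] [y z] /=; ring.
have eI : ImF (fun x => (a +i* b) * g x + h x) = (fun x => a * ImF g x + (b * ReF g x + ImF h x)).
  by apply/funext => x; rewrite /ReF /ImF; case: (g x) (h x) => [u v] [y z] /=; ring.
have k1 : HR (fun x => - b * ImF g x + ReF h x) by apply: HRD => //; exact: HRZ.
have k2 : HR (fun x => b * ReF g x + ImF h x) by apply: HRD => //; exact: HRZ.
rewrite eR eI !br_linear //; apply/eqP; rewrite eq_complex /=; apply/andP.
by split; apply/eqP; ring.
Qed.

Lemma dotH_conj f g : HC f -> HC g -> dotH g f = (dotH f g)^*.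
Proof.
move=> hf hg; rewrite !dotHE //= (brC (ReF f)) (brC (ImF f)) (brC (ReF f)) (brC (ImF f)).
by congr (_ +i* _); rewrite opprB.
Qed.

Lemma Re_dotH f : HC f -> complex.Re (dotH f f) = nrm2 (ReF f) + nrm2 (ImF f).
Proof.
by move=> hf; rewrite dotHE.
Qed.

Lemma nrm2_ge0 (g : R -> R) : 0 <= nrm2 g.
Proof. by apply: I_ge0 => x; rewrite mulr_ge0 ?sqr_ge0 // ltW // sech2_gt0. Qed.

Lemma nrm2_eq0 (g : R -> R) : HR g -> nrm2 g = 0 <-> aeeqr g (fun=> 0).
Proof.
move=> hg; have s0 x := ltW (@sech2_gt0 R x); split=> [h|h].
  have := I_eq0_ae (HR_Int2 hg) (fun x => mulr_ge0 (s0 x) (sqr_ge0 _)) h.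
  apply: ae_map1 => x hx t; have /eqP := hx t.
  by rewrite mulf_eq0 gt_eqF ?sech2_gt0 // sqrf_eq0 => /eqP.
rewrite -[RHS](I_0 R); apply: I_ae; [exact: Int_meas (HR_Int2 hg)|exact: measc|].
by apply: ae_map1 h => x hx t; rewrite hx // expr0n /= mulr0.
Qed.

Definition HHpred : {pred X} := [pred w | `[< HH w >]].

Lemma HHP (w : X) : reflect (HC w.1 /\ HC w.2) (w \in HHpred).
Proof.
apply: (iffP (asboolP _)) => -[h1 h2]; split; exact/HP.
Qed.

Lemma HHpred_submod : submod_closed HHpred.
Proof.
split.
  have h0 : HC (fun=> 0) by split; apply/Sq_HR; split; [exact: measc|apply: Int_ext (Int0 R) => x; rewrite expr0n|exact: measc|apply: Int_ext (Int0 R) => x; rewrite expr0n].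
  by apply/HHP.
by move=> a u v /HHP[u1 u2] /HHP[v1 v2]; apply/HHP; split; exact: HC_lin.
Qed.

HB.instance Definition _ := GRing.isSubmodClosed.Build C X HHpred HHpred_submod.

(** The functions themselves, and not their classes, form a vector space, with
    sums and scalar multiples computed pointwise. *)
Record HHt := HHT { hval : X; hvalP : hval \in HHpred }.
HB.instance Definition _ := [isSub for hval].
HB.instance Definition _ := [Choice of HHt by <:].
HB.instance Definition _ := [SubChoice_isSubLmodule of HHt by <:].

End HilbertSpace.

(** * Pointwise completeness of the space of pairs *)

Section GeometricLimit.
Variable R : realType.

(** Completeness of the line, obtained as a supremum: with q^2 = r, the
    intervals of radius 2 q / 2^n about u n are nested. *)
Lemma geometric_limit (u : nat -> R) (r : R) : 0 <= r ->
  (forall n, (u n.+1 - u n) ^+ 2 <= r * 4^-1 ^+ n) ->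
  exists l, forall n, (l - u n) ^+ 2 <= 4 * r * 4^-1 ^+ n.
Proof.
move=> r0 h; pose q := Num.sqrt r; pose d n := q * 2^-1 ^+ n.
have q0 : 0 <= q by exact: sqrtr_ge0.
have d0 n : 0 <= d n by rewrite mulr_ge0 // exprn_ge0 // invr_ge0.
have d2 n : d n ^+ 2 = r * 4^-1 ^+ n.
  rewrite exprMn sqr_sqrtr // -exprM mulnC exprM; congr (_ * _ ^+ n).
  by rewrite exprVn; congr (_^-1); ring.
have step n : `|u n.+1 - u n| <= d n.
  by rewrite -ler_sqr ?nnegrE // real_normK ?num_real // d2.
have dS n : d n = 2 * d n.+1.
  by rewrite /d exprS; field.
pose a n := u n - 2 * d n; pose b n := u n + 2 * d n.
have amono m n : (m <= n)%N -> a m <= a n.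
  move=> /subnK <-; elim: (n - m)%N => [//|k IH]; rewrite addSn.
  apply: le_trans IH _; have := step (k + m)%N; have := dS (k + m)%N.
  by rewrite /a ler_norml => e /andP[e1 e2]; lra.
have bmono m n : (m <= n)%N -> b n <= b m.
  move=> /subnK <-; elim: (n - m)%N => [//|k IH]; rewrite addSn.
  apply: le_trans IH; have := step (k + m)%N; have := dS (k + m)%N.
  by rewrite /b ler_norml => e /andP[e1 e2]; lra.
have ab m n : a m <= b n.
  apply: le_trans (amono m (maxn m n) (leq_maxl _ _)) _.
  apply: le_trans (bmono n (maxn m n) (leq_maxr _ _)).
  by rewrite /a /b; have := d0 (maxn m n); lra.
pose l := sup (range a).
have hs : has_sup (range a) by split; [exists (a 0%N), 0%N|exists (b 0%N) => _ [n _ <-]].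
exists l => n.
have l1 : a n <= l by apply: sup_upper_bound => //; exists n.
have l2 : l <= b n by apply: ge_sup; [by exists (a 0%N), 0%N|move=> _ [m _ <-]].
have : `|l - u n| <= 2 * d n by rewrite ler_norml; rewrite /a /b in l1 l2; apply/andP; split; lra.
rewrite -ler_sqr ?nnegrE ?mulr_ge0 // real_normK ?num_real // exprMn d2 => h1.
by apply: le_trans h1 _; rewrite mulrA ler_wpM2r ?exprn_ge0 ?invr_ge0 //; lra.
Qed.

Lemma meas_geometric_limit (u : nat -> R -> R) (l : R -> R) (r : R) :
  (forall n, meas (u n)) -> (forall n x, (l x - u n x) ^+ 2 <= 4 * r * 4^-1 ^+ n) -> meas l.
Proof.
move=> mu h; apply: (@measurable_fun_cvg _ _ R setT u l mu) => x _.
have r0 : 0 <= 4 * r by have := h 0%N x; rewrite expr0 mulr1; apply: le_trans; exact: sqr_ge0.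
apply/cvgrPdist_le => e e0.
have g : (fun n => 4 * r * 4^-1 ^+ n : R) @ \oo --> (0 : R).
  rewrite -(mulr0 (4 * r)); apply: cvgM; first exact: cvg_cst.
  by apply: cvg_expr; rewrite ger0_norm ?invr_ge0 // invf_lt1 // ltr1n.
move/cvgr0Pnorm_lt: g => /(_ (e ^+ 2)); rewrite exprn_gt0 // => /(_ isT).
apply: filterS => n hn; rewrite -ler_sqr ?nnegrE ?(ltW e0) // real_normK ?num_real //.
apply: le_trans (h n x) _; apply: ltW; apply: le_lt_trans hn; exact: ler_norm.
Qed.

End GeometricLimit.

Section Space.
Variable R : realType.
Local Notation C := R[i].
Local Notation X := ((R -> C) * (R -> C))%type.
Local Notation V := (HHt R).
Implicit Types x y z : V.

(** Point evaluation at t.1 of the component selected by t.2. *)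
Definition HHev (t : R * bool) x : C := if t.2 then (hval x).1 t.1 else (hval x).2 t.1.
Definition HHip x y : C := dotH (hval x).1 (hval y).1 + dotH (hval x).2 (hval y).2.

Lemma HH1 x : HC (hval x).1. Proof. by have /HHP[] := hvalP x. Qed.
Lemma HH2 x : HC (hval x).2. Proof. by have /HHP[] := hvalP x. Qed.

Lemma HHip_linear x a y z : HHip x (a *: y + z) = a * HHip x y + HHip x z.
Proof.
rewrite /HHip mulrDr addrACA.
by congr (_ + _); rewrite -dotH_linear //; first [exact: HH1|exact: HH2].
Qed.

Lemma HHip_conj x y : HHip y x = (HHip x y)^*.
Proof. by rewrite /HHip rmorphD /= (dotH_conj (HH1 x) (HH1 y)) (dotH_conj (HH2 x) (HH2 y)). Qed.

Definition HHnorm2 x : R := nrm2 (ReF (hval x).1) + nrm2 (ImF (hval x).1) +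
  (nrm2 (ReF (hval x).2) + nrm2 (ImF (hval x).2)).

Lemma Re_HHip x : complex.Re (HHip x x) = HHnorm2 x.
Proof. by rewrite ReD !Re_dotH //; [exact: HH2|exact: HH1]. Qed.

Lemma HHip_ge0 x : 0 <= complex.Re (HHip x x).
Proof. by rewrite Re_HHip !addr_ge0 // nrm2_ge0. Qed.

Lemma HHev_linear t (a : C) x y : HHev t (a *: x + y) = a * HHev t x + HHev t y.
Proof. by case: t => t []. Qed.

Lemma HHev_sep x : (forall t, HHev t x = 0) -> x = 0.
Proof.
move=> h; apply: val_inj => /=; case: x h => -[f g] p h /=; congr (_, _).
  by apply/funext => t; exact: (h (t, true)).
by apply/funext => t; exact: (h (t, false)).
Qed.

Definition HHdens x (t : R) : R := sqmod (HHev (t, true) x) + sqmod (HHev (t, false) x).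

Lemma HHnorm2E x : Int (fun t => sech2 t * HHdens x t) /\
  HHnorm2 x = I (fun t => sech2 t * HHdens x t).
Proof.
have [[h1 h2] [h3 h4]] := (HH1 x, HH2 x).
have i1 := HR_Int2 h1; have i2 := HR_Int2 h2; have i3 := HR_Int2 h3; have i4 := HR_Int2 h4.
have e : (fun t => sech2 t * HHdens x t) = (fun t => sech2 t * ReF (hval x).1 t ^+ 2 +
   sech2 t * ImF (hval x).1 t ^+ 2 + (sech2 t * ReF (hval x).2 t ^+ 2 + sech2 t * ImF (hval x).2 t ^+ 2)).
  by apply/funext => t; rewrite /HHdens /sqmod /HHev /ReF /ImF /=; ring.
rewrite e; split; first by apply: IntD; exact: IntD.
by rewrite !I_D //; exact: IntD.
Qed.

(** The factor 2 counts the two components. *)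
Lemma HHip_dominated (s : seq V) (r : R) : 0 <= r ->
  (forall t, \sum_(x <- s) sqmod (HHev t x) <= r * 1) ->
  \sum_(x <- s) complex.Re (HHip x x) <= r * (2 * smass R).
Proof.
move=> r0 h; under eq_bigr do rewrite Re_HHip.
have [i e] : Int (fun t => sech2 t * \sum_(x <- s) HHdens x t) /\
    \sum_(x <- s) HHnorm2 x = I (fun t => sech2 t * \sum_(x <- s) HHdens x t).
  elim: s {h} => [|x s [i e]].
    rewrite big_nil; split; last first.
      by rewrite -[LHS](I_0 R); apply: I_ext => t; rewrite big_nil mulr0.
    by apply: Int_ext (Int0 R) => t; rewrite big_nil mulr0.
  have [ix ex] := HHnorm2E x; split.
    by apply: Int_ext (IntD ix i) => t; rewrite big_cons [RHS]mulrDr.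
  by rewrite big_cons ex e -I_D //; apply: I_ext => t; rewrite big_cons [RHS]mulrDr.
rewrite e mulrA -I_Z; last exact: Int_sech2.
apply: I_le => //; first exact/IntZ/Int_sech2.
move=> t; rewrite mulrC ler_wpM2r ?(ltW (sech2_gt0 _)) //.
rewrite big_split /=; have := h (t, true); have := h (t, false).
rewrite mulr1 => h1 h2; lra.
Qed.

Lemma HHev_complete (x : nat -> V) (r : R) : 0 <= r ->
  (forall n t, sqmod (HHev t (x n.+1 - x n)) <= r * 4^-1 ^+ n * 1) ->
  exists y, forall n t, sqmod (HHev t (y - x n)) <= 8 * r * 4^-1 ^+ n * 1.
Proof.
move=> r0 h.
have evB t y z : HHev t (y - z) = HHev t y - HHev t z.
  by case: t => t []; rewrite /HHev /=.
have comp (F : C -> R) : (forall a b : C, F (a - b) = F a - F b) -> (forall a : C, F a ^+ 2 <= sqmod a) ->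
   {l : R * bool -> R & forall t n, (l t - F (HHev t (x n))) ^+ 2 <= 4 * r * 4^-1 ^+ n}.
  move=> FB Fle; apply: (@choice _ _ (fun t l => forall n, (l - F (HHev t (x n))) ^+ 2 <= 4 * r * 4^-1 ^+ n)) => t.
  apply: geometric_limit => // n; rewrite -FB -evB; apply: le_trans (Fle _) _.
  by have := h n t; rewrite mulr1.
have [lr hr] : {l : R * bool -> R & forall t n, (l t - complex.Re (HHev t (x n))) ^+ 2 <= 4 * r * 4^-1 ^+ n}.
  by apply: comp => [[a b] [c d] //|[a b]]; rewrite /sqmod /= lerDl sqr_ge0.
have [li hi] : {l : R * bool -> R & forall t n, (l t - complex.Im (HHev t (x n))) ^+ 2 <= 4 * r * 4^-1 ^+ n}.
  by apply: comp => [[a b] [c d] //|[a b]]; rewrite /sqmod /= lerDr sqr_ge0.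
have HRlim (u : nat -> R -> R) (l : R -> R) : (forall n, HR (u n)) ->
    (forall n t, (l t - u n t) ^+ 2 <= 4 * r * 4^-1 ^+ n) -> HR l.
  move=> hu hl; have ml : meas l by apply: meas_geometric_limit hl => n; case: (hu n).
  have hd : HR (fun t => l t - u 0%N t).
    apply: (HR_bounded (M := Num.sqrt (4 * r))); first by apply: measB => //; case: (hu 0%N).
    move=> t; have := hl 0%N t; rewrite expr0 mulr1 => hlt.
    by rewrite -sqrtr_sqr ler_wsqrtr.
  by have := HRD hd (hu 0%N); congr HR; apply/funext => t; rewrite subrK.
pose f1 t : C := lr (t, true) +i* li (t, true).
pose f2 t : C := lr (t, false) +i* li (t, false).
have fP : (f1, f2) \in @HHpred R.
  apply/HHP; split; split.
  - by apply: (HRlim (fun n => ReF (hval (x n)).1)) => [n|n t]; [case: (HH1 (x n))|exact: (hr (t, true))].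
  - by apply: (HRlim (fun n => ImF (hval (x n)).1)) => [n|n t]; [case: (HH1 (x n))|exact: (hi (t, true))].
  - by apply: (HRlim (fun n => ReF (hval (x n)).2)) => [n|n t]; [case: (HH2 (x n))|exact: (hr (t, false))].
  - by apply: (HRlim (fun n => ImF (hval (x n)).2)) => [n|n t]; [case: (HH2 (x n))|exact: (hi (t, false))].
exists (HHT fP) => n t; rewrite mulr1 evB.
have -> : HHev t (HHT fP) = lr t +i* li t by case: t => t [].
have := hr t n; have := hi t n; case: (HHev t (x n)) => a b; rewrite /sqmod /=; lra.
Qed.

(** The weight sech^2 has been absorbed in the measure, so that the bounding
    weight is constant. *)
Definition HHspace : carleman_space V :=
  @CarlemanSpace R V HHip (R * bool)%type HHev (fun=> 1) (2 * smass R)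
    HHip_linear HHip_conj HHip_ge0 HHev_linear HHev_sep (fun=> ler01)
    (mulr_ge0 (ler0n _ 2) (ltW (smass_gt0 R))) HHip_dominated HHev_complete.

Lemma sqnormE x : sqnorm HHspace x = HHnorm2 x.
Proof. exact: Re_HHip. Qed.

Lemma sqnorm_eq0 x : sqnorm HHspace x = 0 <-> aeeq (hval x) 0.
Proof.
rewrite sqnormE /HHnorm2; have [[h1 h2] [h3 h4]] := (HH1 x, HH2 x).
split=> [h|[/aeeqcP[e1 e2] /aeeqcP[e3 e4]]].
  have := nrm2_ge0 (ReF (hval x).1); have := nrm2_ge0 (ImF (hval x).1).
  have := nrm2_ge0 (ReF (hval x).2); have := nrm2_ge0 (ImF (hval x).2) => n4 n3 n2 n1.
  split; apply/aeeqcP; split; apply/nrm2_eq0 => //; lra.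
rewrite ((nrm2_eq0 h1).2 e1) ((nrm2_eq0 h2).2 e2) ((nrm2_eq0 h3).2 e3) ((nrm2_eq0 h4).2 e4).
by rewrite !addr0.
Qed.

Lemma eqv_aeeq x y : eqv HHspace x y <-> aeeq (hval x) (hval y).
Proof.
rewrite /eqv sqnorm_eq0; split=> -[h1 h2]; split.
- by apply: ae_map1 h1 => t h u; apply/eqP; rewrite -subr_eq0; apply/eqP; exact: h.
- by apply: ae_map1 h2 => t h u; apply/eqP; rewrite -subr_eq0; apply/eqP; exact: h.
- by apply: ae_map1 h1 => t h u; apply/eqP; rewrite subr_eq0; apply/eqP; exact: h.
- by apply: ae_map1 h2 => t h u; apply/eqP; rewrite subr_eq0; apply/eqP; exact: h.
Qed.

Lemma normHHE x : normHH (hval x) = Num.sqrt (sqnorm HHspace x).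
Proof. by []. Qed.

End Space.

(** * The complex operators and their domains *)

Section Domain.
Variable R : realType.
Local Notation C := R[i].
Local Notation sech2 := (@sech2 R).
Local Notation phi := (@phi R).
Implicit Types (f g : R -> C) (p q : R -> R).

Lemma Re_calLplus f : ReF (calLplus f) =
  (fun x => cosh x ^+ 2 * (- ReF (wderiv 2 f) x + (6 * phi x ^+ 2 - 2) * ReF f x)).
Proof.
rewrite /calLplus ReF_scale; apply/funext => x; congr (_ * _).
by rewrite /Lplus /ReF; case: (wderiv 2 f x) (f x) => [a b] [c d] /=; ring.
Qed.

Lemma Im_calLplus f : ImF (calLplus f) =
  (fun x => cosh x ^+ 2 * (- ImF (wderiv 2 f) x + (6 * phi x ^+ 2 - 2) * ImF f x)).
Proof.
rewrite /calLplus ImF_scale; apply/funext => x; congr (_ * _).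
by rewrite /Lplus /ImF; case: (wderiv 2 f x) (f x) => [a b] [c d] /=; ring.
Qed.

Lemma Re_calLminus f : ReF (calLminus f) =
  (fun x => cosh x ^+ 2 * (- ReF (wderiv 2 f) x + (2 * phi x ^+ 2 - 2) * ReF f x)).
Proof.
rewrite /calLminus ReF_scale; apply/funext => x; congr (_ * _).
by rewrite /Lminus /ReF; case: (wderiv 2 f x) (f x) => [a b] [c d] /=; ring.
Qed.

Lemma Im_calLminus f : ImF (calLminus f) =
  (fun x => cosh x ^+ 2 * (- ImF (wderiv 2 f) x + (2 * phi x ^+ 2 - 2) * ImF f x)).
Proof.
rewrite /calLminus ImF_scale; apply/funext => x; congr (_ * _).
by rewrite /Lminus /ImF; case: (wderiv 2 f x) (f x) => [a b] [c d] /=; ring.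
Qed.

Lemma cont_cosh : continuous (@cosh R).
Proof.
move=> x; apply: cvgM; last exact: cvg_cst.
apply: cvgD; first exact: continuous_expR.
by apply: continuous_comp; [exact: opp_continuous|exact: continuous_expR].
Qed.

Lemma meas_cosh2 : meas (fun x : R => cosh x ^+ 2).
Proof. by apply: measX; apply: meas_cont; exact: cont_cosh. Qed.

Lemma sech2_cosh2 x (r : R) : sech2 x * (cosh x ^+ 2 * r) = r.
Proof. by rewrite mulrA [sech2 x * _]mulrC sech2_cosh mul1r. Qed.

Lemma cosh2_sech2 x (r : R) : cosh x ^+ 2 * (sech2 x * r) = r.
Proof. by rewrite mulrA sech2_cosh mul1r. Qed.

(** The chosen representatives of the weak derivatives agree almost everywhere
    with the given derivatives. *)
Lemma weak_intro p p1 p2 q q1 q2 : AC2 p p1 p2 -> AC2 q q1 q2 ->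
  [/\ weakly_derivable 1 (cx p q), weakly_derivable 2 (cx p q),
      meas (ReF (wderiv 1 (cx p q))) /\ meas (ImF (wderiv 1 (cx p q))),
      aeeqc (wderiv 1 (cx p q)) (cx p1 q1) &
      (meas (ReF (wderiv 2 (cx p q))) /\ meas (ImF (wderiv 2 (cx p q)))) /\
      aeeqc (wderiv 2 (cx p q)) (cx p2 q2)].
Proof.
move=> hp hq; have [w1 w2] := AC2_is_wderiv hp hq.
have d1 : weakly_derivable 1 (cx p q) by exists (cx p1 q1).
have d2 : weakly_derivable 2 (cx p q) by exists (cx p2 q2).
split=> //; [|exact: wderiv_ae|split; [|exact: wderiv_ae]].
  by have [_ /L1locP[[? _] [? _]] _] := wderivP d1.
by have [_ /L1locP[[? _] [? _]] _] := wderivP d2.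
Qed.

Lemma H1plus_intro p p1 p2 q q1 q2 : AC2 p p1 p2 -> AC2 q q1 q2 ->
  Sq p -> Sq p1 -> Sq q -> Sq q1 -> H1plus (cx p q).
Proof.
move=> hp hq sp sp1 sq sq1; have [d1 _ [m1 m2] /aeeqcP[e1 e2] _] := weak_intro hp hq.
split=> //; first by apply/L2P.
by apply/L2P; split; [apply: Sq_ae sp1 m1 (ae_sym e1)|apply: Sq_ae sq1 m2 (ae_sym e2)].
Qed.

Lemma H1minus_intro p p1 p2 q q1 q2 : AC2 p p1 p2 -> AC2 q q1 q2 ->
  HR p -> Sq p1 -> HR q -> Sq q1 -> H1minus (cx p q).
Proof.
move=> hp hq sp sp1 sq sq1; have [d1 _ [m1 m2] /aeeqcP[e1 e2] _] := weak_intro hp hq.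
split=> //; first by apply/HP.
by apply/L2P; split; [apply: Sq_ae sp1 m1 (ae_sym e1)|apply: Sq_ae sq1 m2 (ae_sym e2)].
Qed.

Lemma Re_sub6 (z a : C) : complex.Re (z - 6 * a) = complex.Re z - 6 * complex.Re a.
Proof. by case: z a => [? ?] [? ?] /=; ring. Qed.

Lemma Im_sub6 (z a : C) : complex.Im (z - 6 * a) = complex.Im z - 6 * complex.Im a.
Proof. by case: z a => [? ?] [? ?] /=; ring. Qed.

Lemma Re_sub2 (z a m : C) :
  complex.Re (z - 2 * a - m) = complex.Re z - 2 * complex.Re a - complex.Re m.
Proof. by case: z a m => [? ?] [? ?] [? ?] /=; ring. Qed.

Lemma Im_sub2 (z a m : C) :
  complex.Im (z - 2 * a - m) = complex.Im z - 2 * complex.Im a - complex.Im m.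
Proof. by case: z a m => [? ?] [? ?] [? ?] /=; ring. Qed.

Definition RpC f := cx (Rp (ReF f)) (Rp (ImF f)).
Definition RmC f := cx (Rm (ReF f)) (Rm (ImF f)).

Lemma RpC_HC f : HC f -> HC (RpC f).
Proof. by move=> [h1 h2]; split; apply: Sq_HR; [have [] := Rp_Sq h1|have [] := Rp_Sq h2]. Qed.

Lemma RmC_HC f : HC f -> HC (RmC f).
Proof. by move=> [h1 h2]; split; exact: Rm_HR. Qed.

(** With [RpC_left], this says that Rp inverts cosh^2 L_+ + 6. *)
Lemma RpC_domain f : HC f -> H2plus (RpC f) /\
  aeeqc (calLplus (RpC f)) (fun x => f x - 6 * RpC f x).
Proof.
move=> [h1 h2]; have a1 := Rp_AC2 h1; have a2 := Rp_AC2 h2.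
have [s1 s1'] := Rp_Sq h1; have [s2 s2'] := Rp_Sq h2.
have [d1 d2 _ _ [[m1 m2] /aeeqcP[e1 e2]]] := weak_intro a1 a2.
have key p (d : R -> R) : aeeqr d (fun x => 4 * Rp p x - sech2 x * p x) ->
    aeeqr (fun x => cosh x ^+ 2 * (- d x + (6 * phi x ^+ 2 - 2) * Rp p x)) (fun x => p x - 6 * Rp p x).
  apply: ae_map1 => x h t; rewrite h // phi2E.
  have -> : - (4 * Rp p x - sech2 x * p x) + (6 * (1 - sech2 x) - 2) * Rp p x =
    sech2 x * (p x - 6 * Rp p x) by move: (sech2 x) (Rp p x) (p x) => a b c; ring.
  exact: cosh2_sech2.
have k1 := key _ _ e1; have k2 := key _ _ e2.
have ae : aeeqc (calLplus (RpC f)) (fun x => f x - 6 * RpC f x).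
  apply/aeeqcP; rewrite Re_calLplus Im_calLplus; split.
    by apply: ae_trans k1 _; apply: aeW => x _; rewrite /ReF Re_sub6.
  by apply: ae_trans k2 _; apply: aeW => x _; rewrite /ImF Im_sub6.
split=> //; split=> //; first exact: H1plus_intro a1 a2 s1 s1' s2 s2'.
have HRsub p : HR p -> HR (fun x => p x - 6 * Rp p x).
  move=> hp; have := HRD (HRZ (- 6) (Sq_HR (Rp_Sq hp).1)) hp; congr HR; apply/funext => x; ring.
have mL p (d : R -> R) : HR p -> meas d ->
    meas (fun x => cosh x ^+ 2 * (- d x + (6 * phi x ^+ 2 - 2) * Rp p x)).
  move=> hp md; apply: measM; first exact: meas_cosh2.
  apply: measD; first exact: measN.
  by apply: measM; [exact: meas_potential|exact: AC_meas (Rp_AC2 hp).1].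
apply/HP; split; rewrite ?Re_calLplus ?Im_calLplus.
  exact: HR_ae (HRsub _ h1) (mL _ _ h1 m1) (ae_sym k1).
exact: HR_ae (HRsub _ h2) (mL _ _ h2 m2) (ae_sym k2).
Qed.

Definition smeanC f : C := smean (ReF f) +i* smean (ImF f).

(** With [RmC_left], this says that Rm inverts cosh^2 L_- + 2 + smean. *)
Lemma RmC_domain f : HC f -> H2minus (RmC f) /\
  aeeqc (calLminus (RmC f)) (fun x => f x - 2 * RmC f x - smeanC (RmC f)).
Proof.
move=> [h1 h2]; have a1 := Rm_AC2 h1; have a2 := Rm_AC2 h2.
have s1 := Rm1_Sq h1; have s2 := Rm1_Sq h2.
have [d1 d2 _ _ [[m1 m2] /aeeqcP[e1 e2]]] := weak_intro a1 a2.
have key p (d : R -> R) : HR p -> aeeqr d (fun x => - centred p x) ->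
    aeeqr (fun x => cosh x ^+ 2 * (- d x + (2 * phi x ^+ 2 - 2) * Rm p x))
     (fun x => p x - 2 * Rm p x - smean (Rm p)).
  move=> hp; apply: ae_map1 => x h t; rewrite h // phi2E (smean_Rm hp) /centred.
  have -> : - - (sech2 x * (p x - smean p / smass R)) + (2 * (1 - sech2 x) - 2) * Rm p x =
    sech2 x * (p x - 2 * Rm p x - smean p / smass R).
    by move: (sech2 x) (Rm p x) (p x) (smean p / smass R) => a b c d'; ring.
  exact: cosh2_sech2.
have k1 := key _ _ h1 e1; have k2 := key _ _ h2 e2.
have ae : aeeqc (calLminus (RmC f)) (fun x => f x - 2 * RmC f x - smeanC (RmC f)).
  apply/aeeqcP; rewrite Re_calLminus Im_calLminus; split.
    by apply: ae_trans k1 _; apply: aeW => x _; rewrite /ReF Re_sub2.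
  by apply: ae_trans k2 _; apply: aeW => x _; rewrite /ImF Im_sub2.
have b1 := Rm_HR h1; have b2 := Rm_HR h2.
split=> //; split=> //; first exact: H1minus_intro a1 a2 b1 s1 b2 s2.
have HRsub p : HR p -> HR (fun x => p x - 2 * Rm p x - smean (Rm p)).
  move=> hp; have hc : HR (fun=> - smean (Rm p)) by exact: (HR_bounded (measc _) (fun=> lexx _)).
  have := HRD (HRD (HRZ (- 2) (Rm_HR hp)) hp) hc; congr HR; apply/funext => x.
  by congr (_ - _); ring.
have mL p (d : R -> R) : HR p -> meas d ->
    meas (fun x => cosh x ^+ 2 * (- d x + (2 * phi x ^+ 2 - 2) * Rm p x)).
  move=> hp md; apply: measM; first exact: meas_cosh2.
  apply: measD; first exact: measN.
  apply: measM; last exact: AC_meas (Rm_AC2 hp).1.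
  apply: measB; last exact: measc.
  by apply: measM; [exact: measc|apply: measX; exact: meas_phi].
apply/HP; split; rewrite ?Re_calLminus ?Im_calLminus.
  exact: HR_ae (HRsub _ h1) (mL _ _ h1 m1) (ae_sym k1).
exact: HR_ae (HRsub _ h2) (mL _ _ h2 m2) (ae_sym k2).
Qed.

(** The domain in terms of absolutely continuous representatives of the real
    and imaginary parts. *)
Lemma H2plus_elim f : H2plus f -> exists p p1 q q1,
  [/\ aeeqc f (cx p q), [/\ Sq p, Sq p1, Sq q & Sq q1] &
   isAC p p1 /\ isAC p1 (fun x => (6 * phi x ^+ 2 - 2) * p x - sech2 x * ReF (calLplus f) x) /\
   isAC q q1 /\ isAC q1 (fun x => (6 * phi x ^+ 2 - 2) * q x - sech2 x * ImF (calLplus f) x)].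
Proof.
move=> [[/L2P[sf1 sf2] w1 /L2P[sd1 sd2]] w2 /HP[hL1 hL2]].
have [p [p1 [q [q1 [[hp hp1] [hq hq1] /aeeqcP[e1 e2] /aeeqcP[e3 e4]]]]]] := weak2_AC w1 w2.
exists p, p1, q, q1; split; first by apply/aeeqcP.
  split; [exact: Sq_ae sf1 (AC_meas hp) e1|exact: Sq_ae sd1 (AC_meas hp1) e3|
          exact: Sq_ae sf2 (AC_meas hq) e2|exact: Sq_ae sd2 (AC_meas hq1) e4].
have m (g h : R -> R) : HR h -> meas g -> meas (fun x => (6 * phi x ^+ 2 - 2) * g x - sech2 x * h x).
  move=> hh mg; apply: measB; last by apply: Int_meas; exact: HR_Int.
  by apply: measM => //; exact: meas_potential.
have alg (V z d : R) : V * z - (- d + V * z) = d by ring.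
split=> //; split; last split=> //.
  apply: AC_ae hp1 (m _ _ hL1 (AC_meas hp)) _; apply: ae_map1 e1 => x h t.
  rewrite Re_calLplus sech2_cosh2; have -> : p x = ReF f x by rewrite (h t).
  by rewrite alg.
apply: AC_ae hq1 (m _ _ hL2 (AC_meas hq)) _; apply: ae_map1 e2 => x h t.
rewrite Im_calLplus sech2_cosh2; have -> : q x = ImF f x by rewrite (h t).
  by rewrite alg.
Qed.

Lemma H2minus_elim f : H2minus f -> exists p p1 q q1,
  [/\ aeeqc f (cx p q), [/\ HR p, Sq p1, HR q & Sq q1] &
   isAC p p1 /\ isAC p1 (fun x => - (2 * sech2 x * p x) - sech2 x * ReF (calLminus f) x) /\
   isAC q q1 /\ isAC q1 (fun x => - (2 * sech2 x * q x) - sech2 x * ImF (calLminus f) x)].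
Proof.
move=> [[/HP[sf1 sf2] w1 /L2P[sd1 sd2]] w2 /HP[hL1 hL2]].
have [p [p1 [q [q1 [[hp hp1] [hq hq1] /aeeqcP[e1 e2] /aeeqcP[e3 e4]]]]]] := weak2_AC w1 w2.
exists p, p1, q, q1; split; first by apply/aeeqcP.
  split; [exact: HR_ae sf1 (AC_meas hp) e1|exact: Sq_ae sd1 (AC_meas hp1) e3|
          exact: HR_ae sf2 (AC_meas hq) e2|exact: Sq_ae sd2 (AC_meas hq1) e4].
have m (g h : R -> R) : HR h -> meas g -> meas (fun x => - (2 * sech2 x * g x) - sech2 x * h x).
  move=> hh mg; apply: measB; last by apply: Int_meas; exact: HR_Int.
  apply: measN; apply: measM => //; apply: measM; [exact: measc|exact: meas_sech2].
have alg x (d z : R) : - (2 * sech2 x * z) - (- d + (2 * phi x ^+ 2 - 2) * z) = d.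
  by rewrite phi2E; ring.
split=> //; split; last split=> //.
  apply: AC_ae hp1 (m _ _ hL1 (AC_meas hp)) _; apply: ae_map1 e1 => x h t.
  rewrite Re_calLminus sech2_cosh2; have -> : p x = ReF f x by rewrite (h t).
  by rewrite alg.
apply: AC_ae hq1 (m _ _ hL2 (AC_meas hq)) _; apply: ae_map1 e2 => x h t.
rewrite Im_calLminus sech2_cosh2; have -> : q x = ImF f x by rewrite (h t).
  by rewrite alg.
Qed.

Lemma RpC_left f : H2plus f -> aeeqc f (RpC (fun x => calLplus f x + 6 * f x)).
Proof.
move=> hf; have [p [p1 [q [q1 [/aeeqcP[e1 e2] [sp sp1 sq sq1] [hp [hp1 [hq hq1]]]]]]]] := H2plus_elim hf.
have [[/L2P[sf1 sf2] _ _] _ /HP[hL1 hL2]] := hf.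
have eR : ReF (fun x => calLplus f x + 6 * f x) = (fun x => 6 * ReF f x + ReF (calLplus f) x).
  by apply/funext => x; rewrite /ReF; case: (calLplus f x) (f x) => [a b] [c d] /=; ring.
have eI : ImF (fun x => calLplus f x + 6 * f x) = (fun x => 6 * ImF f x + ImF (calLplus f) x).
  by apply/funext => x; rewrite /ImF; case: (calLplus f x) (f x) => [a b] [c d] /=; ring.
have h1 := HRD (HRZ 6 (Sq_HR sf1)) hL1; have h2 := HRD (HRZ 6 (Sq_HR sf2)) hL2.
have key (g0 z z1 L : R -> R) : HR (fun x => 6 * g0 x + L x) -> aeeqr g0 z -> Sq z -> Sq z1 -> isAC z z1 ->
   isAC z1 (fun x => (6 * phi x ^+ 2 - 2) * z x - sech2 x * L x) ->
   z = Rp (fun x => 6 * g0 x + L x).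
  move=> hg e sz sz1 az az1; apply: (Rp_unique hg (conj az az1) sz sz1).
  apply: ae_map1 e => x h t; rewrite (h t) phi2E.
  by move: (sech2 x) (z x) (L x) => a b c; ring.
apply/aeeqcP; rewrite /RpC eR eI ReF_cx ImF_cx.
by rewrite -(key _ _ _ _ h1 e1 sp sp1 hp hp1) -(key _ _ _ _ h2 e2 sq sq1 hq hq1).
Qed.

Lemma smean_ae p q : HR p -> HR q -> aeeqr p q -> smean p = smean q.
Proof.
move=> hp hq e; apply: I_ae; [exact: Int_meas (HR_Int hp)|exact: Int_meas (HR_Int hq)|].
by apply: ae_map1 e => x h t; rewrite h.
Qed.

Lemma RmC_left f : H2minus f ->
  aeeqc f (RmC (fun x => calLminus f x + 2 * f x + smeanC f)).
Proof.
move=> hf; have [p [p1 [q [q1 [/aeeqcP[e1 e2] [sp sp1 sq sq1] [hp [hp1 [hq hq1]]]]]]]] := H2minus_elim hf.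
have [[/HP[sf1 sf2] _ _] _ /HP[hL1 hL2]] := hf.
pose rhs (g0 L : R -> R) := fun x => (2 * g0 x + L x) + smean g0.
have eR : ReF (fun x => calLminus f x + 2 * f x + smeanC f) = rhs (ReF f) (ReF (calLminus f)).
  apply/funext => x; rewrite /rhs /smeanC; move: (smean (ReF f)) (smean (ImF f)) => m m'.
  by rewrite /ReF; case: (calLminus f x) (f x) => [a b] [c d] /=; ring.
have eI : ImF (fun x => calLminus f x + 2 * f x + smeanC f) = rhs (ImF f) (ImF (calLminus f)).
  apply/funext => x; rewrite /rhs /smeanC; move: (smean (ReF f)) (smean (ImF f)) => m m'.
  by rewrite /ImF; case: (calLminus f x) (f x) => [a b] [c d] /=; ring.
have key (g0 z z1 L : R -> R) : HR g0 -> HR L -> aeeqr g0 z -> HR z -> Sq z1 -> isAC z z1 ->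
   isAC z1 (fun x => - (2 * sech2 x * z x) - sech2 x * L x) ->
   z = Rm (rhs g0 L).
  move=> hg hL e hz sz1 az az1.
  have hr : HR (rhs g0 L).
    apply: HRD; last exact: (HR_bounded (measc _) (fun=> lexx _)).
    by apply: HRD => //; exact: HRZ.
  have sm := smean_ae hg hz e.
  apply: (Rm_unique hr hz (conj az az1) sz1).
  apply: ae_map1 e => x h t; rewrite /rhs (h t) sm.
  by move: (sech2 x) (z x) (L x) (smean z) => a b c d; ring.
apply/aeeqcP; rewrite /RmC eR eI ReF_cx ImF_cx.
by rewrite -(key _ _ _ _ sf1 hL1 e1 sp sp1 hp hp1) -(key _ _ _ _ sf2 hL2 e2 sq sq1 hq hq1).
Qed.

End Domain.

(** * The parametrix of the stability operator *)

Section Operators.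
Variable R : realType.
Local Notation C := R[i].
Local Notation V := (HHt R).
Local Notation E := (HHspace R).
Local Notation phi := (@phi R).
Local Notation sech2 := (@sech2 R).
Implicit Types (f g : R -> C) (p q : R -> R) (x y z : V).

Lemma ReF_lin (a : C) f g : ReF (fun t => a * f t + g t) =
  (fun t => complex.Re a * ReF f t + (- complex.Im a * ImF f t + ReF g t)).
Proof.
apply/funext => t; rewrite /ReF /ImF.
by case: a (f t) (g t) => [? ?] [? ?] [? ?] /=; ring.
Qed.

Lemma ImF_lin (a : C) f g : ImF (fun t => a * f t + g t) =
  (fun t => complex.Re a * ImF f t + (complex.Im a * ReF f t + ImF g t)).
Proof.
apply/funext => t; rewrite /ReF /ImF.
by case: a (f t) (g t) => [? ?] [? ?] [? ?] /=; ring.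
Qed.

Lemma complexify_linear (K : (R -> R) -> R -> R) :
  (forall b p q, HR p -> HR q -> K (fun t => b * p t + q t) = (fun t => b * K p t + K q t)) ->
  forall (a : C) f g, HC f -> HC g ->
  cx (K (ReF (fun t => a * f t + g t))) (K (ImF (fun t => a * f t + g t))) =
  (fun t => a * cx (K (ReF f)) (K (ImF f)) t + cx (K (ReF g)) (K (ImF g)) t).
Proof.
move=> Klin a f g [f1 f2] [g1 g2]; rewrite ReF_lin ImF_lin !Klin //; first last.
- by apply: HRD => //; exact: HRZ.
- by apply: HRD => //; exact: HRZ.
apply/funext => t; rewrite /cx.
move: (K (ReF f) t) (K (ImF f) t) (K (ReF g) t) (K (ImF g) t) => u v u' v'.
by case: a => a b; apply/eqP; rewrite eq_complex /=; apply/andP; split; apply/eqP; ring.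
Qed.

Lemma RpC_linear (a : C) f g : HC f -> HC g ->
  RpC (fun t => a * f t + g t) = (fun t => a * RpC f t + RpC g t).
Proof. by apply: complexify_linear => b p q; exact: Rp_linear. Qed.

Lemma RmC_linear (a : C) f g : HC f -> HC g ->
  RmC (fun t => a * f t + g t) = (fun t => a * RmC f t + RmC g t).
Proof. by apply: complexify_linear => b p q; exact: Rm_linear. Qed.

Lemma smeanC_linear (a : C) f g : HC f -> HC g ->
  smeanC (fun t => a * f t + g t) = a * smeanC f + smeanC g.
Proof.
move=> [f1 f2] [g1 g2]; rewrite /smeanC ReF_lin ImF_lin !smean_linear //; first last.
- by apply: HRD => //; exact: HRZ.
- by apply: HRD => //; exact: HRZ.
move: (smean (ReF f)) (smean (ImF f)) (smean (ReF g)) (smean (ImF g)) => u v u' v'.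
by case: a => a b; apply/eqP; rewrite eq_complex /=; apply/andP; split; apply/eqP; ring.
Qed.

Lemma HC_N f : HC f -> HC (fun t => - f t).
Proof.
move=> [h1 h2]; split.
  have := HRZ (-1) h1; congr HR; apply/funext => t.
  by rewrite mulN1r /ReF; case: (f t).
have := HRZ (-1) h2; congr HR; apply/funext => t.
by rewrite mulN1r /ImF; case: (f t).
Qed.

Lemma HC_D f g : HC f -> HC g -> HC (fun t => f t + g t).
Proof. by move=> hf hg; have := HC_lin 1 hf hg; congr HC; apply/funext => t; rewrite mul1r. Qed.

Lemma HC_Z (a : C) f : HC f -> HC (fun t => a * f t).
Proof.
move=> hf; have h0 : HC (fun t => f t - f t) by apply: HC_D => //; exact: HC_N.
by have := HC_lin a hf h0; congr HC; apply/funext => t; rewrite subrr addr0.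
Qed.

Lemma HC_cst (a : C) : HC (fun=> a).
Proof. by split; apply: (HR_bounded (measc _) (fun=> lexx _)). Qed.

Definition pairHH f g (hf : HC f) (hg : HC g) : V :=
  HHT (introT (HHP (f, g)) (conj hf hg)).

(** The parametrix (F, G) |-> (- Rp G, Rm F). *)
Definition Top y : V :=
  pairHH (RpC_HC (HC_N (HH2 y))) (RmC_HC (HH1 y)).

Lemma Bop_HC2 y : HC (fun t => - (2 * (hval y).2 t) - smeanC (hval y).2).
Proof. by apply: HC_D; [exact/HC_N/HC_Z/HH2|exact: HC_cst]. Qed.

(** The error A - Top^-1, whose entries are - 2 - smean and 6 because L_+ and
    L_- are inverted only after adding 6 and 2 + smean. *)
Definition Bop y : V := pairHH (Bop_HC2 y) (HC_Z 6 (HH1 y)).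

Definition Dop : set V := [set x | stab_domain (hval x)].

(** The value 0 outside the domain is a dummy. *)
Definition Aop x : V := insubd 0 (stab_op (hval x)).

Lemma stab_op_HH (w : (R -> C) * (R -> C)) : stab_domain w -> stab_op w \in @HHpred R.
Proof.
move=> [[_ _ /HP h1] [_ _ /HP h2]]; apply/HHP; split=> //; exact: HC_N.
Qed.

Lemma hval_Aop x : Dop x -> hval (Aop x) = stab_op (hval x).
Proof. by move=> Dx; rewrite /Aop /insubd insubT ?stab_op_HH. Qed.

Lemma Top_linear : is_linear Top.
Proof.
move=> a x y; apply: val_inj => /=; congr (_, _); last exact: RmC_linear (HH1 x) (HH1 y).
have := RpC_linear a (HC_N (HH2 x)) (HC_N (HH2 y)).
apply: etrans; congr RpC; apply/funext => t /=; by rewrite [LHS]opprD mulrN.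
Qed.

Lemma Bop_linear : is_linear Bop.
Proof.
move=> a x y; apply: val_inj => /=; congr (_, _); apply/funext => t; last first.
  by rewrite [LHS]mulrDr mulrCA.
rewrite [smeanC _](smeanC_linear a (HH2 x) (HH2 y)).
move: (smeanC (hval x).2) (smeanC (hval y).2) => m m'.
have alg (u v : C) : - (2 * (a * u + v)) - (a * m + m') = a * (- (2 * u) - m) + (- (2 * v) - m').
  by ring.
exact: alg.
Qed.

(** The Carleman property of Rp and Rm: both are bounded pointwise by wmass.
    *)
Lemma resolvents_bound : exists2 c : R, 0 <= c & forall p, HR p -> forall t,
  Rp p t ^+ 2 <= c * nrm2 p /\ Rm p t ^+ 2 <= c * nrm2 p.
Proof.
have [C C0 hC] := Rm_bound R.
have wc : 0 <= wmass_const R by apply: I_ge0 => t; exact: sqr_ge0.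
exists ((1 + C ^+ 2) * wmass_const R); first by rewrite mulr_ge0 // addr_ge0 // sqr_ge0.
move=> p hp t.
have m0 := wmass_ge0 p; have m1 := wmass_le hp.
have C2 := sqr_ge0 C.
have sq (a b : R) : `|a| <= b -> 0 <= b -> a ^+ 2 <= b ^+ 2.
  by move=> h b0; rewrite -[a ^+ 2]real_normK ?num_real // ler_sqr ?nnegrE.
have n0 : 0 <= wmass_const R * nrm2 p by apply: le_trans m1; exact: sqr_ge0.
have b1 : `|Rp p t| <= wmass p.
  apply: le_trans (Rp_bound hp t) _; rewrite ler_pdivrMr ?w_gt0 //.
  by rewrite ler_peMr // w_ge1.
have b2 := hC p hp t.
have dist (k c n : R) : (1 + k) * c * n = c * n + k * (c * n) by ring.
split.
  apply: le_trans (sq _ _ b1 m0) _; apply: le_trans m1 _.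
  by rewrite dist lerDl mulr_ge0.
apply: le_trans (sq _ _ b2 (mulr_ge0 C0 m0)) _; rewrite exprMn.
apply: le_trans (ler_wpM2l C2 m1) _.
by rewrite dist lerDr.
Qed.

Lemma nrm2N p : nrm2 (fun t => - p t) = nrm2 p.
Proof. by apply: I_ext => t; rewrite sqrrN. Qed.

Lemma Top_carleman : exists c, carleman E c Top.
Proof.
have [c c0 hc] := resolvents_bound; exists c; split=> //; first exact: Top_linear.
move=> x t; have -> : weight t = 1 by [].
rewrite mulr1 sqnormE /HHnorm2.
have [[h1 h2] [h3 h4]] := (HH1 x, HH2 x).
have [n1 n2] := HC_N (HH2 x).
have N1 : nrm2 (ReF (fun t => - (hval x).2 t)) = nrm2 (ReF (hval x).2).
  by rewrite -nrm2N; congr nrm2; apply/funext => u; rewrite /ReF; case: ((hval x).2 u) => a b /=; rewrite opprK.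
have N2 : nrm2 (ImF (fun t => - (hval x).2 t)) = nrm2 (ImF (hval x).2).
  by rewrite -nrm2N; congr nrm2; apply/funext => u; rewrite /ImF; case: ((hval x).2 u) => a b /=; rewrite opprK.
rewrite mulrDr.
have q1 := mulr_ge0 c0 (nrm2_ge0 (ReF (hval x).1)); have q2 := mulr_ge0 c0 (nrm2_ge0 (ImF (hval x).1)).
have q3 := mulr_ge0 c0 (nrm2_ge0 (ReF (hval x).2)); have q4 := mulr_ge0 c0 (nrm2_ge0 (ImF (hval x).2)).
rewrite !mulrDr; case: t => t [].
  have [k1 _] := hc _ n1 t; have [k2 _] := hc _ n2 t.
  rewrite N1 in k1; rewrite N2 in k2.
  apply: le_trans (lerD k1 k2) _.
  by rewrite lerDr addr_ge0.
have [_ k1] := hc _ h1 t; have [_ k2] := hc _ h2 t.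
apply: le_trans (lerD k1 k2) _.
by rewrite lerDl addr_ge0.
Qed.

Lemma smean_sq p : HR p -> smean p ^+ 2 <= smass R * nrm2 p.
Proof.
move=> hp; have h1 : HR (fun=> 1 : R) by apply: (HR_bounded (measc _) (fun=> lexx _)).
have := CS h1.2 hp.2.
rewrite (@I_ext _ _ (fun t => sech2 t * p t)); last by move=> t; rewrite mulr1 mulrA -expr2 sech_sq.
rewrite [X in _ <= X * _](@I_ext _ _ sech2); last by move=> t; rewrite mulr1 sech_sq.
by rewrite -nrm2E.
Qed.

Lemma nrm2Z (a : R) p : HR p -> nrm2 (fun t => a * p t) = a ^+ 2 * nrm2 p.
Proof.
move=> hp; rewrite /nrm2 -I_Z; last exact: HR_Int2.
by apply: I_ext => t; rewrite exprMn mulrCA.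
Qed.

Lemma nrm2_affine p : HR p ->
  nrm2 (fun t => - (2 * p t) - smean p) <= (8 + 2 * smass R ^+ 2) * nrm2 p.
Proof.
move=> hp; have sq := smean_sq hp; have s0 := smass_gt0 R.
set k := smean p in sq *.
have hr : HR (fun t => - (2 * p t) - k).
  have := HRD (HRZ (- 2) hp) (HR_bounded (measc (- k)) (fun=> lexx _)); congr HR.
  by apply/funext => t; rewrite mulNr.
have i8 : Int (fun t => 8 * (sech2 t * p t ^+ 2)) by exact/IntZ/HR_Int2.
have ik : Int (fun t => 2 * k ^+ 2 * sech2 t) by exact/IntZ/Int_sech2.
have le1 : nrm2 (fun t => - (2 * p t) - k) <= 8 * nrm2 p + 2 * k ^+ 2 * smass R.
  rewrite /nrm2 /smass -(I_Z _ (HR_Int2 hp)) -(I_Z _ (Int_sech2 R)) -I_D //.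
  apply: I_le; [exact: HR_Int2|exact: IntD|] => t.
  have := ltW (sech2_gt0 t); move: (sech2 t) (p t) => s y s1.
  have -> : 8 * (s * y ^+ 2) + 2 * k ^+ 2 * s = s * (8 * y ^+ 2 + 2 * k ^+ 2) by ring.
  by rewrite ler_wpM2l //; have := sqr_ge0 (2 * y - k); lra.
apply: le_trans le1 _; have := ler_wpM2l (ltW s0) sq.
move: (nrm2 p) (smass R) (k ^+ 2) => n s K h; lra.
Qed.

Lemma Bop_bounded : bounded E Bop.
Proof.
exists (36 + (8 + 2 * smass R ^+ 2)); first by rewrite !addr_ge0 // mulr_ge0 ?sqr_ge0.
move=> x; rewrite !sqnormE /HHnorm2.
have [[h1 h2] [h3 h4]] := (HH1 x, HH2 x).
have -> : ReF (hval (Bop x)).1 = (fun t => - (2 * ReF (hval x).2 t) - smean (ReF (hval x).2)).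
  apply/funext => t; rewrite /= {1}/ReF /smeanC; move: (smean _) (smean _) => m m'.
  by rewrite /ReF; case: ((hval x).2 t) => a b /=; ring.
have -> : ImF (hval (Bop x)).1 = (fun t => - (2 * ImF (hval x).2 t) - smean (ImF (hval x).2)).
  apply/funext => t; rewrite /= {1}/ImF /smeanC; move: (smean _) (smean _) => m m'.
  by rewrite /ImF; case: ((hval x).2 t) => a b /=; ring.
have -> : ReF (hval (Bop x)).2 = (fun t => 6 * ReF (hval x).1 t).
  by apply/funext => t; rewrite /ReF /=; case: ((hval x).1 t) => a b /=; ring.
have -> : ImF (hval (Bop x)).2 = (fun t => 6 * ImF (hval x).1 t).
  by apply/funext => t; rewrite /ImF /=; case: ((hval x).1 t) => a b /=; ring.
rewrite (nrm2Z _ h1) (nrm2Z _ h2).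
have := nrm2_affine h3; have := nrm2_affine h4.
have := nrm2_ge0 (ReF (hval x).1); have := nrm2_ge0 (ImF (hval x).1).
have := nrm2_ge0 (ReF (hval x).2); have := nrm2_ge0 (ImF (hval x).2).
move: (nrm2 (ReF (hval x).1)) (nrm2 (ImF (hval x).1)) (nrm2 (ReF (hval x).2)) (nrm2 (ImF (hval x).2)).
have := sqr_ge0 (smass R).
move: (nrm2 _) (nrm2 _) (smass R ^+ 2) => u v s s0 a b c d d0 c0 b0 a0 hu hv.
have -> : (36 + (8 + 2 * s)) * (a + b + (c + d)) = (8 + 2 * s) * d + (8 + 2 * s) * c +
  36 * (a + b) + ((8 + 2 * s) * (a + b) + 36 * (c + d)) by ring.
have : 0 <= (8 + 2 * s) * (a + b) + 36 * (c + d) by rewrite addr_ge0 ?mulr_ge0 ?addr_ge0 ?mulr_ge0.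
lra.
Qed.

Lemma aeeqcW f g : f =1 g -> aeeqc f g.
Proof. by move=> h; apply: aeW => t _; exact: h. Qed.

Lemma aeeqc_trans f g h : aeeqc f g -> aeeqc g h -> aeeqc f h.
Proof. by apply: ae_map2 => t h1 h2 u; rewrite h1 // h2. Qed.

Lemma Top_domain y : Dop (Top y) /\ eqv E (Aop (Top y)) (y + Bop (Top y)).
Proof.
have [d1 e1] := RpC_domain (HC_N (HH2 y)); have [d2 e2] := RmC_domain (HH1 y).
have Dy : Dop (Top y) by [].
split=> //; apply/eqv_aeeq; rewrite hval_Aop //; split.
  apply: aeeqc_trans e2 _; apply: aeeqcW => t.
  by rewrite -addrA.
have alg (L u v : C) : L = - u - 6 * v -> - L = u + 6 * v by move=> ->; ring.
apply: (ae_map1 _ e1) => t h u.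
change (- calLplus (hval (Top y)).1 t = (hval y).2 t + 6 * (hval (Top y)).1 t).
by apply: alg; exact: h u.
Qed.

Lemma Top_left x : Dop x -> eqv E x (Top (Aop x - Bop x)).
Proof.
move=> Dx; apply/eqv_aeeq; have [d1 d2] := Dx.
have hA := hval_Aop Dx.
have e1 : (hval (Aop x - Bop x)).1 = (fun t => calLminus (hval x).2 t + 2 * (hval x).2 t + smeanC (hval x).2).
  rewrite [LHS](_ : _ = (hval (Aop x)).1 - (hval (Bop x)).1) // hA.
  have alg (L u m : C) : L - (- (2 * u) - m) = L + 2 * u + m by ring.
  by apply/funext => t; exact: alg.
have e2 : (fun t => - (hval (Aop x - Bop x)).2 t) = (fun t => calLplus (hval x).1 t + 6 * (hval x).1 t).
  rewrite [X in fun t => - X t](_ : _ = (hval (Aop x)).2 - (hval (Bop x)).2) // hA.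
  have alg (L u : C) : - (- L - 6 * u) = L + 6 * u by ring.
  by apply/funext => t; exact: alg.
by split; [have := RpC_left d1; rewrite -e2|have := RmC_left d2; rewrite -e1].
Qed.

(** Taking real and imaginary parts of A (u, v) = (1 + i) (u, v) gives the
    four equations of [no_eigenvector]. *)
Lemma lam0_regular x : Dop x -> eqv E (Aop x) ((1 +i* 1) *: x) -> eqv E x 0.
Proof.
move=> Dx /eqv_aeeq; rewrite hval_Aop // => -[/aeeqcP[em1 em2] /aeeqcP[ep1 ep2]].
have [d1 d2] := Dx; have [[h1 h2] [h3 h4]] := (HH1 x, HH2 x).
set u := (hval x).1 in d1 h1 h2 em1 em2 ep1 ep2.
set v := (hval x).2 in d2 h3 h4 em1 em2 ep1 ep2.
have [a [a1 [b [b1 [/aeeqcP[ea eb] [sa sa1 sb sb1] [ha [ha1 [hb hb1]]]]]]]] := H2plus_elim d1.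
have [c [c1 [d [d1' [/aeeqcP[ec ed] [sc sc1 sd sd1] [hc [hc1 [hd hd1]]]]]]]] := H2minus_elim d2.
rewrite ReF_cx in ea ec; rewrite ImF_cx in eb ed.
have Rel (z : C) : complex.Re ((1 +i* 1) * z) = complex.Re z - complex.Im z.
  by case: z => ? ?; rewrite /= !mul1r.
have Iml (z : C) : complex.Im ((1 +i* 1) * z) = complex.Re z + complex.Im z.
  by case: z => ? ?; rewrite /= !mul1r addrC.
have ReN (z : C) : complex.Re (- z) = - complex.Re z by case: z.
have ImN (z : C) : complex.Im (- z) = - complex.Im z by case: z.
have {}em1 : aeeqr (ReF (calLminus v)) (fun t => a t - b t).
  apply: (@ae_trans _ (fun t => ReF u t - ImF u t)); last exact: (@ae_comp2 R (fun _ r s => r - s) _ _ _ _ ea eb).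
  by apply: ae_map1 em1 => t h w; exact: (etrans (h w) (Rel (u t))).
have {}em2 : aeeqr (ImF (calLminus v)) (fun t => a t + b t).
  apply: (@ae_trans _ (fun t => ReF u t + ImF u t)); last exact: (@ae_comp2 R (fun _ r s => r + s) _ _ _ _ ea eb).
  by apply: ae_map1 em2 => t h w; exact: (etrans (h w) (Iml (u t))).
have {}ep1 : aeeqr (fun t => - ReF (calLplus u) t) (fun t => c t - d t).
  apply: (@ae_trans _ (fun t => ReF v t - ImF v t)); last exact: (@ae_comp2 R (fun _ r s => r - s) _ _ _ _ ec ed).
  by apply: ae_map1 ep1 => t h w; exact: (etrans (esym (ReN (calLplus u t))) (etrans (h w) (Rel (v t)))).
have {}ep2 : aeeqr (fun t => - ImF (calLplus u) t) (fun t => c t + d t).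
  apply: (@ae_trans _ (fun t => ReF v t + ImF v t)); last exact: (@ae_comp2 R (fun _ r s => r + s) _ _ _ _ ec ed).
  by apply: ae_map1 ep2 => t h w; exact: (etrans (esym (ImN (calLplus u t))) (etrans (h w) (Iml (v t)))).
have ra := Sq_HR sa; have rb := Sq_HR sb.
have HRB p q : HR p -> HR q -> HR (fun t => p t - q t).
  by move=> hp hq; have := HRD (HRZ (- 1) hq) hp; congr HR; apply/funext => t; rewrite mulN1r addrC.
have mplus p q : HR p -> HR q -> meas (fun t => (6 * phi t ^+ 2 - 2) * p t + sech2 t * q t).
  move=> hp hg; apply: measD; last by apply: Int_meas; exact: HR_Int.
  by apply: measM; [exact: meas_potential|exact: hp.1].
have mminus p q : HR p -> HR q -> meas (fun t => - (2 * sech2 t * p t) - sech2 t * q t).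
  move=> hp hg; apply: measB; last by apply: Int_meas; exact: HR_Int.
  apply: measN; apply: measM; last exact: hp.1.
  by apply: measM; [exact: measc|exact: meas_sech2].
have pl p p1 L q : Sq p -> Sq p1 -> HR q -> isAC p p1 ->
    isAC p1 (fun t => (6 * phi t ^+ 2 - 2) * p t - sech2 t * L t) ->
    aeeqr (fun t => - L t) q -> plus_eq p p1 q.
  move=> sp sp1 hg hp hp1 e; split=> //.
  apply: AC_ae hp1 (mplus _ _ (Sq_HR sp) hg) _; apply: ae_map1 e => t h w.
  by rewrite -(h w) mulrN.
have mi p p1 L q : HR p -> Sq p1 -> HR q -> isAC p p1 ->
    isAC p1 (fun t => - (2 * sech2 t * p t) - sech2 t * L t) ->
    aeeqr L q -> minus_eq p p1 q.
  move=> sp sp1 hg hp hp1 e; split=> //.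
  apply: AC_ae hp1 (mminus _ _ sp hg) _; apply: ae_map1 e => t h w.
  by rewrite -(h w).
have [z1 z2 z3 z4] := no_eigenvector
  (pl _ _ _ _ sa sa1 (HRB _ _ sc sd) ha ha1 ep1) (pl _ _ _ _ sb sb1 (HRD sc sd) hb hb1 ep2)
  (mi _ _ _ _ sc sc1 (HRB _ _ ra rb) hc hc1 em1) (mi _ _ _ _ sd sd1 (HRD ra rb) hd hd1 em2).
apply/eqv_aeeq; split; apply/aeeqcP; split.
- exact: ae_trans ea z1.
- exact: ae_trans eb z2.
- exact: ae_trans ec z3.
- exact: ae_trans ed z4.
Qed.

End Operators.

(** * The spectrum *)

Section StabilitySpectrum.
Variable R : realType.
Local Notation C := R[i].
Local Notation V := (HHt R).
Local Notation E := (HHspace R).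
Local Notation D := (@stab_domain R).
Local Notation A := (@stab_op R).
Local Notation lam0 := (1 +i* 1 : C).
Local Notation stab_eigen := (eigen E (@Dop R) (@Aop R)).

Lemma stab_domain_HH w : D w -> w \in @HHpred R.
Proof.
move=> [[[h1 _ _] _ _] [[h2 _ _] _ _]]; apply/HHP; split; last exact/HP.
by have /L2P[s1 s2] := h1; split; exact: Sq_HR.
Qed.

Lemma hval_sub lam (x : V) : Dop x ->
  hval (Aop x - lam *: x) = A (hval x) - lam *: hval x.
Proof. by move=> Dx; rewrite -(hval_Aop Dx). Qed.

Lemma not_eigen_resolvent_set lam : ~ stab_eigen lam -> resolvent_set D A lam.
Proof.
have [c Tc] := Top_carleman R.
move=> /(not_eigen_resolvent Tc (@Bop_linear R) (@Bop_bounded R) (@Top_domain R) (@Top_left R)).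
move=> [surj inj [b b0 hb]]; split.
- move=> F hF; have hF' : F \in @HHpred R by apply/asboolP.
  have [x Dx /eqv_aeeq] := surj (HHT hF'); rewrite hval_sub // => e.
  by exists (hval x).
- move=> w z Dw Dz e.
  have := inj (HHT (stab_domain_HH Dw)) (HHT (stab_domain_HH Dz)) Dw Dz.
  by rewrite !eqv_aeeq !hval_sub //; apply.
- exists (Num.sqrt b) => w Dw; have := hb (HHT (stab_domain_HH Dw)) Dw.
  set x := HHT _; rewrite -[w]/(hval x) -hval_sub // !normHHE => h.
  by rewrite -sqrtrM // ler_wsqrtr.
Qed.

Lemma spectrum_eigen lam : @stab_spectrum R lam -> stab_eigen lam.
Proof. by move=> h; apply: contrapT => /not_eigen_resolvent_set. Qed.

Lemma eigen_eigenvalue_of lam : stab_eigen lam -> eigenvalue_of D A lam.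
Proof.
move=> [x [Dx nx hx]]; exists (hval x); split=> //.
  by move=> h; apply: nx; apply/eqv_aeeq.
by have /eqv_aeeq := hx; rewrite hval_Aop.
Qed.

Lemma ker_pow_root_space lam k (x : V) : ker_pow D A lam k (hval x) ->
  root_space E (@Dop R) (@Aop R) lam k x.
Proof.
elim: k x => [|k IH] x /=; first by move=> h; apply/eqv_aeeq.
by move=> [Dx]; rewrite -hval_sub // => /IH.
Qed.

Lemma hval_sum n (c : 'I_n -> C) (e : 'I_n -> V) :
  hval (\sum_(i < n) c i *: e i) = \sum_(i < n) c i *: hval (e i).
Proof. by apply: (big_morph (@hval R)). Qed.

(** A vector of order at least 1 lies in the domain, hence is a vector of
    [HHt]. The order 0 only says that w vanishes almost everywhere; such a w
    need not be measurable, and the null combination represents it. *)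
Lemma stab_finite_multiplicity lam : finite_multiplicity D A lam.
Proof.
have [c Tc] := Top_carleman R.
have [s hs] := root_space_finite Tc (@Bop_linear R) (@Bop_bounded R)
  (@Top_domain R) (@Top_left R) (@lam0_regular R) lam.
exists (size s), (fun i => hval (nth 0 s i)) => -[|k] w hw.
  by exists (fun=> 0); rewrite big1 // => i _; rewrite scale0r.
have Dw : D w by case: hw.
pose x : V := HHT (stab_domain_HH Dw).
have hx : inspan E s x by apply: (hs k.+1); exact: ker_pow_root_space.
exists (fun i => ip E (nth 0 s i) x); rewrite -hval_sum -[w]/(hval x).
by apply/eqv_aeeq; move: hx; rewrite /inspan /proj (big_nth 0) big_mkord.
Qed.

(** A longest list of eigenvalues in the disc contains them all. *)
Lemma eigen_finite_list (M : R) : exists L : seq C,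
  forall lam, stab_eigen lam -> sqmod (lam - lam0) <= M -> lam \in L.
Proof.
have [c Tc] := Top_carleman R.
have [N hN] := eigen_discrete Tc (@Bop_linear R) (@Bop_bounded R)
  (@Top_domain R) (@Top_left R) (@lam0_regular R) M.
pose P n := exists L : seq C, [/\ uniq L, (forall lam, lam \in L ->
  stab_eigen lam /\ sqmod (lam - lam0) <= M) & size L = n].
have P0 : P 0%N by exists [::].
have Pb n : P n -> (n <= N)%N by move=> [L [uL hL <-]]; exact: hN.
have [m [L [uL hL sL]] hm] := bounded_nat_max P0 Pb.
exists L => lam el lM; apply: contrapT => /negP nL.
have : (m.+1 <= m)%N; last by rewrite ltnn.
apply: hm; exists (lam :: L); split; last by rewrite /= sL.
  by rewrite cons_uniq nL.
by move=> nu; rewrite inE => /predU1P[->|]; [split|exact: hL].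
Qed.

Lemma sqmod_ball (a z : C^o) : ball a 1 z -> sqmod (a - z) <= 1.
Proof.
rewrite -ball_normE /= => /ltW.
case: (a - z) => u v.
rewrite normc_def lecE /= => /andP[_ h].
rewrite /sqmod /=; set s := u ^+ 2 + v ^+ 2 in h *.
have s0 : 0 <= s by rewrite addr_ge0 // sqr_ge0.
by rewrite -(sqr_sqrtr s0) -[X in _ <= X](expr1n _ 2) ler_sqr ?nnegrE ?sqrtr_ge0.
Qed.

Lemma spectrum_punctured_nbhs (lam : C^o) :
  exists2 U, nbhs lam U & forall nu, U nu -> @stab_spectrum R nu -> nu = lam.
Proof.
(* This disc about 1 + i contains the unit disc about lam, by |z + z'|^2 <= 2
   |z|^2 + 2 |z'|^2. *)
have [L hL] := eigen_finite_list (2 * sqmod (lam - lam0) + 2).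
pose F : set C^o := [set` L] `\ lam.
have cF : closed F.
  have /accessible_finite_set_closed : accessible_space (C^o : topologicalType).
    by apply: hausdorff_accessible; exact: norm_hausdorff.
  by apply; apply: finite_setD; exact: finite_seq.
exists (ball lam 1 `&` ~` F).
  apply: filterI; first exact: nbhsx_ballx.
  by apply: open_nbhs_nbhs; split; [exact: closed_openC|by case=> _; apply].
move=> nu [bnu nF] snu; apply: contrapT => ne; apply: nF; split=> //.
apply: hL; first exact: spectrum_eigen.
have -> : nu - lam0 = (lam - lam0) - (lam - nu) by ring.
apply: le_trans (sqmodD _ _) _; rewrite sqmodN.
have := sqmod_ball bnu; lra.
Qed.

End StabilitySpectrum.

Theorem theorem5 (R : realType) :
  (forall lam : R[i], @stab_spectrum R lam ->
     [/\ isolated (@stab_spectrum R) lam,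
         eigenvalue_of (@stab_domain R) (@stab_op R) lam &
         finite_multiplicity (@stab_domain R) (@stab_op R) lam]) /\
  limit_point (@stab_spectrum R) = set0.
Proof.
split.
  move=> lam slam; split; [|exact/eigen_eigenvalue_of/spectrum_eigen|exact: stab_finite_multiplicity].
  split; first exact/mem_set.
  have [U nU hU] := spectrum_punctured_nbhs lam; exists U => //.
  apply/seteqP; split=> [nu [] //|nu ->]; first exact: hU.
  by split=> //; exact: (@nbhs_singleton (R[i]^o) _ _ nU).
apply/seteqP; split=> // lam hlam.
have [U nU hU] := spectrum_punctured_nbhs lam.
have [nu [ne snu Unu]] := hlam U nU.
by move: ne; rewrite (hU _ Unu snu) eqxx.
Qed.
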